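(* Let $k$ be an algebraically closed field, $n\ge 2$, $G=\mathrm{GL}_n(k)$ and $\mathfrak g=\mathfrak{gl}_n(k)$. Let $\lambda$ be a partition of $r$ with length $\le n-1$. (i) The $u_T$, $T$ running over the semi-standard tableaux of shape $\lambda$ with entries in $\{1,\ldots,n-1\}$, form a basis of the $k[\mathfrak g]^G$-module $k[\mathfrak g]^U_{[(r),\lambda]}$. The same holds for the $\tilde u_T$. (ii) The $v_T$, $T$ running over the semi-standard tableaux of shape $\lambda$ with entries in $\{1,\ldots,n-1\}$, form a basis of the $k[\mathfrak g]^G$-module $k[\mathfrak g]^U_{[\lambda,(r)]}$. The same holds for the $\tilde v_T$.
   Context: **Group actions and weights.** $G$ acts on $\mathfrak g$ by conjugation and on the algebra $k[\mathfrak g]$ of polynomial functions (a polynomial algebra in the matrix entry functions $x_{ij}$) by $(g\cdot f)(A)=f(g^{-1}Ag)$. $k[\mathfrak g]^G$ is the algebra of $G$-invariants. $U\subseteq G$ is the subgroup of upper unitriangular matrices and $H\subseteq G$ the subgroup of invertible diagonal matrices. Characters of $H$ (''weights'') are identified with elements of $\mathbb Z^n$: $\chi=(\chi_1,\ldots,\chi_n)$ corresponds to $S\mapsto\prod_i S_{ii}^{\chi_i}$. For a weight $\chi$, $k[\mathfrak g]^U_\chi$ is the space of $f\in k[\mathfrak g]$ that are fixed by $U$ and satisfy $S\cdot f=\chi(S)f$ for all $S\in H$; it is a $k[\mathfrak g]^G$-module. **Partitions and tableaux.** Partitions of length $\le n$ (length = number of nonzero parts) are regarded as elements of $\mathbb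 Z^n$ by extending with zeros. For $\lambda,\mu\in\mathbb Z^n$, $[\lambda,\mu]=\lambda-\mu^{\rm rev}$, where $\mu^{\rm rev}$ is the reversed $n$-tuple. $(r)$ is the partition with single part $r$ (viewed as $(r,0,\ldots,0)\in\mathbb Z^n$). The shape of $\lambda$ is $\{(i,j)\mid 1\le i\le l(\lambda),\,1\le j\le\lambda_i\}$, where $l(\lambda)$ is the length of $\lambda$; a tableau of shape $\lambda$ with entries in a set $I$ of integers is a function from this shape to $I$, with rows and columns as for matrices. It is semi-standard if its entries are strictly increasing down the columns and weakly increasing in the rows from left to right. **The semi-invariants.** For $m\ge0$ let $s_m\in k[\mathfrak g]$ be $s_m(A)=\mathrm{tr}(\wedge^m A)$, and let $\partial_{ij}$ be partial differentiation with respect to $x_{ij}$. Let $e_1,\ldots,e_n$ be the standard basis of $k^n$ and let $A'$ denote the transpose of $A$. For a one-column tableau $T$ of length $l$ with entries $t_1,\ldots,t_l\in\{1,\ldots,n-1\}$ (from top to bottom) define functions on $\mathfrak{gl}_n$ by $$u_T=\det\big((\partial_{1i}s_{t_j+1})_{n-l+1\le i\le n,\,1\le j\le l}\big),\qquad v_T=\det\big((\partial_{in}s_{t_j+1})_{1\le i\le l,\,1\le j\le l}\big),$$ $$\tilde u_T(A)=\det\big(A^{t_1}(e_1)|\cdots|A^{t_l}(e_1)\big)_{l\ge},\qquad \tilde v_T(A)=\det\big(A'^{\,t_1}(e_n)|\cdots|A'^{\,t_l}(e_n)\big)_{l\le},$$ where the subscripts ''$l\ge$'' and ''$l\le$'' mean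 that one takes the last, respectively first, $l$ rows of the $n\times l$ matrix before taking the determinant. For an arbitrary tableau $T$ of shape $\lambda$ with entries in $\{1,\ldots,n-1\}$ and columns $T^1,\ldots,T^{\lambda_1}$, define $u_T=\prod_i u_{T^i}$, $v_T=\prod_i v_{T^i}$, $\tilde u_T=\prod_i\tilde u_{T^i}$, $\tilde v_T=\prod_i\tilde v_{T^i}$ (empty products are $1$). *)

(* Defs.v *)
From mathcomp Require Import all_boot all_order all_algebra.
From mathcomp Require Export mpoly.

Set Implicit Arguments.
Unset Strict Implicit.
Unset Printing Implicit Defensive.

Import GRing.Theory.
Local Open Scope ring_scope.

(* gl_n is taken with n of the form n'.+1, so that 'I_n has a first and a last
   element; all indices are 0-based: x_{ij} is [xvar (i-1) (j-1)]. *)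

Section GenericMatrix.
Variables (k : fieldType) (n' : nat).
Local Notation n := n'.+1.

Definition polyfun := {mpoly k[n * n]}.

Definition xvar (i j : 'I_n) : polyfun := 'X_(mxvec_index i j).

Definition xmx : 'M[polyfun]_n := \matrix_(i, j) xvar i j.

Definition evalmx (f : polyfun) (A : 'M[k]_n) : k := f.@[mxvec A 0].

(* [f \mPo lq] substitutes the entries of g^-1 X g for those of X;
   see [evalmx_conj_act]. *)
Definition conj_act (g : 'M[k]_n) (f : polyfun) : polyfun :=
  let Y : 'M[polyfun]_n :=
    map_mx (@mpolyC _ k) (invmx g) *m xmx *m map_mx (@mpolyC _ k) g in
  f \mPo [tuple mxvec Y 0 p | p < n * n].

Lemma evalmx_conj_act g f A :
  evalmx (conj_act g f) A = evalmx f (invmx g *m A *m g).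
Proof.
rewrite /evalmx /conj_act comp_mpoly_meval; apply/meval_eq => p.
rewrite tnth_mktuple; case/mxvec_indexP: p => i j; rewrite !mxvecE !mxE.
rewrite rmorph_sum; apply: eq_bigr => a _.
rewrite rmorphM /= !mxE mevalC rmorph_sum; congr (_ * _).
by apply: eq_bigr => b _; rewrite rmorphM /= !mxE mevalC mevalXU mxvecE.
Qed.

Definition invariant (f : polyfun) : Prop :=
  forall g : 'M[k]_n, g \in unitmx -> conj_act g f = f.

Definition upper_unitriangular (g : 'M[k]_n) : Prop :=
  (forall i, g i i = 1) /\ (forall i j : 'I_n, (j < i)%N -> g i j = 0).

Definition weight := 'I_n -> int.

Definition weight_char (chi : weight) (S : 'M[k]_n) : k :=
  \prod_(i < n) S i i ^ chi i.

Definition U_weight_space (chi : weight) (f : polyfun) : Prop :=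
  (forall g, upper_unitriangular g -> conj_act g f = f) /\
  (forall S, is_diag_mx S -> S \in unitmx ->
     conj_act S f = weight_char chi S *: f).

Lemma U_weight_space_submod chi (c f g : polyfun) :
  invariant c -> U_weight_space chi f -> U_weight_space chi g ->
  U_weight_space chi (c * f + g).
Proof.
have actE h a b d : conj_act h (a * b + d)
    = conj_act h a * conj_act h b + conj_act h d.
  by rewrite /conj_act rmorphD rmorphM.
move=> cI [fU fH] [gU gH]; split=> [h hU|S dS uS]; rewrite actE.
  have uh : h \in unitmx.
    rewrite -unitmx_tr unitmxE det_trig.
      by rewrite big1 ?unitr1 // => i _; rewrite mxE hU.1.
    by apply/is_trig_mxP => i j ij; rewrite mxE hU.2.
  by rewrite cI // fU // gU.
by rewrite cI // fH // gH // scalerDr scalerAr.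
Qed.

End GenericMatrix.

Arguments U_weight_space k {n'} chi f.

Definition is_partition_of (r : nat) (la : seq nat) : Prop :=
  [/\ sorted geq la, 0%N \notin la & sumn la = r].

Definition pad_weight (n' : nat) (la : seq nat) : weight n' :=
  fun i => (nth 0%N la i)%:Z.

Arguments pad_weight : clear implicits.

Definition bracket (n' : nat) (la mu : weight n') : weight n' :=
  fun i => la i - mu (rev_ord i).

Section Tableaux.
Variables (n' : nat) (la : seq nat).
Local Notation n := n'.+1.

Definition shape :=
  {p : 'I_(size la) * 'I_(head 0%N la) | (p.2 < nth 0%N la p.1)%N}.

(* 'I_n contains 0, which is not an allowed entry: it is excluded by
   [pos_entries]. *)
Definition tableau := {ffun shape -> 'I_n}.

Definition pos_entries (T : tableau) : bool := [forall p, (0 < T p)%N].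

Definition semistandard (T : tableau) : bool :=
  [forall p : shape, forall q : shape,
    ((((val p).2 == (val q).2) && ((val p).1 < (val q).1)%N) ==> (T p < T q)%N)
    && ((((val p).1 == (val q).1) && ((val p).2 < (val q).2)%N)
          ==> (T p <= T q)%N)].

Definition ssyt := {T : tableau | pos_entries T && semistandard T}.

(* [insub (i, c)] is [None] when the cell (i, c) is outside the shape. *)
Definition column (T : tableau) (c : 'I_(head 0%N la)) : seq nat :=
  pmap (fun i => omap (fun p : shape => nat_of_ord (T p)) (insub (i, c)))
       (enum 'I_(size la)).

End Tableaux.

Section ExteriorPower.
Variables (R : comNzRingType) (n : nat).

Definition increasing_tuples (m : nat) : {set m.-tuple 'I_n} :=
  [set t : m.-tuple 'I_n | sorted ltn (map val t)].

(* Matrix of the m-th exterior power of A in the basis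
   e_{i_1} /\ ... /\ e_{i_m}, i_1 < ... < i_m: by multilinearity,
   A e_{j_1} /\ ... /\ A e_{j_m} is the sum over I of
   det(A_{i_a j_b})_{a,b} e_{i_1} /\ ... /\ e_{i_m}. *)
Definition exterior_power_mx (m : nat) (A : 'M[R]_n) :
    'M[R]_#|increasing_tuples m| :=
  \matrix_(I, J) \det (\matrix_(a < m, b < m)
    A (tnth (enum_val I) a) (tnth (enum_val J) b)).

End ExteriorPower.

Section SemiInvariants.
Variables (k : fieldType) (n' : nat).
Local Notation n := n'.+1.
Local Notation kg := (polyfun k n').

(* [inord] is only used in range, i.e., for l <= n. *)
Definition last_rows (l : nat) (M : 'M[kg]_(n, l)) : 'M[kg]_l :=
  \matrix_(a < l, b < l) M (inord (n - l + a)) b.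

Definition first_rows (l : nat) (M : 'M[kg]_(n, l)) : 'M[kg]_l :=
  \matrix_(a < l, b < l) M (inord a) b.

Definition s_ (m : nat) : kg := \tr (exterior_power_mx m (xmx k n')).

Definition partial (i j : 'I_n) (f : kg) : kg := f^`M(mxvec_index i j).

Definition u_col (t : seq nat) : kg :=
  \det (last_rows (\matrix_(i < n, j < size t)
    partial ord0 i (s_ (nth 0%N t j).+1))).

Definition v_col (t : seq nat) : kg :=
  \det (first_rows (\matrix_(i < n, j < size t)
    partial i ord_max (s_ (nth 0%N t j).+1))).

Definition std_basis (i : 'I_n) : 'cV[kg]_n := delta_mx i 0.

Definition ut_col (t : seq nat) : kg :=
  \det (last_rows (\matrix_(i < n, j < size t)
    (xmx k n' ^+ nth 0%N t j *m std_basis ord0) i 0)).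

Definition vt_col (t : seq nat) : kg :=
  \det (first_rows (\matrix_(i < n, j < size t)
    ((xmx k n')^T ^+ nth 0%N t j *m std_basis ord_max) i 0)).

Definition tableau_prod (F : seq nat -> kg) (la : seq nat) (T : tableau n' la) :
    kg :=
  \prod_(c < head 0%N la) F (column T c).

(* The family [b] is a basis of the k[g]^G-module given by [M] (a subset of
   k[g] stable under multiplication by invariants). *)
Definition invariant_basis (I : finType) (M : kg -> Prop) (b : I -> kg) : Prop :=
  [/\ forall i, M (b i),
      forall f, M f ->
        exists2 c : I -> kg, (forall i, invariant (c i)) & f = \sum_i c i * b i
    & forall c : I -> kg, (forall i, invariant (c i)) ->
        \sum_i c i * b i = 0 -> forall i, c i = 0].

End SemiInvariants.

Section TableauProducts.
Variables (k : fieldType) (n' : nat) (la : seq nat) (T : ssyt n' la).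

Definition u_ := tableau_prod (@u_col k n') (val T).
Definition v_ := tableau_prod (@v_col k n') (val T).
Definition ut_ := tableau_prod (@ut_col k n') (val T).
Definition vt_ := tableau_prod (@vt_col k n') (val T).

End TableauProducts.

Arguments u_ k {n' la} T.
Arguments v_ k {n' la} T.
Arguments ut_ k {n' la} T.
Arguments vt_ k {n' la} T.

(* Main.v *)
Require Import Defs.
From mathcomp Require Import all_boot all_order all_algebra.
From mathcomp Require Import perm zify.

Set Implicit Arguments.
Unset Strict Implicit.
Unset Printing Implicit Defensive.

Import Order.TTheory GRing.Theory.
Local Open Scope ring_scope.

(** Indices start at 0, so e_0 is the first basis vector. The frame of a matrix A
is the matrix F(A) with columns e_0, A e_0, A^2 e_0, and so on, multiplied on
the right by an invertible matrix Tau(chi_A) which has first column e_0 and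
whose entries are polynomials in the coefficients of the characteristic
polynomial chi_A. For Tau = 1 the bottom minors of F(A) are the functions with
a tilde. The gradient of the trace of an exterior power is up to sign a
coefficient of adj(X - A) ([partial_s]), so for another, triangular, choice of
Tau the columns of F(A) contain the derivatives that define the functions u.
Both families are therefore products of bottom minors of a frame, one minor for
each column of a tableau, and are treated together.

If g is invertible with g e_0 = al e_0, then conjugating A by g multiplies the
frame on the left by g and divides it by al ([frame_conj]). For upper
triangular g this gives the weight of the products of bottom minors
([frame_tableau_weight]). Let C(c) be the companion matrix with coefficients c
transported by Tau. Then A F(A) = F(A) C(chi_A) ([mul_frame]), and every
invertible g fixing e_0 is the frame of g C(c) g^-1 ([frame_of_conj]). So the
matrices with an invertible frame, which are dense, are parametrized by
characteristic polynomials and frames.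

Let f be a weight vector. A frame has first column e_0, so by invariance under
unitriangular matrices f(A) depends only on chi_A and on the lower right block
h of F(A): it is the value of f at h C(chi_A) h^-1, where h is bordered by the
identity. Multiplied by det(h)^d, with d the size of f, this is a polynomial in
the entries of h over the polynomials in c ([hom_pol]), and the weight of f
makes it semi-invariant under upper triangular row operations
([hom_pol_semi_inv]).

It remains to see that the semi-invariants of this weight are det(h)^d times
the unique combinations of bideterminants of semistandard tableaux. This is
done with leading monomials for a lexicographic order. Applied to a matrix with
well chosen parameters, semi-invariance forces interlacing inequalities between
the exponents of consecutive rows in a leading monomial ([lead_pattern]); the
exponents allowed by them are exactly the row contents of semistandard tableaux
with d full columns added ([pattern_tableau]); and the corresponding products of
minors have precisely these leading monomials, with coefficient a sign
([bottom_minor_lead]). Distinct tableaux have distinct row contents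
([tableau_mnm_inj]). Division gives generation ([semi_inv_span]) and comparison
of leading terms gives independence ([tableau_poly_indep]). Substituting
F(A) for h and chi_A for c expresses f with coefficients that are polynomials
in the coefficients of chi_A, hence invariant ([weight_vector_span]); an
invariant is constant on the conjugates of C(c), so a relation with invariant
coefficients gives one between bideterminants with constant coefficients
([frame_tableau_indep]).

The functions v are obtained from the functions u, up to a common sign, by the
reflection in the antidiagonal, an anti-automorphism of the matrix algebra that
preserves the unitriangular group and exchanges the two weights
([twist_basis], [twist_tableau]). *)

(** * Polynomial identities over an infinite field *)

Definition infinite_type (T : eqType) := forall s : seq T, exists x, x \notin s.

Lemma closed_field_infinite (k : closedFieldType) : infinite_type k.
Proof.
(* the factor 'X keeps p from being constant when s is empty *)
move=> s; pose p : {poly k} := 'X * \prod_(a <- s) ('X - a%:P) + 1.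
have sp : size p = (size s).+2.
  have s1 : size ('X * \prod_(a <- s) ('X - a%:P)) = (size s).+2.
    by rewrite mulrC size_mulX ?size_prod_XsubC // monic_neq0 ?monic_prod_XsubC.
  by rewrite size_polyDl s1 // size_poly1.
have /closed_rootP[x] : size p != 1 by rewrite sp.
rewrite rootE !hornerE => /eqP px; exists x; apply: contra_eqN px => xs.
suff -> : (\prod_(a <- s) ('X - a%:P)).[x] = 0 by rewrite mulr0 add0r oner_eq0.
by apply/eqP; rewrite -rootE root_prod_XsubC.
Qed.

Lemma infinite_uniq_seq (T : eqType) N :
  infinite_type T -> exists s : seq T, uniq s /\ size s = N.
Proof.
move=> infT; elim: N => [|N [s [us ss]]]; first by exists [::].
by have [x xs] := infT s; exists (x :: s); rewrite /= xs us ss.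
Qed.

Lemma poly_vanish (T : eqType) (D : idomainType) (phi : T -> D) (q : {poly D}) :
  infinite_type T -> injective phi -> (forall x, q.[phi x] = 0) -> q = 0.
Proof.
move=> infT phiI qv; have [s [us ss]] := infinite_uniq_seq (size q) infT.
apply: (@roots_geq_poly_eq0 _ _ (map phi s)).
- by apply/allP => _ /mapP[x _ ->]; rewrite rootE qv.
- by rewrite map_inj_uniq.
- by rewrite size_map ss.
Qed.

Section MMap.
Variables (n : nat) (R : nzRingType).

Lemma rmorph_mmap (S S' : comNzRingType) (psi : {rmorphism S -> S'})
    (f : R -> S) (h : 'I_n -> S) (p : {mpoly R[n]}) :
  psi (mmap f h p) = mmap (psi \o f) (psi \o h) p.
Proof.
rewrite /mmap rmorph_sum; apply: eq_bigr => m _ /=.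
rewrite rmorphM /mmap1 rmorph_prod; congr (_ * _).
by apply: eq_bigr => i _; rewrite rmorphXn.
Qed.

Lemma eq_mmap (S : nzRingType) (f f' : R -> S) (h h' : 'I_n -> S)
    (p : {mpoly R[n]}) :
  f =1 f' -> h =1 h' -> mmap f h p = mmap f' h' p.
Proof.
by move=> ff hh; apply: eq_bigr => m _; rewrite ff (mmap1_eq _ hh).
Qed.

Lemma mmap_id (p : {mpoly R[n]}) :
  mmap (@mpolyC n R) (fun i => 'X_i) p = p.
Proof.
by rewrite [RHS]mpolyE; apply: eq_bigr => m _; rewrite mmap1_id mul_mpolyC.
Qed.

End MMap.

(** The variables are specialized one after the other: once the variables
before a given one have numerical values, the polynomial in that variable has
infinitely many roots. *)
Lemma mpoly_vanish (k : nzRingType) (N : nat) (D : idomainType)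
    (iota : {rmorphism k -> D}) (p : {mpoly D[N]}) :
  infinite_type k -> injective iota ->
  (forall v : 'I_N -> k, p.@[iota \o v] = 0) -> p = 0.
Proof.
move=> infk iotaI pv.
(* h j v gives their values to the variables before j and keeps the others *)
pose h j (v : 'I_N -> k) (i : 'I_N) : {mpoly D[N]} :=
  if (i < j)%N then (iota (v i))%:MP else 'X_i.
suff H : forall j, (j <= N)%N -> forall v, mmap (@mpolyC N D) (h (N - j)%N v) p = 0.
  rewrite -[LHS](mmap_id p) -(H N (leqnn N) (fun=> 0)); apply: eq_mmap => // i.
  by rewrite /h subnn.
elim=> [_ v|j IH jN v].
  rewrite subn0 -[RHS](mpolyC0 _ D) -(pv v) /meval rmorph_mmap.
  by apply: eq_mmap => // i; rewrite /h ltn_ord.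
have lt0 : (N - j.+1 < N)%N by lia.
pose i0 := Ordinal lt0.
pose q : {poly {mpoly D[N]}} := mmap (polyC \o @mpolyC N D)
  (fun i => if i == i0 then 'X else (h (N - j.+1)%N v i)%:P) p.
suff q0 : q = 0.
  have := congr1 (fun r : {poly {mpoly D[N]}} => r.['X_i0]) q0.
  rewrite horner0 /q -[_.[_]]/(horner_eval 'X_i0 _) rmorph_mmap => <-.
  apply: eq_mmap => [c|i] /=; first by rewrite /horner_eval hornerC.
  rewrite /horner_eval; case: eqP => [->|_]; rewrite !hornerE //.
  by rewrite /h ltnn.
apply: (@poly_vanish k _ (fun x => (iota x)%:MP)) => // [x y|x].
  by move/(congr1 (mcoeff 0)); rewrite !mcoeffC eqxx !mulr1 => /iotaI.
have ltj : (j <= N)%N by lia.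
rewrite -(IH ltj (fun i => if i == i0 then x else v i)).
rewrite -[_.[_]]/(horner_eval _ _) rmorph_mmap.
apply: eq_mmap => [c|i] /=; first by rewrite /horner_eval hornerC.
rewrite /horner_eval /h; case: eqP => [->|ne]; rewrite !hornerE //=.
  by have -> : (N - j.+1 < N - j)%N by lia.
have -> // : (i < N - j)%N = (i < N - j.+1)%N.
have : nat_of_ord i <> (N - j.+1)%N by move=> e; apply: ne; apply: val_inj.
by lia.
Qed.

(** * Characteristic polynomials and traces of exterior powers *)

Section PrincipalMinors.
Variable R : comNzRingType.

Lemma det_perm_conj n (s : 'S_n) (M : 'M[R]_n) :
  \det (\matrix_(i, j) M (s i) (s j)) = \det M.
Proof.
have -> : \matrix_(i, j) M (s i) (s j) = row_perm s (col_perm s M).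
  by apply/matrixP => i j; rewrite !mxE.
rewrite row_permE col_permE !det_mulmx !det_perm mulrC -mulrA odd_permV.
by rewrite -expr2 sqrr_sign mulr1.
Qed.

(** Listing the indices of the tuple first makes the matrix block triangular,
with a scalar block in the remaining rows. *)
Lemma det_scalar_rows n m (t : m.-tuple 'I_n) (x : R) (M : 'M[R]_n) :
  uniq t -> (forall i j, i \notin t -> M i j = x *+ (i == j)) ->
  \det M = \det (\matrix_(a < m, b < m) M (tnth t a) (tnth t b)) * x ^+ (n - m).
Proof.
move=> ut; have [q nq] : exists q, n = (m + q)%N.
  exists (n - m)%N; rewrite subnKC // -[X in (_ <= X)%N]card_ord.
  by rewrite -(size_tuple t) -(card_uniqP ut) max_card.
subst n => Mt; pose r := [seq i <- enum 'I_(m + q) | i \notin t].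
have ul : uniq (t ++ r).
  rewrite cat_uniq ut filter_uniq ?enum_uniq // andbT /=.
  by apply/hasPn => i; rewrite mem_filter => /andP[].
have sl : size (t ++ r) = (m + q)%N.
  rewrite -[RHS]card_ord -(card_uniqP ul); apply/eq_card => i.
  by rewrite !inE mem_cat mem_filter mem_enum andbT orbN.
pose l : (m + q).-tuple 'I_(m + q) := Tuple (introT eqP sl).
have linj : injective (tnth l) by apply/tuple_uniqP.
rewrite -(det_perm_conj (perm linj)).
have ll a : tnth l (lshift q a) = tnth t a.
  rewrite (tnth_nth (tnth t a)) /= nth_cat size_tuple ltn_ord.
  by rewrite [RHS](tnth_nth (tnth t a)).
have lr a : tnth l (rshift m a) \notin t.
  set y := tnth _ _; have -> : y = nth y r a.
    rewrite {1}/y (tnth_nth y) /= nth_cat size_tuple -ltn_subRL subnn ltn0.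
    by rewrite addKn.
  suff : nth y r a \in r by rewrite mem_filter => /andP[].
  apply: mem_nth; have := sl; rewrite size_cat size_tuple => /addnI ->.
  exact: ltn_ord.
set N := (X in \det X = _); rewrite -[N]submxK.
have -> : dlsubmx N = 0.
  by apply/matrixP => i j; rewrite !mxE !permE Mt ?lr // (inj_eq linj) eq_rlshift.
have -> : drsubmx N = x%:M.
  by apply/matrixP => i j; rewrite !mxE !permE Mt ?lr // (inj_eq linj) eq_rshift.
rewrite det_ublock det_scalar addKn; congr (\det _ * _); apply/matrixP => i j.
by rewrite !mxE !permE !ll.
Qed.

Lemma det_addmx n (B D : 'M[R]_n) :
  \det (B + D) = \sum_(S : {set 'I_n})
    \det (\matrix_(i, j) if i \in S then B i j else D i j).
Proof.
rewrite /determinant exchange_big; apply: eq_bigr => s _ /=.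
rewrite -mulr_sumr; congr (_ * _).
have -> : \prod_i (B + D) i (s i) = \prod_i (B i (s i) + D i (s i)).
  by apply: eq_bigr => i _; rewrite mxE.
rewrite (bigA_distr _ +%R); apply: eq_bigr => S _; apply: eq_bigr => i _.
by rewrite mxE.
Qed.

(** Injectivity and a comparison of cardinals show that every set of size m is
enumerated by exactly one increasing tuple. *)
Lemma sum_increasing_tuples m n (F : {set 'I_n} -> R) :
  \sum_(t in increasing_tuples n m) F [set i in t] =
  \sum_(S : {set 'I_n} | #|S| == m) F S.
Proof.
pose f (t : m.-tuple 'I_n) := [set i in t].
have f_inj : {in increasing_tuples n m &, injective f}.
  move=> t t'; rewrite !inE => st st' /setP ft; apply: val_inj.
  apply: (inj_map val_inj); apply: (irr_sorted_eq ltn_trans ltnn) => // y.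
  by apply/mapP/mapP => [] [x xt ->]; exists x => //; have := ft x; rewrite !inE xt.
rewrite -(big_imset _ f_inj) /=; apply: eq_bigl => S.
suff -> : f @: increasing_tuples n m = [set S : {set 'I_n} | #|S| == m].
  by rewrite inE.
apply/eqP; rewrite eqEcard card_in_imset // card_draws card_ord.
rewrite card_ltn_sorted_tuples leqnn andbT; apply/subsetP => _ /imsetP[t st ->].
rewrite inE in st; rewrite inE cardsE (card_uniqP _) ?size_tuple //.
by rewrite -(map_inj_uniq val_inj) (sorted_uniq ltn_trans ltnn).
Qed.

Lemma trace_exterior_power m n (A : 'M[R]_n) :
  \tr (exterior_power_mx m A) = \sum_(t in increasing_tuples n m)
    \det (\matrix_(a < m, b < m) A (tnth t a) (tnth t b)).
Proof.
rewrite [RHS]big_enum_val /mxtrace; apply: eq_bigr => I _; rewrite mxE.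
by congr (\det _); apply/matrixP => a b; rewrite !mxE.
Qed.

End PrincipalMinors.

(** Expanding the determinant of X - A by choosing in each row either X or -A,
the rows in a set S contribute the principal minor of A on S and the other
rows a power of X. *)
Lemma char_poly_coef_trace (R : comNzRingType) (n m : nat) (A : 'M[R]_n) :
  (m <= n)%N ->
  (char_poly A)`_(n - m) = (-1) ^+ m * \tr (exterior_power_mx m A).
Proof.
move=> mn; rewrite trace_exterior_power /char_poly /char_poly_mx addrC det_addmx.
pose G (S : {set 'I_n}) := \det (\matrix_(i, j)
  if i \in S then (- map_mx polyC A) i j else ('X%:M : 'M[{poly R}]_n) i j).
have GE p (t : p.-tuple 'I_n) : uniq t -> G [set i in t] =
    ((-1) ^+ p * \det (\matrix_(a, b) A (tnth t a) (tnth t b)))%:P * 'X^(n - p).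
  move=> ut; rewrite /G (det_scalar_rows (x := 'X) ut) => [|i j it]; last first.
    by rewrite !mxE inE (negPf it).
  rewrite -detZ -det_map_mx; congr (\det _ * _).
  by apply/matrixP => a b; rewrite !mxE inE mem_tnth mulN1r rmorphN.
transitivity ((\sum_S G S)`_(n - m)); first by [].
rewrite coef_sum (bigID (fun S : {set 'I_n} => #|S| == m)) /=.
rewrite [X in _ + X]big1 => [|S /eqP Sm]; last first.
  have uS : uniq (enum S) by exact: enum_uniq.
  have -> : S = [set i in in_tuple (enum S)].
    by apply/setP => i; rewrite inE mem_enum.
  rewrite GE // coefCM coefXn; case: eqP => [e|_]; rewrite ?mulr0 //.
  have Sn : (#|S| <= n)%N by rewrite -[X in (_ <= X)%N]card_ord max_card.
  case: Sm; move: e; rewrite -cardE; move: Sn; clear -mn; move: #|S| => c; lia.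
rewrite addr0 -(@sum_increasing_tuples R m n (fun S => (G S)`_(n - m))) mulr_sumr.
apply: eq_bigr => t; rewrite inE => st.
have ut : uniq t by rewrite -(map_inj_uniq val_inj) (sorted_uniq ltn_trans ltnn).
by rewrite GE // coefCM coefXn eqxx mulr1.
Qed.

Section AdjugateCoefs.
Variables (R : comNzRingType) (n : nat) (A : 'M[R]_n.+1).

Definition adj_coef (l : nat) : 'M[R]_n.+1 :=
  \matrix_(i, j) ((\adj (char_poly_mx A)) i j)`_l.

(** This is the coefficient of degree l + 1 in the identity
adj (X - A) (X - A) = chi_A. *)
Lemma adj_coef_rec l :
  adj_coef l = adj_coef l.+1 *m A + ((char_poly A)`_l.+1)%:M.
Proof.
rewrite /adj_coef; have := mul_adj_mx (char_poly_mx A).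
rewrite -/(char_poly A); move: (\adj _) => J.
rewrite /char_poly_mx mulmxBr mul_mx_scalar => JA; apply/matrixP => i j.
move/matrixP/(_ i j)/(congr1 (fun p : {poly R} => p`_l.+1)): JA.
rewrite !mxE coefB coefXM /= coefMn => <-; rewrite coef_sum.
under [X in _ = _ + (_ - X)]eq_bigr => q _ do rewrite mxE coefMC.
under [X in _ = X + _]eq_bigr => q _ do rewrite mxE.
by rewrite addrC subrK.
Qed.

(** The recursion is run downwards, from the degrees where the adjugate
vanishes. *)
Lemma adj_coefE l :
  adj_coef l = \sum_(j < n.+1) (char_poly A)`_(l.+1 + j) *: A ^+ j.
Proof.
have sz : exists N, forall l, (N <= l)%N -> adj_coef l = 0.
  exists (\max_(p : 'I_n.+1 * 'I_n.+1) size (\adj (char_poly_mx A) p.1 p.2)).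
  move=> l' Nl; apply/matrixP => i j.
  rewrite [LHS]mxE [RHS]mxE nth_default //.
  apply: leq_trans Nl; pose F p := size (\adj (char_poly_mx A) p.1 p.2).
  exact: (leq_bigmax (F := F) (i, j)).
have chi0 j : (n.+1 < j)%N -> (char_poly A)`_j = 0.
  by move=> nj; rewrite nth_default // size_char_poly.
(* the recursion itself sharpens the crude bound N on the degree of the
   adjugate to n *)
have big0 l' : (n < l')%N -> adj_coef l' = 0.
  have [N NP] := sz; have [k] := ubnP (N - l'); elim: k l' => // k IH l' Nk nl.
  have [/NP //|lN] := leqP N l'.
  rewrite adj_coef_rec IH ?mul0mx ?add0r ?chi0 ?raddf0 //; last by lia.
  by lia.
have [k] := ubnP (n.+1 - l); elim: k l => // k IH l lk.
have [nl|ln] := ltnP n l.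
  rewrite big0 // big1 // => j _; rewrite chi0 ?scale0r //; lia.
rewrite adj_coef_rec IH; last by lia.
rewrite [RHS]big_ord_recl addn0 expr0 -[1%R]/(1%:M) scalemx1 addrC.
congr (_ + _); rewrite big_ord_recr /= chi0; last by lia.
rewrite scale0r addr0 mulmx_suml; apply: eq_bigr => j _.
by rewrite -scalemxAl -[_ *m A]exprSr addSnnS.
Qed.

End AdjugateCoefs.

(** * Derivations and the gradients of the traces of exterior powers *)

Section Derivation.
Variables (S : comNzRingType) (D : {additive S -> S}).
Hypothesis DM : forall x y, D (x * y) = D x * y + x * D y.

Lemma derivation1 : D 1 = 0.
Proof.
by have /eqP := DM 1 1; rewrite !mul1r mulr1 -[X in X == _]addr0 (inj_eq (addrI _)) eq_sym => /eqP.
Qed.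

Lemma derivation_prod (I : Type) (r : seq I) (F : I -> S) :
  (forall i, D (F i) = 0) -> D (\prod_(i <- r) F i) = 0.
Proof.
move=> DF; elim: r => [|i r IH]; first by rewrite big_nil derivation1.
by rewrite big_cons DM DF IH mul0r mulr0 addr0.
Qed.

Lemma derivation_sign m x : D ((-1) ^+ m * x) = (-1) ^+ m * D x.
Proof. by rewrite -signr_odd; case: odd; rewrite ?expr0 ?expr1 ?mul1r // !mulN1r raddfN. Qed.

Lemma derivation_det0 n (M : 'M[S]_n) :
  (forall i j, D (M i j) = 0) -> D (\det M) = 0.
Proof.
move=> DM0; rewrite raddf_sum big1 // => s _.
by rewrite derivation_sign derivation_prod ?mulr0.
Qed.

Lemma derivation_det_row n (M : 'M[S]_n) i :
  (forall a b, a != i -> D (M a b) = 0) ->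
  D (\det M) = \sum_b D (M i b) * cofactor M i b.
Proof.
move=> DM0; rewrite (expand_det_row M i) raddf_sum; apply: eq_bigr => b _.
rewrite DM derivation_sign derivation_det0 ?mulr0 ?addr0 // => a c.
by rewrite !mxE DM0 // eq_sym neq_lift.
Qed.

End Derivation.

Lemma map_poly_derivation (S : comNzRingType) (D : {additive S -> S}) :
  (forall x y, D (x * y) = D x * y + x * D y) ->
  forall p q : {poly S},
    map_poly D (p * q) = map_poly D p * q + p * map_poly D q.
Proof.
move=> DM p q; apply/polyP => l; rewrite coefD coef_map !coefM raddf_sum -big_split.
by apply: eq_bigr => a _ /=; rewrite DM !coef_map.
Qed.

Section GenericCharPoly.
Variables (k : fieldType) (n' : nat).
Local Notation n := n'.+1.
Local Notation kg := (polyfun k n').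
Local Notation X := (xmx k n').

Lemma mxvec_index_eq (i j a b : 'I_n) :
  (mxvec_index a b == mxvec_index i j) = (a == i) && (b == j).
Proof.
by rewrite /mxvec_index (inj_eq (@cast_ord_inj _ _ _)) (inj_eq enum_rank_inj).
Qed.

Lemma partial_xvar (i j a b : 'I_n) :
  partial i j (xvar k a b) = ((a == i) && (b == j))%:R.
Proof.
rewrite /partial /xvar mderivX mnm1E mxvec_index_eq.
case: andP => [[/eqP-> /eqP->]|_]; last by rewrite scale0r.
by rewrite scale1r -[X in 'X_[X - _]]add0m addmK mpolyX0.
Qed.

(** Only the entry (i, j) of the characteristic matrix depends on the variable
x_ij, and its cofactor is an entry of the adjugate. *)
Lemma partial_char_poly (i j : 'I_n) l :
  partial i j (char_poly X)`_l = - adj_coef X l j i.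
Proof.
pose D := mderiv (R := k) (mxvec_index i j).
have DM : forall x y, D (x * y) = D x * y + x * D y by exact: mderivM.
have DX a b : map_poly D (char_poly_mx X a b) = - ((a == i) && (b == j))%:R%:P.
  rewrite !mxE raddfB /= map_polyC /= -/(partial i j _) -/(xvar k a b).
  rewrite partial_xvar; suff -> : map_poly D ('X *+ (a == b)) = 0 by rewrite sub0r.
  apply/polyP => c; rewrite coef_map coefMn coefX coef0 raddfMn /=.
  by case: (c == _); rewrite /= ?(derivation1 DM) ?raddf0 mul0rn.
rewrite -[LHS](coef_map D) (derivation_det_row (map_poly_derivation DM) (i := i)).
  rewrite (bigD1 j) //= big1 => [|b bj]; last first.
    by rewrite [X in X * _](DX i b) (negPf bj) andbF polyC0 oppr0 mul0r.
  by rewrite [X in X * _](DX i j) !eqxx addr0 polyC1 mulN1r coefN !mxE.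
by move=> a b ai; rewrite [LHS](DX a b) (negPf ai) polyC0 oppr0.
Qed.

Lemma s_char_poly m : (m <= n)%N ->
  s_ k n' m = (-1) ^+ m * (char_poly X)`_(n - m).
Proof. by move=> mn; rewrite char_poly_coef_trace // mulrA -expr2 sqrr_sign mul1r. Qed.

(** The gradient of the trace of an exterior power is, up to sign, a
coefficient of the adjugate of the characteristic matrix, hence a polynomial
in the matrix itself with invariant coefficients. *)
Lemma partial_s (i j : 'I_n) t : (t < n)%N ->
  partial i j (s_ k n' t.+1) =
    (-1) ^+ t * \sum_(q < n) (char_poly X)`_(n - t + q) * (X ^+ q) j i.
Proof.
move=> tn; rewrite s_char_poly //.
transitivity ((-1) ^+ t.+1 * partial i j (char_poly X)`_(n - t.+1)).
  exact: (derivation_sign (mderiv (R := k) (mxvec_index i j))).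
rewrite partial_char_poly exprS mulN1r mulNr mulrN opprK.
congr (_ * _); rewrite adj_coefE summxE -[in LHS]subSn //; apply: eq_bigr => q _.
by rewrite mxE.
Qed.

End GenericCharPoly.

(** * Matrices with a cyclic first basis vector *)

Section Krylov.
Variables (R : comNzRingType) (n' : nat).
Local Notation n := n'.+1.

Definition krylov (A : 'M[R]_n) : 'M[R]_n := \matrix_(i, j) (A ^+ j) i 0.

(** The companion matrix of the monic polynomial with lower coefficients c: it
is the matrix of A in its Krylov basis when c lists the coefficients of the
characteristic polynomial of A. *)
Definition companion (c : 'I_n -> R) : 'M[R]_n :=
  \matrix_(i, j) if j == ord_max then - c i else (i == j.+1 :> nat)%:R.

Lemma krylov_col (A : 'M[R]_n) i (j : 'I_n) :
  krylov A i j = (A ^+ j *m delta_mx 0 (0 : 'I_1)) i 0.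
Proof. by rewrite -colE !mxE. Qed.

Lemma Cayley_Hamilton_sum (A : 'M[R]_n) :
  A ^+ n = - \sum_(i < n) (char_poly A)`_i *: A ^+ i.
Proof.
have := Cayley_Hamilton A; rewrite /horner_mx /horner_morph.
rewrite (@horner_coef_wide _ n.+1); last first.
  by rewrite (leq_trans (size_poly _ _)) // size_char_poly.
rewrite big_ord_recr /= coef_map /=.
have /monicP := char_poly_monic A; rewrite lead_coefE size_char_poly => /= ->.
rewrite mul1r => /eqP; rewrite addrC addr_eq0 => /eqP ->; congr (- _).
by apply: eq_bigr => i _; rewrite coef_map /= [_ * _]mul_scalar_mx.
Qed.

Lemma mul_krylov (A : 'M[R]_n) :
  A *m krylov A = krylov A *m companion (fun i => (char_poly A)`_i).
Proof.
apply/matrixP => i j.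
have -> : (A *m krylov A) i j = (A ^+ j.+1) i 0.
  by rewrite exprS [RHS]mxE [LHS]mxE; apply: eq_bigr => b _; rewrite mxE.
rewrite [RHS]mxE; have [jm|jm] := eqVneq j ord_max.
  rewrite {1}jm /= Cayley_Hamilton_sum mxE summxE -sumrN; apply: eq_bigr => b _.
  by rewrite !mxE jm eqxx mulrN mulrC.
have ltj : (j.+1 < n)%N.
  rewrite ltnS ltn_neqAle -ltnS ltn_ord andbT; apply: contra_neq jm => jm.
  exact: val_inj.
rewrite (bigD1 (Ordinal ltj)) //= big1 => [|b bj].
  by rewrite !mxE /= (negPf jm) eqxx mulr1 addr0.
rewrite !mxE (negPf jm); case: eqP => [e|]; last by rewrite mulr0.
by case/eqP: bj; apply: val_inj.
Qed.

Lemma companionX (c : 'I_n -> R) (j : 'I_n) i :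
  (companion c ^+ j) i 0 = (i == j)%:R.
Proof.
case: j => j; elim: j i => [|j IH] i ltj /=.
  by rewrite expr0 mxE; congr (_%:R); rewrite -val_eqE.
have ltj' : (j < n)%N by exact: ltnW.
rewrite exprS mxE (bigD1 (Ordinal ltj')) //= big1 => [|b bj].
  rewrite (IH (Ordinal ltj') ltj') eqxx mulr1 addr0 mxE -val_eqE /=.
  by rewrite (ltn_eqF (ltj : (j < n')%N)) -val_eqE.
by rewrite (IH b ltj') (negPf bj) mulr0.
Qed.

Lemma krylov_companion (c : 'I_n -> R) : krylov (companion c) = 1%:M.
Proof. by apply/matrixP => i j; rewrite !mxE companionX. Qed.

Lemma char_poly_companion (c : 'I_n -> R) (i : 'I_n) :
  (char_poly (companion c))`_i = c i.
Proof.
have := mul_krylov (companion c).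
rewrite krylov_companion mulmx1 mul1mx => /matrixP/(_ i ord_max).
by rewrite !mxE eqxx => /oppr_inj.
Qed.

(** Passing to another matrix of a conjugacy class changes the Krylov basis
by the conjugating matrix as soon as the latter has the first basis vector as
an eigenvector. *)
Lemma krylov_conj (A B g : 'M[R]_n) (al : R) :
  A *m g = g *m B -> col 0 g = al *: col 0 1%:M ->
  al *: krylov A = g *m krylov B.
Proof.
move=> AB g0; have AX j : A ^+ j *m g = g *m B ^+ j.
  elim: j => [|j IH]; first by rewrite !expr0 mulmx1 mul1mx.
  by rewrite exprSr -mulmxA AB mulmxA IH -mulmxA -[_ *m B]exprSr.
have E j : al *: col 0 (A ^+ j) = col 0 (g *m B ^+ j).
  by rewrite -AX [RHS]colE -mulmxA -colE g0 -scalemxAr [col 0 1%:M]colE mul1mx -colE.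
apply/matrixP => i j; have := congr1 (fun M : 'cV_n => M i 0) (E j).
by rewrite /= !mxE => ->; apply: eq_bigr => b _; rewrite !mxE.
Qed.

End Krylov.

(** * Semi-invariants of the upper triangular row operations *)

Section VarIndex.
Variable n' : nat.
Local Notation n := n'.+1.

Lemma vidx_proof (r j : 'I_n) : ((n' - j) * n + r < n * n)%N.
Proof. by have := ltn_ord r; have := leq_subr j n'; nia. Qed.

(** The rank of the entry (r, j) for the lexicographic comparison of monomials:
the variables of the last column are the most significant, and inside a column
those of the upper rows. This is the order for which the extreme term of a
bottom minor is its antidiagonal. *)
Definition vidx (r j : 'I_n) : 'I_(n * n) := Ordinal (vidx_proof r j).

Definition vrow (i : 'I_(n * n)) : 'I_n := inord (i %% n).
Definition vcol (i : 'I_(n * n)) : 'I_n := inord (n' - i %/ n).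

Lemma vrowK r j : vrow (vidx r j) = r.
Proof.
by apply: val_inj; rewrite /vrow /= inordK ?ltn_pmod // modnMDl modn_small.
Qed.

Lemma vcolK r j : vcol (vidx r j) = j.
Proof.
apply: val_inj; rewrite /vcol /= divnMDl // divn_small // addn0.
by rewrite inordK; have := ltn_ord j; lia.
Qed.

Lemma vidxK i : vidx (vrow i) (vcol i) = i.
Proof.
apply: val_inj; rewrite /vrow /vcol /= !inordK ?ltn_pmod ?ltnS ?leq_subr //.
have : (i %/ n <= n')%N by rewrite -ltnS ltn_divLR.
by move=> le; rewrite subKn // -divn_eq.
Qed.

Variant is_vidx : 'I_(n * n) -> Type := IsVidx r j : is_vidx (vidx r j).

Lemma vidxP i : is_vidx i.
Proof. by rewrite -(vidxK i). Qed.

Lemma vidx_eq r j r' j' : (vidx r j == vidx r' j') = (r == r') && (j == j').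
Proof.
apply/eqP/andP => [e|[/eqP-> /eqP->]//].
by rewrite -(vrowK r j) -{2}(vcolK r j) e vrowK vcolK.
Qed.

Lemma vidx_lt r j r' j' :
  (vidx r j < vidx r' j')%N = (j' < j)%N || (j == j') && (r < r')%N.
Proof.
have := ltn_ord r; have := ltn_ord r'; have := ltn_ord j; have := ltn_ord j'.
rewrite -(inj_eq val_inj) /=; move: (val r) (val r') (val j) (val j') => a b c d.
move=> dn cn bn an; have [cd|dc|->] := ltngtP c d.
- have : (n' - c = (n' - d) + (d - c).-1.+1)%N by lia.
  by move=> ->; rewrite mulnDl mulSn /=; nia.
- have : (n' - d = (n' - c) + (c - d).-1.+1)%N by lia.
  by move=> ->; rewrite mulnDl mulSn /=; nia.
- by rewrite ltn_add2l.
Qed.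

Lemma vidx_sum (F : 'I_(n * n) -> nat) :
  (\sum_i F i = \sum_r \sum_j F (vidx r j))%N.
Proof.
rewrite pair_big /= (reindex (fun p => vidx p.1 p.2)) //.
exists (fun i => (vrow i, vcol i)) => [[r j] _|i _] /=; last exact: vidxK.
by rewrite vrowK vcolK.
Qed.

End VarIndex.

Section SemiInvariance.
Variables (A : idomainType) (n' : nat).
Local Notation n := n'.+1.
Local Notation N := (n * n)%N.

Definition matev (B : comNzRingType) (phi : A -> B) (h : 'M[B]_n)
    (P : {mpoly A[N]}) : B :=
  mmap phi (fun i => h (vrow i) (vcol i)) P.

(** With s invertible these matrices generate the upper triangular group of a
field. Allowing any s makes it possible to take an indeterminate, and to read
semi-invariance as a polynomial identity in s. *)
Definition rowop (B : comNzRingType) (b b' : 'I_n) (s : B) (u : bool) :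
    'M[B]_n :=
  \matrix_(i, j) if i == b then if j == b then s else (u && (j == b'))%:R
                 else (i == j)%:R.

Lemma rowopE (B : comNzRingType) (b b' : 'I_n) (s : B) (u : bool)
    (h : 'M[B]_n) i j : (u ==> (b != b')) ->
  (rowop b b' s u *m h) i j =
    if i == b then s * h b j + h b' j *+ u else h i j.
Proof.
move=> ub; rewrite mxE; have [->|ib] := eqVneq i b.
  rewrite (bigD1 b) //= mxE !eqxx; congr (_ + _).
  case: u ub => /= [bb'|_]; last first.
    by rewrite big1 // => c /negPf cb; rewrite mxE eqxx cb mul0r.
  rewrite (bigD1 b') 1?eq_sym //= big1 => [|c /andP[/negPf cb /negPf cb']].
    by rewrite mxE eqxx eq_sym (negPf bb') eqxx mul1r addr0.
  by rewrite mxE eqxx cb cb' mul0r.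
rewrite (bigD1 i) //= big1 => [|c ci]; rewrite mxE (negPf ib).
  by rewrite eqxx mul1r addr0.
by rewrite eq_sym (negPf ci) mul0r.
Qed.

Lemma rowop_upper (B : comNzRingType) (b b' : 'I_n) (s : B) (u : bool) (i j : 'I_n) :
  u ==> (b < b')%N -> (j < i)%N -> rowop b b' s u i j = 0.
Proof.
move=> ub ji; rewrite mxE; case: (i =P b) => [ib|_]; last first.
  by rewrite -(inj_eq val_inj) /= gtn_eqF.
rewrite -(inj_eq val_inj) /= -ib ltn_eqF //; case: u ub => //= bb'.
by rewrite -(inj_eq val_inj) /= ltn_eqF // (ltn_trans ji) // ib.
Qed.

(** All extensions of the ring of coefficients are allowed, so that the identity
can be used on matrices whose entries involve new parameters. The row operations
are those of the lower right block of a frame. *)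
Definition semi_inv (L : 'I_n -> nat) (P : {mpoly A[N]}) :=
  forall (B : comNzRingType) (phi : {rmorphism A -> B}) (h : 'M[B]_n)
    (b b' : 'I_n) (s : B) (u : bool), (0 < b)%N -> u ==> (b < b')%N ->
  matev phi (rowop b b' s u *m h) P = s ^+ L b * matev phi h P.

(** The semi-invariants of interest come from frames, whose first column is the
first basis vector and whose first row can be changed by the action of the
unitriangular group; this leaves the lower right block. *)
Definition inner (P : {mpoly A[N]}) :=
  forall (B : comNzRingType) (phi : {rmorphism A -> B}) (h h' : 'M[B]_n),
  (forall i j, i != 0 -> j != 0 -> h i j = h' i j) ->
  matev phi h P = matev phi h' P.

End SemiInvariance.

(** Substituting a monomial for each variable keeps the terms of a polynomial
visible; all the coefficient comparisons below use such substitutions. *)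
Lemma mmap_monomial (A : nzRingType) (C : comNzRingType) (N : nat)
    (phi : A -> C) (c : 'I_N -> C) (nu : 'I_N -> 'X_{1..N}) (P : {mpoly A[N]}) :
  mmap (@mpolyC N C \o phi) (fun i => (c i)%:MP * 'X_[nu i]) P =
  \sum_(m <- msupp P) (phi P@_m * \prod_i c i ^+ m i)
     *: 'X_[(\sum_i nu i *+ m i)%MM].
Proof.
apply: eq_bigr => m _ /=; rewrite -mul_mpolyC mpolyCM -mulrA; congr (_ * _).
rewrite /mmap1 rmorph_prod -mprodXnE -big_split; apply: eq_bigr => i _ /=.
by rewrite exprMn -rmorphXn.
Qed.

Lemma sum_mnm1 N (m : 'X_{1..N}) : (\sum_i U_(i) *+ m i)%MM = m.
Proof. by rewrite -multinomUE_id. Qed.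

Lemma mcoeff_scaled (A : nzRingType) (C : comNzRingType) (N : nat)
    (phi : {additive A -> C}) (c : 'I_N -> C) (P : {mpoly A[N]}) m :
  (mmap (@mpolyC N C \o phi) (fun i => (c i)%:MP * 'X_[U_(i)]) P)@_m =
  phi P@_m * \prod_i c i ^+ m i.
Proof.
rewrite mmap_monomial raddf_sum /=.
have [mP|mP] := boolP (m \in msupp P); last first.
  rewrite (memN_msupp_eq0 mP) raddf0 mul0r big_seq big1 // => m' m'P.
  rewrite mcoeffZ mcoeffX sum_mnm1; case: eqP => [e|]; last by rewrite mulr0.
  by rewrite -e m'P in mP.
rewrite (bigD1_seq m) ?msupp_uniq //= [X in _ + X]big1 => [|m' m'm].
  by rewrite addr0 mcoeffZ mcoeffX sum_mnm1 eqxx mulr1.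
by rewrite mcoeffZ mcoeffX sum_mnm1 (negPf m'm) mulr0.
Qed.

Section Support.
Variables (A : idomainType) (n' : nat).
Local Notation n := n'.+1.
Local Notation N := (n * n)%N.
Variables (L : 'I_n -> nat) (P : {mpoly A[N]}).

(** Setting the variables of the first row and column to zero changes nothing,
hence they do not occur. *)
Lemma inner_supp m (r j : 'I_n) : inner P -> m \in msupp P ->
  (r == 0) || (j == 0) -> m (vidx r j) = 0%N.
Proof.
move=> Pin mP rj; pose c (i : 'I_N) : A := ((vrow i != 0) && (vcol i != 0))%:R.
pose h (c : 'I_N -> A) : 'M[{mpoly A[N]}]_n :=
  \matrix_(r, j) ((c (vidx r j))%:MP * 'X_[U_(vidx r j)]).
have hE c' : matev (@mpolyC N A) (h c') P =
    mmap (@mpolyC N A \o idfun) (fun i => (c' i)%:MP * 'X_[U_(i)]) P.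
  by apply: eq_mmap => // i; rewrite mxE vidxK.
have : matev (@mpolyC N A) (h (fun=> 1)) P = matev (@mpolyC N A) (h c) P.
  by apply: Pin => i1 j1 i10 j10; rewrite !mxE /c vrowK vcolK i10 j10.
rewrite !hE => /(congr1 (mcoeff m)); rewrite !mcoeff_scaled /=.
rewrite [X in _ * X = _]big1 => [|i _]; last by rewrite expr1n.
rewrite mulr1 (bigD1 (vidx r j)) //= {1}/c vrowK vcolK -negb_or rj /= expr0n.
by case: (m (vidx r j)) => // l /eqP; rewrite mul0r mulr0 mcoeff_eq0 mP.
Qed.

(** Multiplying row b by an indeterminate shows that a semi-invariant is
homogeneous in the variables of that row. *)
Lemma semi_inv_supp m (b : 'I_n) : semi_inv L P -> m \in msupp P -> (0 < b)%N ->
  (\sum_j m (vidx b j) = L b)%N.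
Proof.
move=> Psi mP b0; pose c (i : 'I_N) : {poly A} := if vrow i == b then 'X else 1.
pose h (c : 'I_N -> {poly A}) : 'M[{mpoly {poly A}[N]}]_n :=
  \matrix_(r, j) ((c (vidx r j))%:MP * 'X_[U_(vidx r j)]).
have hE c' : matev (@mpolyC N _ \o polyC) (h c') P =
    mmap (@mpolyC N _ \o polyC) (fun i => (c' i)%:MP * 'X_[U_(i)]) P.
  by apply: eq_mmap => // i; rewrite mxE vidxK.
have := Psi _ (@mpolyC N _ \o polyC) (h (fun=> 1)) b b ('X)%:MP false b0 isT.
have -> : rowop b b ('X)%:MP false *m h (fun=> 1) = h c.
  apply/matrixP => i j; rewrite rowopE // !mxE /c vrowK.
  by case: eqP => [->|//]; rewrite mulr0n addr0 mpolyC1 mul1r.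
rewrite !hE -rmorphXn mul_mpolyC => /(congr1 (mcoeff m)).
rewrite mcoeffZ !mcoeff_scaled [X in _ = _ * (_ * X)]big1 => [|i _]; last first.
  by rewrite expr1n.
have -> : \prod_i c i ^+ m i = 'X^(\sum_j m (vidx b j)).
  rewrite -prodrXr (bigID (fun i => vrow i == b)) /= [X in _ * X]big1; last first.
    by move=> i /negPf ib; rewrite /c ib expr1n.
  rewrite mulr1 (reindex (fun j => vidx b j)) /=.
    apply: eq_big => [j|j _]; first by rewrite vrowK eqxx.
    by rewrite /c vrowK eqxx.
  exists (@vcol n') => [j _|i]; first exact: vcolK.
  by rewrite inE => /eqP <-; exact: vidxK.
rewrite mulr1 mulrC => /(congr1 (fun q : {poly A} => q`_(L b))).
rewrite !coefMC !coefXn eqxx mul1r; case: eqP => [->//|_] /eqP.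
by rewrite mul0r eq_sym mcoeff_eq0 mP.
Qed.

Lemma semi_inv_mdeg m m' : inner P -> semi_inv L P ->
  m \in msupp P -> m' \in msupp P -> mdeg m = mdeg m'.
Proof.
move=> Pin Psi; suff H q : q \in msupp P -> mdeg q = (\sum_(b | b != 0%R) L b)%N.
  by move=> /H -> /H ->.
move=> qP; rewrite mdegE vidx_sum (bigD1 0) //= big1 ?add0n => [|j _].
  by apply: eq_bigr => b b0; rewrite -(semi_inv_supp Psi qP) // lt0n.
by rewrite (inner_supp Pin qP) ?eqxx.
Qed.

End Support.

(** * The leading monomial of a semi-invariant *)

Section Bounded.
Variables (N : nat) (R : idomainType).
Implicit Types (q : {mpoly {poly R}[N]}) (nu : 'X_{1..N}).

(** A simultaneous bound for the monomials and for the degree in a parameter.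
Such bounds are multiplicative, hence follow for products from their factors. *)
Definition bounded_by q nu (d : nat) := forall t, q@_t != 0 ->
  [/\ (t <= nu)%O, mdeg t = mdeg nu & (size q@_t <= d.+1)%N].

Lemma bounded0 nu d : bounded_by 0 nu d.
Proof. by move=> t; rewrite mcoeff0 eqxx. Qed.

Lemma bounded_monomial (c : {poly R}) nu d : (size c <= d.+1)%N ->
  bounded_by (c%:MP * 'X_[nu]) nu d.
Proof.
move=> sc t; rewrite mcoeffCM mcoeffX; case: (nu =P t) => [<-|]; last first.
  by rewrite mulr0 eqxx.
by rewrite mulr1 lexx.
Qed.

Lemma boundedD q1 q2 nu1 nu2 d : (nu2 <= nu1)%O -> mdeg nu2 = mdeg nu1 ->
  bounded_by q1 nu1 d -> bounded_by q2 nu2 d -> bounded_by (q1 + q2) nu1 d.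
Proof.
move=> le12 deg12 b1 b2 t; rewrite mcoeffD.
have [->|/b1[t1 d1 s1]] := eqVneq q1@_t 0.
  by rewrite add0r => /b2[t2 d2 s2]; rewrite (le_trans t2) // d2 deg12.
have [->|/b2[t2 d2 s2]] := eqVneq q2@_t 0; first by rewrite addr0.
by move=> _; split=> //; rewrite (leq_trans (size_polyD _ _)) // geq_max s1.
Qed.

Lemma boundedM q1 q2 nu1 nu2 d1 d2 :
  bounded_by q1 nu1 d1 -> bounded_by q2 nu2 d2 ->
  bounded_by (q1 * q2) (nu1 + nu2)%MM (d1 + d2).
Proof.
move=> b1 b2 t t0; rewrite mcoeffM in t0 *.
have [/= [m1 m2] /eqP tE m0] : exists2 m : 'X_{1..N < (mdeg t).+1, (mdeg t).+1},
    t == (m.1 + m.2)%MM & q1@_m.1 * q2@_m.2 != 0.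
  apply/exists_inP; apply: contraNT t0 => /exists_inPn H.
  by rewrite big1 // => m /H/negPn/eqP.
move: m0; rewrite mulf_eq0 negb_or => /andP[/b1[le1 e1 _] /b2[le2 e2 _]].
split; first by rewrite tE lem_add.
  by rewrite tE !mdegD e1 e2.
rewrite (leq_trans (size_sum _ _ _)) //; apply/bigmax_leqP => -[p1 p2] _ /=.
have [->|/b1[_ _ s1]] := eqVneq q1@_p1 0; first by rewrite mul0r size_poly0.
have [->|/b2[_ _ s2]] := eqVneq q2@_p2 0; first by rewrite mulr0 size_poly0.
rewrite (leq_trans (size_polyMleq _ _)) // -subn1 leq_subLR add1n -addSn -addnS.
by rewrite leq_add.
Qed.

Lemma bounded1 : bounded_by 1 0%MM 0.
Proof.
move=> t; rewrite mcoeff1; case: (t =P 0%MM) => [->|_]; last by rewrite eqxx.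
by rewrite lexx size_poly1.
Qed.

Lemma boundedX q nu d m : bounded_by q nu d ->
  bounded_by (q ^+ m) (nu *+ m)%MM (d * m).
Proof.
move=> bq; elim: m => [|m IH]; first by rewrite expr0 muln0; exact: bounded1.
by rewrite exprS mulmS mulnS; exact: boundedM.
Qed.

Lemma bounded_prod (I : Type) (r : seq I) (q : I -> {mpoly {poly R}[N]})
    (nu : I -> 'X_{1..N}) (d : I -> nat) :
  (forall i, bounded_by (q i) (nu i) (d i)) ->
  bounded_by (\prod_(i <- r) q i) (\sum_(i <- r) nu i)%MM (\sum_(i <- r) d i).
Proof.
move=> bq; elim: r => [|i r IH]; first by rewrite !big_nil; exact: bounded1.
by rewrite !big_cons; exact: boundedM.
Qed.

End Bounded.

Lemma coefXnM_add (R : nzRingType) (p : {poly R}) a c :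
  ('X^a * p)`_(a + c) = p`_c.
Proof. by rewrite coefXnM ltnNge leq_addr addKn. Qed.

Section LexSqueeze.
Variable N : nat.
Implicit Types m e t mu : 'X_{1..N}.

(** For monomials of the same degree the order is lexicographic: at the first
possible difference the smaller monomial has the smaller exponent. *)
Lemma lemc_head m e (i : 'I_N) : (m <= e)%O -> mdeg m = mdeg e ->
  (forall j : 'I_N, (j < i)%N -> m j = e j) -> (m i <= e i)%N.
Proof.
move=> le_me deg_me eq_me; rewrite leqNgt; apply: contraL le_me => lt_em.
rewrite -ltNge; apply/ltmcP; first exact: esym.
by exists i => // j /eq_me.
Qed.

(** Before i the comparisons form a cycle: m <= e, e agrees with t, t <= mu, and
mu agrees with m. *)
Lemma lex_squeeze m e t mu i : (m <= e)%O -> mdeg m = mdeg e ->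
  (t <= mu)%O -> mdeg t = mdeg mu ->
  (forall j : 'I_N, (j < i)%N -> t j = e j /\ mu j = m j) ->
  forall j : 'I_N, (j < i)%N -> m j = e j.
Proof.
move=> le1 d1 le2 d2 tm [j ltj] /=; elim/ltn_ind: j ltj => j IH ltj ji.
have eq_me (j' : 'I_N) : (j' < j)%N -> m j' = e j'.
  case: j' => j' lt' /= jj; apply: IH => //; exact: ltn_trans ji.
apply/eqP; rewrite eqn_leq (lemc_head (i := Ordinal ltj) le1) //=.
have [te mm] := tm (Ordinal ltj) ji; rewrite -te -mm.
apply: (lemc_head (i := Ordinal ltj) le2) => // j' lt'.
have [-> ->] := tm j' (ltn_trans lt' ji); exact: esym (eq_me _ lt').
Qed.

End LexSqueeze.

(** Let b' = b + 1. The leading exponent e of a semi-invariant P satisfies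
the interlacing inequality
  sum_(j <= j0) e_(b, j) <= sum_(j < j0) e_(b', j).
To see this, let the entries preceding (b, j0) be outer variables, write w
for the outer variable of the entry (b, j0), let y denote the inner variables
of the remaining entries, and evaluate P at the matrix h with
  row b :  y_(b, j) for j < j0,                  -w at j0,
  row b':  y_(b', j) - s y_(b, j) for j < j0,    s w at j0.
In row b of the matrix g obtained by adding row b' to s times row b, the
parameter s has disappeared from the columns j < j0, and the entry at j0
vanishes. Semi-invariance is the identity P(g) = s^(L b) P(h). Let tau be the
outer monomial of e, that is, e before (b, j0) with w to the power
e_(b, j0) + e_(b', j0), and compare the degrees in s of its coefficients. On
the right the term of e survives and has s-exponent at least
L b + e_(b', j0). On the left only the monomials m agreeing with e before
(b, j0) contribute, and their s-degree is at most
sum_(j > j0) e_(b, j) + sum_(j <= j0) e_(b', j). As L b is the sum of row b of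
e, the inequality follows. *)
Section LeadPattern.
Variables (A : idomainType) (n' : nat).
Local Notation n := n'.+1.
Local Notation N := (n * n)%N.
Variables (L : 'I_n -> nat) (P : {mpoly A[N]}).
Hypotheses (Psi : semi_inv L P) (Pin : inner P) (P0 : P != 0).
Variables (b b' : 'I_n) (j0 : 'I_n).
Hypotheses (b0 : (0 < b)%N) (bb' : b' = b.+1 :> nat).

Local Notation e := (mlead P).
Local Notation D := {mpoly A[N]}.
Local Notation C := {poly D}.
Local Notation O := {mpoly C[N]}.

Let i0 := vidx b j0.
Let i1 := vidx b' j0.

Let phi : {rmorphism A -> O} := (@mpolyC N C \o (polyC \o @mpolyC N A)).

(** The entry of h with index i is coefc i times the outer monomial nu i. *)
Let coefc (i : 'I_N) : C :=
  if (i < i0)%N then 1 else if i == i0 then -1 else if i == i1 then 'X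
  else if vrow i == b' then ('X_i)%:P - ('X_(vidx b (vcol i)))%:P * 'X
  else ('X_i)%:P.

Let nu (i : 'I_N) : 'X_{1..N} :=
  (if (i < i0)%N then U_(i) else if (i == i0) || (i == i1) then U_(i0) else 0)%MM.

Let h : 'M[O]_n := \matrix_(r, j) ((coefc (vidx r j))%:MP * 'X_[nu (vidx r j)]).
Let g := rowop b b' ('X)%:MP true *m h.

Let deg (i : 'I_N) : nat :=
  if (j0 < vcol i)%N then vrow i == b else vrow i == b'.

Let bneq : b != b'. Proof. by rewrite -(inj_eq val_inj) /= bb' ltn_eqF. Qed.

Let ltb r j : (vidx r j < i0)%N = (j0 < j)%N || (j == j0) && (r < b)%N.
Proof. exact: vidx_lt. Qed.

Let ltb' j : (vidx b' j < i0)%N = (j0 < j)%N.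
Proof. by rewrite vidx_lt bb' [(b.+1 < b)%N]ltnNge leqnSn andbF orbF. Qed.

Lemma lemc_mnm1 (i i' : 'I_N) : (i < i')%N -> ((U_(i') : 'X_{1..N})%MM <= U_(i)%MM)%O.
Proof.
move=> ii; apply/ltW/ltmcP; first by rewrite !mdeg1.
exists i => [j ji|]; rewrite !mnm1E.
  by rewrite -!(inj_eq val_inj) /= !gtn_eqF // (ltn_trans ji).
by rewrite eqxx -(inj_eq val_inj) /= gtn_eqF.
Qed.

Let hE r j : h r j = (coefc (vidx r j))%:MP * 'X_[nu (vidx r j)].
Proof. by rewrite mxE. Qed.

Let coefc_le i : (size (coefc i) <= (vrow i == b').+1)%N.
Proof.
rewrite /coefc; case: ifP => _; first by rewrite size_poly1.
case: ifP => _; first by rewrite size_polyN size_poly1.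
case: eqP => [->|_]; first by rewrite size_polyX /i1 vrowK eqxx.
case: ifP => _; last exact: size_polyC_leq1.
rewrite (leq_trans (size_polyD _ _)) // geq_max size_polyN.
rewrite (leq_trans (size_polyC_leq1 _)) //= (leq_trans (size_polyMleq _ _)) //.
by rewrite size_polyX addn2 /= ltnS size_polyC_leq1.
Qed.

Let bounded_entry i : bounded_by (g (vrow i) (vcol i)) (nu i) (deg i).
Proof.
case: i / (vidxP i) => r j; rewrite vrowK vcolK /g rowopE ?bneq // /deg vcolK vrowK.
have [->|rb] := eqVneq r b; last first.
  rewrite hE; apply: bounded_monomial; case: ltnP => jj; last first.
    by rewrite (leq_trans (coefc_le _)) // vrowK.
  by rewrite /coefc ltb jj size_poly1.
rewrite !hE mulr1n (negPf bneq) /coefc /nu ltb ltb' ltnn andbF orbF.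
rewrite /i0 /i1 !vidx_eq eqxx [b' == b]eq_sym (negPf bneq) eqxx !vrowK !vcolK eqxx (negPf bneq) /=.
have [jj|jj|/val_inj jj] := ltngtP j0 j.
- rewrite mpolyC1 !mul1r; apply: boundedD.
  + by apply: (@lemc_mnm1 _ (vidx b' j)); rewrite vidx_lt eqxx bb' ltnSn orbT.
  + by rewrite !mdeg1.
  + by apply: bounded_monomial; rewrite size_polyX.
  + by rewrite -[X in bounded_by X]mul1r -mpolyC1; apply: bounded_monomial; rewrite size_poly1.
- rewrite -!(inj_eq val_inj) /= (ltn_eqF jj) /=.
  rewrite mulrA -mpolyCM -mulrDl -mpolyCD ['X * _]mulrC addrC subrK.
  by apply: bounded_monomial; exact: size_polyC_leq1.
rewrite -jj eqxx /= mulrA -mpolyCM -mulrDl -mpolyCD mulrN1 addNr mpolyC0 mul0r.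
exact: bounded0.
Qed.

Let tau := (\sum_i nu i *+ e i)%MM.

Let nu_before (m : 'X_{1..N}) (i : 'I_N) : (i < i0)%N ->
  (\sum_j nu j *+ m j)%MM i = m i.
Proof.
move=> ii; rewrite mnm_sumE (bigD1 i) //= big1 => [|j ji].
  by rewrite mulmnE /nu ii mnm1E eqxx mul1n addn0.
rewrite mulmnE /nu; case: ifP => _.
  by rewrite mnm1E (negPf ji).
case: ifP => _; last by rewrite mnm0E.
by rewrite mnm1E -(inj_eq val_inj) /= gtn_eqF.
Qed.

Let i01 : i0 != i1.
Proof. by rewrite vidx_eq (negPf bneq). Qed.

Let i01_lt : (i0 < i1)%N.
Proof. by rewrite vidx_lt eqxx bb' ltnSn orbT. Qed.

Let nu_i0 (m : 'X_{1..N}) : (\sum_j nu j *+ m j)%MM i0 = (m i0 + m i1)%N.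
Proof.
rewrite mnm_sumE (bigD1 i0) //= (bigD1 i1) 1?eq_sym //= big1 => [|j].
  rewrite !mulmnE /nu ltnn eqxx (ltnNge i1) (ltnW i01_lt) /= eqxx orbT.
  by rewrite mnm1E eqxx !mul1n addn0.
case/andP=> j0' j1; rewrite mulmnE /nu; case: ifP => ji.
  by rewrite mnm1E (negPf j0').
by rewrite (negPf j0') (negPf j1) mnm0E.
Qed.

Let mdeg_supp m : m \in msupp P -> mdeg m = mdeg e.
Proof. by move=> mP; exact: (semi_inv_mdeg Pin Psi mP (mlead_supp P0)). Qed.

Local Notation K :=
  (\sum_(j : 'I_n | (j0 < j)%N) e (vidx b j) +
   \sum_(j : 'I_n | (j <= j0)%N) e (vidx b' j))%N.

Let sum_deg (m : 'X_{1..N}) : (\sum_i deg i * m i =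
  \sum_(j : 'I_n | (j0 < j)%N) m (vidx b j) +
  \sum_(j : 'I_n | (j <= j0)%N) m (vidx b' j))%N.
Proof.
rewrite vidx_sum exchange_big /= (bigID (fun j : 'I_n => (j0 < j)%N)) /=.
congr (_ + _)%N.
  apply: eq_bigr => j jj; rewrite (bigD1 b) //= big1 => [|r /negPf rb].
    by rewrite /deg vcolK vrowK jj eqxx mul1n addn0.
  by rewrite /deg vcolK vrowK jj rb mul0n.
apply: eq_big => [j|j /negPf jj]; first by rewrite -leqNgt.
rewrite (bigD1 b') //= big1 => [|r /negPf rb].
  by rewrite /deg vcolK vrowK jj eqxx mul1n addn0.
by rewrite /deg vcolK vrowK jj rb mul0n.
Qed.

(** A monomial m of P contributes to the coefficient of tau in P(g) only if it
agrees with e before the entry (b, j0); the homogeneity of P in row b' then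
bounds its s-degree in terms of e. *)
Let left_bound : (size (matev phi g P)@_tau <= K.+1)%N.
Proof.
rewrite /matev /mmap raddf_sum (leq_trans (size_sum _ _ _)) //.
apply/bigmax_leqP_seq => m mP _.
rewrite /= mcoeffCM mul_polyC (leq_trans (size_scale_leq _ _)) //.
have [->|t0] := eqVneq (mmap1 (fun i => g (vrow i) (vcol i)) m)@_tau 0; first by rewrite size_poly0.
have bprod : bounded_by (mmap1 (fun i => g (vrow i) (vcol i)) m)
    (\sum_i nu i *+ m i)%MM (\sum_i deg i * m i).
  by apply: bounded_prod => i; apply: boundedX; exact: bounded_entry.
have [] := bprod tau t0.
move=> le_t deg_t sz; have me := msupp_le_mlead mP.
have eq_me : forall j : 'I_N, (j < i0)%N -> m j = e j.
  apply: (lex_squeeze me (mdeg_supp mP) le_t deg_t) => j ji.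
  by rewrite /tau !nu_before.
rewrite (leq_trans sz) // ltnS sum_deg leq_add //.
  by rewrite leq_eqVlt; apply/orP; left; apply/eqP/eq_bigr => j jj; rewrite eq_me // ltb jj.
(* row b' of m and of e have the same sum, and they agree beyond column j0 *)
rewrite -(leq_add2l (\sum_(j : 'I_n | (j0 < j)%N) m (vidx b' j))).
have b'0 : (0 < b')%N by rewrite bb'.
have := semi_inv_supp Psi mP b'0; rewrite (bigID (fun j : 'I_n => (j0 < j)%N)) /=.
under [X in (_ + X)%N]eq_bigl => j do rewrite -leqNgt.
move=> ->; rewrite -(semi_inv_supp Psi (mlead_supp P0) b'0).
rewrite (bigID (fun j : 'I_n => (j0 < j)%N)) /=.
under [X in (X + _ <= _)%N]eq_bigr => j jj do rewrite -eq_me ?ltb' //.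
by under [X in (_ + X <= _)%N]eq_bigl => j do rewrite -leqNgt.
Qed.

(** The factor of coefc i that is not divisible by s, so that the lowest
coefficient in s of a product of entries can be read off. *)
Let epsc (i : 'I_N) : C :=
  if (i < i0)%N then 1 else if i == i0 then -1 else if i == i1 then 1
  else if vrow i == b' then ('X_i)%:P - ('X_(vidx b (vcol i)))%:P * 'X
  else ('X_i)%:P.

Let late (i : 'I_N) := ~~ [|| (i < i0)%N, i == i0 | i == i1].

Let epsc0 i : (epsc i)`_0 =
  (-1) ^+ (i == i0) *: 'X_[if late i then U_(i)%MM else 0%MM].
Proof.
rewrite /epsc /late; case: ltnP => //= ii.
  have -> : (i == i0) = false by rewrite -(inj_eq val_inj) ltn_eqF.
  by rewrite coef1 mpolyX0 scale1r.
have [_|_] /= := eqVneq i i0.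
  by rewrite coefN coef1 mpolyX0 scaleN1r.
have [_|_] /= := eqVneq i i1; first by rewrite coef1 mpolyX0 scale1r.
by rewrite scale1r; case: ifP => _; rewrite ?coefB ?coefCM ?coefX ?mulr0 ?subr0 coefC.
Qed.

Let latem (m : 'X_{1..N}) := (\sum_i (if late i then U_(i) else 0) *+ m i)%MM.

Let latemE m i : latem m i = if late i then m i else 0%N.
Proof.
rewrite /latem mnm_sumE (bigD1 i) //= big1 => [|j ji].
  by rewrite mulmnE addn0; case: ifP; rewrite ?mnm1E ?eqxx ?mul1n // mnm0E.
by rewrite mulmnE; case: ifP; rewrite ?mnm1E ?(negPf ji) // mnm0E.
Qed.

Let prod_epsc0 (m : 'X_{1..N}) : (\prod_i epsc i ^+ m i)`_0 =
  (\prod_i (-1) ^+ (i == i0) ^+ m i) *: 'X_[latem m].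
Proof.
rewrite -horner_coef0 horner_prod.
under eq_bigr => i _ do rewrite horner_exp horner_coef0 epsc0 exprZn.
by rewrite scaler_prod mprodXnE.
Qed.

Let prod_coefc (m : 'X_{1..N}) :
  \prod_i coefc i ^+ m i = 'X^(m i1) * \prod_i epsc i ^+ m i.
Proof.
have ce i : coefc i = (if i == i1 then 'X else 1) * epsc i.
  rewrite /coefc /epsc; have [->|_] := eqVneq i i1; last by rewrite mul1r.
  by rewrite ltnNge (ltnW i01_lt) /= eq_sym (negPf i01) mulr1.
under eq_bigr => i _ do rewrite ce exprMn.
rewrite big_split /=; congr (_ * _); rewrite (bigD1 i1) //= eqxx big1 ?mulr1 //.
by move=> i /negPf ->; rewrite expr1n.
Qed.

(** Among the monomials with the same outer part as e, those with a larger
exponent of s do not reach the coefficient of s^(e i1), and the lowest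
coefficients of the others are distinct inner monomials. *)
Let right_coef : exists2 c : A, c != 0 &
  ((matev phi h P)@_tau)`_(e i1)@_(latem e) = c.
Proof.
exists (P@_e * \prod_i (-1) ^+ (i == i0) ^+ e i).
  rewrite mulf_neq0 ?mleadc_eq0 //; apply/prodf_neq0 => i _.
  by rewrite expf_neq0 // signr_eq0.
have -> : matev phi h P = mmap (@mpolyC N C \o (polyC \o @mpolyC N A))
    (fun i => (coefc i)%:MP * 'X_[nu i]) P.
  by apply: eq_mmap => // i; rewrite hE vidxK.
rewrite mmap_monomial raddf_sum coef_sum raddf_sum /=.
rewrite (bigD1_seq e) ?msupp_uniq ?mlead_supp //= [X in _ + X]big1_seq => [|m].
  rewrite addr0 mcoeffZ mcoeffX eqxx mulr1 prod_coefc coefCM coefXnM.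
  rewrite ltnn subnn prod_epsc0 mul_mpolyC !mcoeffZ mcoeffX eqxx mulr1.
  by [].
case/andP=> me mP; rewrite mcoeffZ mcoeffX; case: eqP => [nut|_]; last first.
  by rewrite mulr0 coef0 mcoeff0.
rewrite mulr1 prod_coefc coefCM coefXnM; case: ltnP => m1; first by rewrite mulr0 mcoeff0.
have e_m : forall j : 'I_N, (j < i0)%N -> m j = e j.
  by move=> j ji; rewrite -(nu_before m ji) nut nu_before.
have m_i0 := lemc_head (msupp_le_mlead mP) (mdeg_supp mP) e_m.
have := nu_i0 m; rewrite nut nu_i0 => m01.
(* m i0 <= e i0 as e is the leading exponent, e i1 >= m i1, and the sums are
   equal *)
have [mi0 mi1] : m i0 = e i0 /\ m i1 = e i1 by lia.
rewrite mi1 subnn prod_epsc0 mul_mpolyC !mcoeffZ mcoeffX; case: eqP => [lm|_].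
  case/eqP: me; apply/mnmP => i; have := congr1 (fun q : 'X_{1..N} => q i) lm.
  rewrite !latemE; case: ifP => // /negbT; rewrite negbK => /or3P[/e_m//|/eqP->//|/eqP->//].
by rewrite !mulr0.
Qed.

Lemma lead_pattern :
  (\sum_(j : 'I_n | (j <= j0)%N) e (vidx b j) <=
   \sum_(j : 'I_n | (j < j0)%N) e (vidx b' j))%N.
Proof.
have [c c0 cE] := right_coef.
have sz : (L b + e i1 <= K)%N.
  rewrite leqNgt; apply: contra_neqN c0 => ltK.
  have ub : true ==> (b < b')%N by rewrite bb' ltnSn.
  have /(congr1 (fun q => q@_tau)) := Psi phi h ('X)%:MP b0 ub.
  rewrite -rmorphXn mul_mpolyC mcoeffZ -/g => E.
  rewrite -cE; pose r := (matev phi h P)@_tau; suff -> : r`_(e i1) = 0 by rewrite mcoeff0.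
  rewrite -(coefXnM_add r (L b)) -E.
  by apply: nth_default; exact: leq_trans left_bound ltK.
move: sz; rewrite -(semi_inv_supp Psi (mlead_supp P0) b0).
rewrite (bigID (fun j : 'I_n => (j0 < j)%N)) /= -addnA leq_add2l.
rewrite [X in (_ <= X)%N -> _](bigD1 j0) //= addnC leq_add2l => sz.
under eq_bigl => j do rewrite leqNgt.
rewrite (leq_trans sz) //; apply/eq_leq/eq_bigl => j.
by rewrite ltn_neqAle andbC.
Qed.

End LeadPattern.

(** * Columns of tableaux *)

(** A partial function defined exactly below l is listed without gaps, so that
positions in the list are arguments of the function. *)
Lemma pmap_enum_prefix (T : Type) (x0 : T) m (f : 'I_m -> option T) l :
  (l <= m)%N -> (forall i, isSome (f i) = (i < l)%N) ->
  size (pmap f (enum 'I_m)) = l /\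
  forall i : 'I_m, (i < l)%N -> nth x0 (pmap f (enum 'I_m)) i = odflt x0 (f i).
Proof.
move=> lm fS; have -> : pmap f (enum 'I_m) =
    [seq odflt x0 (f i) | i <- [seq i <- enum 'I_m | isSome (f i)]].
  by elim: (enum _) => //= i s ->; case E: (f i) => //=; rewrite E.
set s := filter _ _; have sE : map val s = iota 0 l.
  rewrite /s (eq_filter fS) -(filter_map val (fun i => i < l)%N) val_enum_ord.
  have -> : m = (l + (m - l))%N by rewrite subnKC.
  rewrite iotaD filter_cat (_ : filter _ (iota 0 l) = iota 0 l).
    rewrite (_ : filter _ _ = [::]) ?cats0 // -(filter_pred0 (iota (0 + l) (m - l))).
    by apply: eq_in_filter => i; rewrite mem_iota => /andP[li _]; rewrite ltnNge li.
  rewrite -[RHS]filter_predT; apply: eq_in_filter => i.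
  by rewrite mem_iota add0n => /andP[_ ->].
have sz : size s = l by rewrite -(size_map val) sE size_iota.
split=> [|i il]; first by rewrite size_map sz.
rewrite (nth_map i) ?sz //; congr (odflt x0 (f _)); apply: val_inj.
by rewrite -(nth_map i (val i) val) ?sz // sE nth_iota.
Qed.

(** A downward closed set of numbers is an initial segment, so membership is
detected by its cardinality. *)
Lemma ltn_count_initial (p : pred nat) w c :
  (forall x y, (x <= y)%N -> p y -> p x) -> (c < w)%N ->
  (c < \sum_(x < w) p x)%N = p c.
Proof.
move=> pS cw; have [pc|/negbTE npc] := boolP (p c).
  rewrite -(subnKC cw) big_split_ord /= (leq_trans _ (leq_addr _ _)) //.
  rewrite (eq_bigr (fun=> 1%N)) ?sum1_card ?card_ord // => i _.
  by rewrite (pS i c) // -ltnS.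
rewrite ltnNge; apply/negbF.
rewrite -(subnKC (ltnW cw)) big_split_ord /= [X in (_ + X)%N]big1 ?addn0 => [|i _].
  rewrite -[X in (_ <= X)%N](card_ord c) -sum1_card leq_sum // => i _.
  exact: leq_b1.
by apply/eqP; rewrite eqb0; apply: contraFN npc; apply: pS; exact: leq_addr.
Qed.

Lemma sum_ltn w x : (x <= w)%N -> (\sum_(c < w) (c < x)%N)%N = x.
Proof.
move=> xw; rewrite -(subnKC xw) big_split_ord /= [X in (_ + X)%N]big1 => [|c _].
  by rewrite addn0 (eq_bigr (fun=> 1%N)) ?sum1_card ?card_ord // => c _; rewrite ltn_ord.
by rewrite ltnNge leq_addr.
Qed.

Section Columns.
Variables (n' : nat) (la : seq nat).
Local Notation n := n'.+1.
Hypothesis la_sorted : sorted geq la.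
Implicit Type T : tableau n' la.

Lemma la_geq i i' : (i <= i')%N -> (nth 0 la i' <= nth 0 la i)%N.
Proof.
move=> ii; have [i'la|] := ltnP i' (size la); last by move/(nth_default 0%N) ->.
have tr : transitive geq by move=> a b c ab bc; exact: leq_trans bc ab.
apply: (sorted_leq_nth tr _ _ la_sorted) => //; first by move=> a; exact: leqnn.
by rewrite inE (leq_ltn_trans ii).
Qed.

Lemma la_head i : (nth 0 la i <= head 0 la)%N.
Proof. by rewrite -nth0 la_geq. Qed.

Lemma la_index_lt i (c : nat) : (c < nth 0 la i)%N -> (i < size la)%N.
Proof. by apply: contraTltn => /(nth_default 0%N) ->. Qed.

Definition column_height (c : nat) : nat := \sum_(i < size la) (c < nth 0 la i)%N.

Lemma ltn_column_height c i : (i < column_height c)%N = (c < nth 0 la i)%N.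
Proof.
have [ila|lai] := ltnP i (size la).
  rewrite (ltn_count_initial (p := fun i => c < nth 0 la i)%N) // => x y xy cy.
  exact: leq_trans cy (la_geq xy).
rewrite (nth_default _ lai) ltn0; apply/negbTE; rewrite -leqNgt.
apply: leq_trans lai; rewrite -[X in (_ <= X)%N](card_ord (size la)) -sum1_card.
by apply: leq_sum => j _; exact: leq_b1.
Qed.

Lemma columnP T (c : 'I_(head 0 la)) :
  size (column T c) = column_height c /\
  forall p : Defs.shape la, (val p).2 = c -> nth 0 (column T c) (val p).1 = T p.
Proof.
pose f (i : 'I_(size la)) : option nat :=
  omap (fun p : Defs.shape la => nat_of_ord (T p)) (insub (i, c)).
have fS i : isSome (f i) = (i < column_height c)%N.
  by rewrite ltn_column_height /f; case: insubP => [u|/negbTE] /= ->.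
have lm : (column_height c <= size la)%N.
  rewrite leqNgt; apply/negP; rewrite ltn_column_height => /la_index_lt.
  by rewrite ltnn.
have [sz nthE] := pmap_enum_prefix 0%N lm fS; split=> // p pc.
rewrite nthE; first by rewrite /f -pc -surjective_pairing valK.
by rewrite ltn_column_height -pc; exact: valP p.
Qed.

Lemma size_column T c : size (column T c) = column_height c.
Proof. by have [] := columnP T c. Qed.

Lemma nth_column T (p : Defs.shape la) :
  nth 0%N (column T (val p).2) (val p).1 = T p.
Proof. by have [_ ->] := columnP T (val p).2. Qed.

Lemma column_cell T (c : 'I_(head 0 la)) i : (i < size (column T c))%N ->
  exists2 p : Defs.shape la, (val p).2 = c & ((val p).1 = i :> nat).
Proof.
rewrite size_column ltn_column_height => ci.
by exists (exist _ (Ordinal (la_index_lt ci), c) ci).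
Qed.

Lemma sum_column_height i :
  (\sum_(c < head 0 la) (i < column_height c))%N = nth 0%N la i.
Proof.
under eq_bigr => c _ do rewrite ltn_column_height.
by rewrite sum_ltn // la_head.
Qed.

Lemma column_height_le (c : nat) : (column_height c <= size la)%N.
Proof.
rewrite leqNgt; apply/negP; rewrite ltn_column_height => /la_index_lt.
by rewrite ltnn.
Qed.

Lemma semistandard_column T (c : 'I_(head 0 la)) :
  pos_entries T -> semistandard T ->
  [/\ sorted ltn (column T c), all (fun j => 0 < j)%N (column T c)
    & all (fun j => j < n)%N (column T c)].
Proof.
move=> /forallP Tpos /forallP Tss.
have cell i : (i < size (column T c))%N ->
    exists2 p : Defs.shape la, (val p).2 = c &
      ((val p).1 = i :> nat) /\ nth 0%N (column T c) i = T p.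
  by move=> /column_cell[p pc pi]; exists p => //; split=> //; rewrite -pi -pc nth_column.
split.
- apply/(sortedP 0%N) => i ii.
  have [p pc [pi ->]] := cell _ (ltnW ii); have [q qc [qi ->]] := cell _ ii.
  have /forallP/(_ q)/andP[/implyP H _] := Tss p.
  by apply: H; rewrite pc qc eqxx pi qi ltnSn.
- by apply/(all_nthP 0%N) => i /cell[p _ [_ ->]]; exact: Tpos.
- by apply/(all_nthP 0%N) => i /cell[p _ [_ ->]].
Qed.

Lemma semistandard_row T i (c c' : 'I_(head 0 la)) : semistandard T ->
  (c <= c')%N -> (i < column_height c')%N ->
  (nth 0 (column T c) i <= nth 0 (column T c') i)%N.
Proof.
move=> /forallP Tss; rewrite leq_eqVlt => /orP[/eqP/val_inj ->//|cc] ic'.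
have ic : (i < column_height c)%N.
  by move: ic'; rewrite !ltn_column_height; exact: ltn_trans.
move: ic ic'; rewrite -!(size_column T) => /column_cell[p pc pi] /column_cell[q qc qi].
have -> : nth 0%N (column T c) i = T p by rewrite -pi -pc nth_column.
have -> : nth 0%N (column T c') i = T q by rewrite -qi -qc nth_column.
have /forallP/(_ q)/andP[_ /implyP] := Tss p.
by apply; rewrite pc qc cc andbT -(inj_eq val_inj) /= pi qi.
Qed.

End Columns.

(** * Bideterminants *)

Section BottomMinors.
Variables (R : comNzRingType) (n' : nat).
Local Notation n := n'.+1.
Implicit Types (K g : 'M[R]_n) (t : seq nat).

(** The products of these minors are the bideterminants whose row tableau is
filled with bottom rows; upper triangular row operations multiply them by
scalars. *)
Definition bottom_minor K t : R :=
  \det (\matrix_(a < size t, c < size t)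
    K (inord (n - size t + a)) (inord (nth 0%N t c))).

Lemma bottom_minorE K t l : size t = l -> bottom_minor K t =
  \det (\matrix_(a < l, c < l) K (inord (n - l + a)) (inord (nth 0%N t c))).
Proof. by move=> <-. Qed.

(** The lower right block is bordered by the identity, rather than extracted, so
that it multiplies and conjugates matrices of size n. *)
Definition inner_mx K : 'M[R]_n :=
  \matrix_(i, j) if (i == 0) || (j == 0) then (i == j)%:R else K i j.

(** The bottom rows of an upper triangular product only involve the bottom
rows, through the lower right block of the triangular factor. *)
Lemma bottom_minor_upper g K t : (size t <= n)%N ->
  (forall i j : 'I_n, (j < i)%N -> g i j = 0) ->
  bottom_minor (g *m K) t =
    (\prod_(i < n | (n - size t <= i)%N) g i i) * bottom_minor K t.
Proof.
move=> tn gU; set l := size t in tn *.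
pose r (a : 'I_l) : 'I_n := inord (n - l + a).
have rE (a : 'I_l) : r a = (n - l + a)%N :> nat.
  by rewrite inordK //; have := ltn_ord a; lia.
pose G : 'M[R]_l := \matrix_(a, a') g (r a) (r a').
have -> : \prod_(i < n | (n - l <= i)%N) g i i = \det G.
  rewrite -det_tr det_trig; last first.
    by apply/is_trig_mxP => a a' aa; rewrite !mxE gU // !rE ltn_add2l.
  pose F i := g (inord i) (inord i).
  rewrite (eq_bigr (fun i : 'I_n => F i)) => [|i _]; last by rewrite /F inord_val.
  rewrite -(big_geq_mkord (n - l)%N n xpredT F) -{1}[(n - l)%N]add0n big_addn.
  rewrite subKn // big_mkord; apply: eq_bigr => a _.
  by rewrite !mxE /F /r [(n - l + a)%N]addnC.
rewrite -det_mulmx; congr (\det _); apply/matrixP => a c; rewrite !mxE.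
pose F j := g (r a) (inord j) * K (inord j) (inord (nth 0%N t c)).
rewrite (eq_bigr (fun j : 'I_n => F j)) => [|j _]; last by rewrite /F inord_val.
rewrite [RHS](eq_bigr (fun a' : 'I_l => F (a' + (n - l))%N)) => [|a' _]; last first.
  by rewrite !mxE /F /r [(n - l + a')%N]addnC.
rewrite (bigID (fun j : 'I_n => (n - l <= j)%N)) /= [X in _ + X]big1 => [|j]; last first.
  rewrite -ltnNge => jl; rewrite /F inord_val gU ?mul0r // rE.
  exact: leq_trans jl (leq_addr _ _).
rewrite addr0 -(big_geq_mkord (n - l)%N n xpredT F) -{1}[(n - l)%N]add0n big_addn.
by rewrite subKn // big_mkord.
Qed.

Lemma det_inner_mx K : \det (inner_mx K) = bottom_minor (inner_mx K) (iota 1 n').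
Proof.
rewrite (@bottom_minorE _ _ n') ?size_iota // (expand_det_row _ ord0).
rewrite (bigD1 ord0) //= big1 => [|j j0]; last by rewrite mxE [_ == j]eq_sym (negPf j0) mul0r.
rewrite !mxE eqxx mul1r addr0 /cofactor expr0 mul1r; congr (\det _).
have lE (i : 'I_n') : inord i.+1 = lift ord0 i :> 'I_n.
  by apply: val_inj; rewrite /= inordK // ltnS ltn_ord.
apply/matrixP => i j; rewrite [RHS]mxE subSnn nth_iota // !add1n !lE.
by rewrite !mxE.
Qed.

Lemma bottom_minor_inner K K' t :
  (forall i j, i != 0 -> j != 0 -> K i j = K' i j) ->
  bottom_minor (inner_mx K) t = bottom_minor (inner_mx K') t.
Proof.
move=> KK; congr bottom_minor; apply/matrixP => i j; rewrite !mxE.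
by case: eqP => //= /eqP i0; case: eqP => //= /eqP j0; rewrite KK.
Qed.

Lemma inner_mx_upper g K : (forall i : 'I_n, i != 0 -> g i 0 = 0) -> g 0 0 = 1 ->
  (forall j : 'I_n, j != 0 -> g 0 j = 0) ->
  inner_mx (g *m K) = g *m inner_mx K.
Proof.
move=> gi0 g00 g0j; apply/matrixP => i j; rewrite !mxE.
rewrite (bigD1 0) //= [RHS](bigD1 0) //= mxE eqxx /=.
have [->|i0] := eqVneq i 0 => /=.
  rewrite [in RHS]big1 => [|l l0]; last by rewrite g0j ?mul0r.
  by rewrite g00 mul1r addr0 .
have [->|j0] := eqVneq j 0 => /=.
  rewrite gi0 // mul0r add0r (negPf i0) big1 // => l l0.
  by rewrite mxE (negPf l0) /= mulr0.
rewrite gi0 // !mul0r !add0r; apply: eq_bigr => l l0.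
by rewrite mxE (negPf l0) (negPf j0).
Qed.

End BottomMinors.

Lemma bottom_minor_map (R S : comNzRingType) (f : {rmorphism R -> S}) n'
    (K : 'M[R]_n'.+1) t :
  f (bottom_minor K t) = bottom_minor (map_mx f K) t.
Proof.
rewrite /bottom_minor -det_map_mx; congr (\det _).
by apply/matrixP => i j; rewrite !mxE.
Qed.

Lemma inner_mx_map (R S : comNzRingType) (f : {rmorphism R -> S}) n'
    (K : 'M[R]_n'.+1) :
  map_mx f (inner_mx K) = inner_mx (map_mx f K).
Proof.
by apply/matrixP => i j; rewrite !mxE; case: ifP => _ //; rewrite rmorph_nat.
Qed.

(** * Leading monomials of bottom minors *)

Section LeadTerms.
Variables (A : idomainType) (n' : nat).
Local Notation n := n'.+1.
Local Notation N := (n * n)%N.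
Local Notation D := {mpoly A[N]}.

Definition varmx : 'M[D]_n := \matrix_(r, j) 'X_(vidx r j).

(** A unit as leading coefficient makes division of a semi-invariant by
bideterminants possible over any integral domain. *)
Definition has_lead (q : D) (mu : 'X_{1..N}) :=
  (exists s : nat, q@_mu = (-1) ^+ s) /\ mlead q = mu.

Lemma has_lead_neq0 q mu : has_lead q mu -> q != 0.
Proof.
move=> [[s qs] _]; apply/eqP => q0; move: qs; rewrite q0 mcoeff0 => /esym/eqP.
by rewrite signr_eq0.
Qed.

Lemma has_leadP q mu s : q@_mu = (-1) ^+ s ->
  (forall m, m \in msupp q -> (m <= mu)%O) -> has_lead q mu.
Proof.
move=> qs qle; have muq : mu \in msupp q by rewrite mcoeff_msupp qs signr_eq0.
split; first by exists s.
apply/eqP; rewrite eq_le msupp_le_mlead // andbT qle // mlead_supp //.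
by apply: contraTneq muq => ->; rewrite msupp0.
Qed.

Lemma has_lead1 : has_lead 1 0%MM.
Proof. by split; [exists 0%N; rewrite mcoeff1 eqxx | exact: mlead1]. Qed.

Lemma has_leadM q1 q2 mu1 mu2 : has_lead q1 mu1 -> has_lead q2 mu2 ->
  has_lead (q1 * q2) (mu1 + mu2)%MM.
Proof.
move=> l1 l2; have z1 := has_lead_neq0 l1; have z2 := has_lead_neq0 l2.
case: l1 l2 => [[s1 q1s] m1] [[s2 q2s] m2]; split; last by rewrite mleadM ?m1 ?m2.
by exists (s1 + s2)%N; rewrite -m1 -m2 mleadcM m1 m2 q1s q2s exprD.
Qed.

Lemma has_lead_prod (I : Type) (r : seq I) (q : I -> D) (mu : I -> 'X_{1..N}) :
  (forall i, has_lead (q i) (mu i)) ->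
  has_lead (\prod_(i <- r) q i) (\sum_(i <- r) mu i)%MM.
Proof.
move=> ql; elim: r => [|i r IH]; first by rewrite !big_nil; exact: has_lead1.
by rewrite !big_cons; apply: has_leadM.
Qed.

Lemma has_leadX q mu d : has_lead q mu -> has_lead (q ^+ d) (mu *+ d)%MM.
Proof.
move=> ql; elim: d => [|d IH]; first by rewrite expr0 mulm0n; exact: has_lead1.
by rewrite exprS mulmS; apply: has_leadM.
Qed.

Section Column.
Variable t : seq nat.
Hypotheses (t_sorted : sorted ltn t) (t_pos : all (fun j => 0 < j)%N t)
  (t_lt : all (fun j => j < n)%N t) (t_size : (size t <= n')%N).

Local Notation l := (size t).

Let row (a : 'I_l) : 'I_n := inord (n - l + a).
Let col (c : 'I_l) : 'I_n := inord (nth 0%N t c).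

(** The antidiagonal of the bottom minor with columns t. *)
Definition column_mnm : 'X_{1..N} :=
  (\sum_(c < l) U_(vidx (inord (n' - c)) (inord (nth 0%N t c))))%MM.

Let rowE a : row a = (n - l + a)%N :> nat.
Proof. by rewrite inordK //; have := ltn_ord a; lia. Qed.

Let colE c : col c = nth 0%N t c :> nat.
Proof. by rewrite inordK //; apply: (allP t_lt); rewrite mem_nth. Qed.

Let row_inj : injective row.
Proof. by move=> a a' /(congr1 val) /=; rewrite !rowE => /addnI /val_inj. Qed.

Let lt_col (c c' : 'I_l) : (col c < col c')%N = (c < c')%N.
Proof.
have mono (x y : 'I_l) : (x < y)%N -> (col x < col y)%N.
  by move=> xy; rewrite !colE (sorted_ltn_nth ltn_trans 0%N t_sorted) ?inE.
case: (ltngtP c c') => [/mono->//|/mono cc|/val_inj ->]; last by rewrite ltnn.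
by apply/negbTE; rewrite -leqNgt ltnW.
Qed.

Let col_inj : injective col.
Proof.
move=> c c' cc; apply: val_inj; case: (ltngtP c c') => //.
  by rewrite -lt_col cc ltnn.
by rewrite -lt_col cc ltnn.
Qed.

Let perm_mnm (s : 'S_l) : 'X_{1..N} := (\sum_c U_(vidx (row (s c)) (col c)))%MM.

Let rev_perm : 'S_l := perm (@rev_ord_inj l).

Let perm_mnmE s r j :
  perm_mnm s (vidx r j) = (\sum_c (row (s c) == r) && (col c == j))%N.
Proof. by rewrite mnm_sumE; apply: eq_bigr => c _; rewrite mnm1E vidx_eq. Qed.

Let perm_mnm_deg s : mdeg (perm_mnm s) = l.
Proof.
rewrite mdeg_sum (eq_bigr (fun=> 1%N)) => [|c _]; last exact: mdeg1.
by rewrite sum1_card card_ord.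
Qed.

(** The extreme term of a minor is its antidiagonal: the last column, which
carries the most significant variables, picks the topmost row, and so on. *)
Let perm_mnm_lt s : s != rev_perm -> (perm_mnm s < perm_mnm rev_perm)%O.
Proof.
move=> sr; have [c0 c0P] : exists c, s c != rev_perm c.
  apply/existsP; apply: contraNT sr; rewrite negb_exists => /forallP H.
  by apply/eqP/permP => c; apply/eqP; rewrite -[_ == _]negbK.
(* the last column where the permutation is not the reversal decides *)
case: (@arg_maxnP _ c0 (fun c => s c != rev_perm c) (fun c : 'I_l => c : nat) c0P) => /= c cP c_max {c0 c0P}.
have s_rev (c' : 'I_l) : (c < c')%N -> s c' = rev_perm c'.
  move=> cc; apply/eqP; rewrite -[_ == _]negbK; apply/negP => /c_max.
  by rewrite leqNgt cc.
(* the rows above this one are already taken by the later columns *)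
have lt_sc : (rev_perm c < s c)%N.
  rewrite ltn_neqAle (inj_eq val_inj) eq_sym cP leqNgt; apply/negP => sc.
  have lt' : (rev_ord (s c) > c)%N.
    by move: sc; rewrite permE /=; have := ltn_ord (s c); have := ltn_ord c; lia.
  have := s_rev _ lt'; rewrite permE rev_ordK => /perm_inj e.
  by rewrite e ltnn in lt'.
apply/ltmcP; first by rewrite !perm_mnm_deg.
exists (vidx (row (rev_perm c)) (col c)) => [i|].
  case: i / (vidxP i) => r j; rewrite vidx_lt !perm_mnmE => rj.
  apply: eq_bigr => c' _; case: (ltngtP c c') => [/s_rev->//|c'c|/val_inj <-].
    have /negbTE -> : col c' != j; last by rewrite !andbF.
    have lt_cc : (col c' < col c)%N by rewrite lt_col.
    rewrite neq_ltn; apply/orP; left; case/orP: rj => [|/andP[/eqP-> _]//].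
    exact: ltn_trans.
  case/orP: rj => [cj|/andP[_ rc]].
    by have /negbTE -> : col c != j; rewrite ?andbF //; apply: contraTneq cj => ->; rewrite ltnn.
  have /negbTE -> : row (s c) != r.
    by apply: contraTneq rc => <-; rewrite -leqNgt !rowE leq_add2l ltnW.
  by have /negbTE -> : row (rev_perm c) != r; rewrite // neq_ltn rc orbT.
rewrite !perm_mnmE [X in (_ < X)%N](bigD1 c) //= !eqxx big1 // => c' _.
have [->|c'c] := eqVneq c' c; last by rewrite (inj_eq col_inj) (negPf c'c) andbF.
by rewrite (inj_eq row_inj) -(inj_eq val_inj) /= gtn_eqF.
Qed.

Let rev_mnm : perm_mnm rev_perm = column_mnm.
Proof.
apply: eq_bigr => c _; congr (U_(vidx _ _))%MM; apply: val_inj.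
rewrite [LHS]rowE permE /= inordK; have := ltn_ord c; lia.
Qed.

Lemma bottom_minor_lead :
  has_lead (bottom_minor (inner_mx varmx) t) column_mnm.
Proof.
have qE : bottom_minor (inner_mx varmx) t =
    \sum_(s : 'S_l) (-1) ^+ s *: 'X_[perm_mnm s].
  rewrite /bottom_minor -det_tr; apply: eq_bigr => s _.
  rewrite scaler_sign mulr_sign -mprodXE.
  suff -> : \prod_c ((\matrix_(a, c) inner_mx varmx (row a) (col c))^T : 'M[D]_l) c (s c)
    = \prod_c 'X_(vidx (row (s c)) (col c)) by [].
  apply: eq_bigr => c _; rewrite !mxE -!(inj_eq val_inj) /= rowE colE.
  have /negbTE -> : (n - l + s c != 0)%N by rewrite -lt0n ltn_addr // subn_gt0 ltnS t_size.
  by have /negbTE -> : nth 0%N t c != 0%N by rewrite -lt0n; apply: (allP t_pos); rewrite mem_nth.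
rewrite qE -rev_mnm; apply: (has_leadP (s := rev_perm)) => [|m].
  rewrite raddf_sum (bigD1 rev_perm) //= mcoeffZ mcoeffX eqxx mulr1 big1 ?addr0 //.
  by move=> s /perm_mnm_lt lt_s; rewrite mcoeffZ mcoeffX lt_eqF ?mulr0.
rewrite mcoeff_msupp raddf_sum /=; apply: contraNT; rewrite -ltNge => lt_m.
rewrite big1 // => s _; rewrite mcoeffZ mcoeffX; case: eqP => [sm|]; last by rewrite mulr0.
have [e|/perm_mnm_lt] := eqVneq s rev_perm; first by rewrite -sm e ltxx in lt_m.
by rewrite sm => /(lt_trans lt_m); rewrite ltxx.
Qed.

End Column.
End LeadTerms.

(** * Leading monomials and semistandard tableaux *)

Lemma eq_partial_sums n (f g : 'I_n -> nat) :
  (forall j0 : 'I_n, \sum_(j < n | (j <= j0)%N) f j = \sum_(j < n | (j <= j0)%N) g j)%N ->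
  f =1 g.
Proof.
move=> fg [j ltj]; elim/ltn_ind: j ltj => j IH ltj; have := fg (Ordinal ltj).
rewrite (bigD1 (Ordinal ltj)) //= [X in _ = X](bigD1 (Ordinal ltj)) //=.
suff -> : (\sum_(i < n | (i <= j)%N && (i != Ordinal ltj)) f i =
           \sum_(i < n | (i <= j)%N && (i != Ordinal ltj)) g i)%N by move/addIn.
apply: eq_bigr => -[i lti] /= /andP[ij ne]; apply: IH.
by rewrite ltn_neqAle ij andbT.
Qed.

Section TableauExponents.
Variables (n' : nat) (la : seq nat).
Local Notation n := n'.+1.
Local Notation N := (n * n)%N.
Hypotheses (la_sorted : sorted geq la) (la_size : (size la <= n')%N).
Implicit Type T : tableau n' la.

Definition tableau_minor (R : comNzRingType) (K : 'M[R]_n) T : R :=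
  \prod_(c < head 0%N la) bottom_minor K (column T c).

Definition tableau_mnm T : 'X_{1..N} :=
  (\sum_(c < head 0%N la) column_mnm n' (column T c))%MM.

Lemma column_mnmE t (r j : 'I_n) : (size t <= n')%N ->
  all (fun j => j < n)%N t ->
  column_mnm n' t (vidx r j) =
    ((n' - r < size t)%N && (nth 0%N t (n' - r) == j)) :> nat.
Proof.
move=> tn /allP tlt; rewrite mnm_sumE.
under eq_bigr => c _ do rewrite mnm1E vidx_eq -!(inj_eq val_inj) /=.
have rn := ltn_ord r.
have [lt_r|ge_r] /= := ltnP (n' - r) (size t).
  rewrite (bigD1 (Ordinal lt_r)) //= big1 => [|c /negPf cr].
    rewrite addn0 !inordK ?ltnS ?leq_subr //; last by apply: tlt; rewrite mem_nth.
    by rewrite subKn ?eqxx // -ltnS.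
  rewrite inordK ?ltnS ?leq_subr //.
  case: eqP => // e; move/negbT: cr; rewrite -(inj_eq val_inj) /= => /eqP; case.
  by have := ltn_ord c; lia.
rewrite big1 // => c _; rewrite inordK ?ltnS ?leq_subr //.
by case: eqP => // e; have := ltn_ord c; lia.
Qed.

Lemma tableau_mnmE T (r j : 'I_n) : pos_entries T -> semistandard T ->
  tableau_mnm T (vidx r j) =
   (\sum_(c < head 0%N la) ((n' - r < column_height la c)%N &&
      (nth 0%N (column T c) (n' - r) == j)))%N.
Proof.
move=> Tpos Tss; rewrite mnm_sumE; apply: eq_bigr => c _.
have [_ _ lt_t] := semistandard_column la_sorted c Tpos Tss.
rewrite column_mnmE ?size_column //.
by rewrite (leq_trans (column_height_le la_sorted c)).
Qed.

Lemma tableau_mnm_partial T (r j0 : 'I_n) : pos_entries T -> semistandard T ->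
  (\sum_(j < n | (j <= j0)%N) tableau_mnm T (vidx r j) =
   \sum_(c < head 0%N la) ((n' - r < column_height la c)%N &&
      (nth 0%N (column T c) (n' - r) <= j0)%N))%N.
Proof.
move=> Tpos Tss; under eq_bigr => j _ do rewrite tableau_mnmE //.
rewrite exchange_big; apply: eq_bigr => c _ /=.
case: ltnP => /= [lt_r|_]; last by rewrite big1.
set x := nth _ _ _; have ltx : (x < n)%N.
  have [_ _ /allP] := semistandard_column la_sorted c Tpos Tss; apply.
  by rewrite mem_nth // size_column.
case: leqP => xj.
  rewrite (bigD1 (Ordinal ltx)) //= eqxx big1 // => j /andP[_ jx].
  by case: eqP => // e; case/eqP: jx; apply: val_inj.
by rewrite big1 // => j jj; rewrite gtn_eqF // (leq_ltn_trans jj).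
Qed.

(** Within a row of a semistandard tableau, the boxes with small entries form
an initial segment, so the contents of the rows determine the tableau. *)
Lemma tableau_mnm_cell T (p : Defs.shape la) (j : 'I_n) :
  pos_entries T -> semistandard T ->
  (T p <= j)%N = ((val p).2 < \sum_(j' < n | (j' <= j)%N)
     tableau_mnm T (vidx (inord (n' - (val p).1)) j'))%N.
Proof.
move=> Tpos Tss; set i := (val p).1.
have lt_in : (i < n')%N by exact: leq_trans (ltn_ord i) la_size.
have rE : (n' - (inord (n' - i) : 'I_n) = i)%N by rewrite inordK; lia.
rewrite tableau_mnm_partial // rE.
pose q (x : nat) := if insub x is Some c then
  (i < column_height la (c : 'I_(head 0%N la)))%N && (nth 0%N (column T c) i <= j)%N
  else false.
rewrite (eq_bigr (fun c : 'I_(head 0%N la) => nat_of_bool (q c))) => [|c _]; last first.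
  by rewrite /q valK.
rewrite ltn_count_initial // => [|x y xy].
  rewrite /q valK nth_column // ltn_column_height //.
  by rewrite (valP p : (_ < _)%N).
rewrite /q; case: insubP => // c' _ yE /andP[hy ty].
have ltx : (x < head 0%N la)%N by apply: (leq_ltn_trans xy); rewrite -yE; exact: ltn_ord.
have cc' : (Ordinal ltx <= c')%N by have := xy; rewrite -yE.
rewrite insubT /=.
rewrite (leq_trans (semistandard_row la_sorted Tss cc' hy)) // andbT.
by move: hy; rewrite !ltn_column_height //; exact: leq_ltn_trans.
Qed.

Lemma tableau_mnm_inj (T T' : ssyt n' la) :
  tableau_mnm (val T) = tableau_mnm (val T') -> T = T'.
Proof.
move=> TT; apply: val_inj; apply/ffunP => p.
have [/andP[Tp Ts] /andP[Tp' Ts']] := (valP T, valP T').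
have le_iff j : (val T p <= j)%N = (val T' p <= j)%N.
  have [ltj|lej] := ltnP j n; last by rewrite !(leq_trans (ltnW (ltn_ord _))).
  by rewrite !(tableau_mnm_cell p (Ordinal ltj)) // TT.
by apply: val_inj; apply/eqP; rewrite eqn_leq le_iff leqnn -le_iff leqnn.
Qed.

(** In a tableau, row i has entries of size at most j in the first cum i j - d
boxes, d being the number of full columns removed. So a box of row i and column
c receives the number of those j for which at most c + d entries are below or
equal to j; the interlacing inequalities are what makes the columns strictly
increasing. *)
Section PatternToTableau.
Variables (d : nat) (e : 'X_{1..N}).
Hypothesis e0 : forall r j : 'I_n, (r == 0) || (j == 0) -> e (vidx r j) = 0%N.
Hypothesis e_sum : forall b : 'I_n, (0 < b)%N ->
  (\sum_j e (vidx b j) = d + nth 0%N la (n' - b))%N.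
Hypothesis e_pattern : forall b b' j0 : 'I_n, (0 < b)%N -> b' = b.+1 :> nat ->
  (\sum_(j : 'I_n | (j <= j0)%N) e (vidx b j) <=
   \sum_(j : 'I_n | (j < j0)%N) e (vidx b' j))%N.

Let cum (i j : nat) := (\sum_(j' < n | (j' <= j)%N) e (vidx (inord (n' - i)) j'))%N.

Let cum0 i : cum i 0 = 0%N.
Proof.
rewrite /cum big1 // => j; rewrite leqn0 => /eqP j0; rewrite e0 //.
by apply/orP; right; apply/eqP; apply: val_inj.
Qed.

Let cum_mono i j j' : (j <= j')%N -> (cum i j <= cum i j')%N.
Proof.
move=> jj; rewrite /cum [X in (_ <= X)%N](bigID (fun c : 'I_n => c <= j)%N) /=.
rewrite (leq_trans _ (leq_addr _ _)) // eq_leq //; apply: eq_bigl => c.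
by case: (leqP c j) => cj; rewrite ?andbF // (leq_trans cj).
Qed.

Let cum_top i j : (i < n')%N -> (n' <= j)%N -> cum i j = (d + nth 0%N la i)%N.
Proof.
move=> lt_i lej; pose b : 'I_n := inord (n' - i).
have bE : b = (n' - i)%N :> nat by rewrite inordK // ltnS leq_subr.
have b0 : (0 < b)%N by rewrite bE subn_gt0.
have := e_sum b0; rewrite bE subKn ?(ltnW lt_i) // => <-; apply: eq_bigl => c.
by rewrite (leq_trans _ lej) // -ltnS.
Qed.

(** The interlacing inequality, in terms of rows of the tableau: its row i comes
from the row n' - i of the matrix. *)
Let cum_int i j : (i.+1 < n')%N -> (cum i.+1 j.+1 <= cum i j)%N.
Proof.
move=> lt_i; have [lej|ltj] := leqP n' j.
  rewrite !cum_top ?leqW //; last exact: ltnW.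
  by rewrite leq_add2l la_geq.
pose b : 'I_n := inord (n' - i.+1); pose b' : 'I_n := inord (n' - i).
have bE : b = (n' - i.+1)%N :> nat by rewrite inordK // ltnS leq_subr.
have b'E : b' = (n' - i)%N :> nat by rewrite inordK // ltnS leq_subr.
have b0 : (0 < b)%N by rewrite bE subn_gt0.
have bb' : b' = b.+1 :> nat by rewrite bE b'E subnSK // ltnW.
have jE : (inord j.+1 : 'I_n) = j.+1 :> nat by rewrite inordK.
by have := e_pattern (inord j.+1) b0 bb'; rewrite jE.
Qed.

Let cum_ge i j : (i < j)%N -> (i < n')%N -> (d <= cum i j)%N.
Proof.
have [k] := ubnP (n' - i); elim: k i j => // k IH i j ki ij lt_i.
have [lt_i1|le_i1] := ltnP i.+1 n'.
  by apply: leq_trans (cum_int j lt_i1); apply: IH; lia.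
by rewrite cum_top ?leq_addr //; lia.
Qed.

Let cum_zero i j : (j <= i)%N -> (i < n')%N -> cum i j = 0%N.
Proof.
elim: j i => [|j IH] [|i] ji lt_i; rewrite ?cum0 //.
apply/eqP; rewrite -leqn0 (leq_trans (cum_int _ lt_i)) // leqn0 IH //.
exact: ltnW.
Qed.

Let entry (i c : nat) : nat := \sum_(j < n) (cum i j <= c + d)%N.

Let ltn_entry i c j : (j < n)%N -> (j < entry i c)%N = (cum i j <= c + d)%N.
Proof.
move=> jn; rewrite /entry (ltn_count_initial (p := fun j => cum i j <= c + d)%N) //.
by move=> x y xy; apply: leq_trans; exact: cum_mono.
Qed.

Let entry_lt i c : (c < nth 0%N la i)%N -> (entry i c < n)%N.
Proof.
move=> ci; have lt_i : (i < n')%N by exact: leq_trans (la_index_lt ci) la_size.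
by rewrite ltnS leqNgt ltn_entry // cum_top // addnC leq_add2r -ltnNge.
Qed.

Let entry_pos i c : (0 < entry i c)%N.
Proof. by rewrite ltn_entry // cum0. Qed.

Let entry_col i i' c : (i < i')%N -> (c < nth 0%N la i')%N ->
  (entry i c < entry i' c)%N.
Proof.
move=> ii ci'; have step q : (c < nth 0%N la q.+1)%N -> (entry q c < entry q.+1 c)%N.
  move=> cq; have cq' : (c < nth 0%N la q)%N by rewrite (leq_trans cq) // la_geq.
  have lt_q : (q.+1 < n')%N by exact: leq_trans (la_index_lt cq) la_size.
  rewrite ltn_entry ?entry_lt //.
  have e_pos := entry_pos q c; rewrite -(prednK e_pos).
  rewrite (leq_trans (cum_int _ lt_q)) // -ltn_entry ?prednK //.
  by rewrite (leq_trans _ (entry_lt cq')) // ltnS leq_pred.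
elim: i' ii ci' => // i' IH; rewrite ltnS leq_eqVlt => /orP[/eqP<-|ii] ci'.
  exact: step.
apply: ltn_trans (step _ ci'); apply: IH => //.
by rewrite (leq_trans ci') // la_geq.
Qed.

Let entry_row i c c' : (c <= c')%N -> (entry i c <= entry i c')%N.
Proof.
move=> cc; apply: leq_sum => j _; case: (leqP (cum i j) (c + d)) => //= le.
by rewrite (leq_trans le) // leq_add2r.
Qed.

(** This is the correspondence between Gelfand-Tsetlin patterns and
semistandard tableaux, for the partition enlarged by [d] full columns. *)
Lemma pattern_tableau : exists2 T : tableau n' la,
  pos_entries T && semistandard T &
  e = (tableau_mnm T + column_mnm n' (iota 1 n') *+ d)%MM.
Proof.
pose T : tableau n' la := [ffun p : Defs.shape la => inord (entry (val p).1 (val p).2)].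
have TE p : T p = entry (val p).1 (val p).2 :> nat.
  by rewrite ffunE inordK // entry_lt // (valP p : (_ < _)%N).
have Tpos : pos_entries T by apply/forallP => p; rewrite TE.
have Tss : semistandard T.
  apply/forallP => p; apply/forallP => q; rewrite !TE; apply/andP; split.
    apply/implyP => /andP[/eqP-> ?]; apply: entry_col => //.
    exact: (valP q : (_ < _)%N).
  by apply/implyP => /andP[/eqP-> ?]; apply: entry_row; exact: ltnW.
exists T; first by rewrite Tpos.
apply/mnmP => x; case: x / (vidxP x) => r; have [->|r0] := eqVneq r 0 => j.
  rewrite mnmDE mulmnE e0 ?eqxx // tableau_mnmE //.
  rewrite column_mnmE ?size_iota //; last first.
    by apply/allP => x; rewrite mem_iota add1n => /andP[].
  rewrite subn0 ltnn mul0n addn0.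
  rewrite big1 // => c _; have := column_height_le la_sorted c.
  by move/leq_trans/(_ la_size); rewrite leqNgt => /negbTE ->.
have r_pos : (0 < r)%N by rewrite lt0n.
move: j; apply: eq_partial_sums => j0.
under [RHS]eq_bigr => j _ do rewrite mnmDE mulmnE.
rewrite big_split /= tableau_mnm_partial // -big_distrl /=.
pose i := (n' - r)%N; rewrite -/i; have rn := ltn_ord r.
have lt_i : (i < n')%N by rewrite /i; lia.
have -> : (\sum_(j < n | (j <= j0)%N) e (vidx r j) = cum i j0)%N.
  apply: eq_bigr => j _; congr (e (vidx _ _)); apply: val_inj.
  by rewrite [RHS]inordK /i ?ltnS ?leq_subr // subKn // -ltnS.
have -> : (\sum_(j < n | (j <= j0)%N) column_mnm n' (iota 1 n') (vidx r j) =
    (i < j0)%N)%N.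
  under eq_bigr => j _.
    rewrite column_mnmE ?size_iota //; last first.
      by apply/allP => x; rewrite mem_iota add1n => /andP[].
    rewrite -/i lt_i nth_iota // add1n /=; over.
  case: ltnP => ij.
    have lt_i1 : (i.+1 < n)%N by rewrite ltnS.
    rewrite (bigD1 (Ordinal lt_i1)) //= eqxx big1 // => j /andP[_ ji].
    by case: eqP => // e1; case/eqP: ji; apply: val_inj.
  rewrite big1 // => j jj; case: eqP => // e1; move: jj; rewrite -e1 => jj.
  by have := leq_trans jj ij; rewrite ltnn.
have -> : (\sum_(c < head 0%N la) ((i < column_height la c)%N &&
    (nth 0%N (column T c) i <= j0)%N) =
    \sum_(c < head 0%N la) (c < cum i j0 - d)%N)%N.
  apply: eq_bigr => c _; rewrite ltn_column_height //; congr nat_of_bool.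
  have [ci|ci] /= := ltnP c (nth 0%N la i).
    have [p pc pi] : exists2 p : Defs.shape la, (val p).2 = c & (val p).1 = i :> nat.
      apply: (@column_cell n' la la_sorted T c i).
      by rewrite size_column // ltn_column_height.
    rewrite -pi -pc nth_column // TE pi pc leqNgt ltn_entry // -ltnNge.
    by rewrite ltn_subRL addnC.
  apply/esym/negbTE; rewrite -leqNgt (leq_trans _ ci) // leq_subLR.
  by rewrite -(cum_top lt_i (leqnn n')) cum_mono // -ltnS.
have le_w : (cum i j0 - d <= head 0%N la)%N.
  rewrite (leq_trans _ (la_head la_sorted i)) // leq_subLR.
  by rewrite -(cum_top lt_i (leqnn n')) cum_mono // -ltnS.
rewrite sum_ltn //; case: ltnP => ij; first by rewrite mul1n subnK // cum_ge.
by rewrite cum_zero.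
Qed.

End PatternToTableau.
End TableauExponents.

(** * Bideterminants span the semi-invariants *)

Section SemiInvariantMinors.
Variables (A : idomainType) (n' : nat).
Local Notation n := n'.+1.
Local Notation N := (n * n)%N.
Local Notation D := {mpoly A[N]}.
Local Notation X := (varmx A n').

Lemma matevB (B : comNzRingType) (phi : {rmorphism A -> B}) (h : 'M[B]_n)
    (P Q : D) : matev phi h (P - Q) = matev phi h P - matev phi h Q.
Proof. exact: rmorphB. Qed.

Lemma matevM (B : comNzRingType) (phi : {rmorphism A -> B}) (h : 'M[B]_n)
    (P Q : D) : matev phi h (P * Q) = matev phi h P * matev phi h Q.
Proof. exact: rmorphM. Qed.

Lemma matev_varmx (B : comNzRingType) (phi : {rmorphism A -> B}) (h : 'M[B]_n) :
  map_mx (matev phi h) X = h.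
Proof.
apply/matrixP => i j; rewrite !mxE /matev mmapX mmap1U.
by rewrite vrowK vcolK.
Qed.

Lemma matev_minor (B : comNzRingType) (phi : {rmorphism A -> B}) (h : 'M[B]_n) t :
  matev phi h (bottom_minor (inner_mx X) t) = bottom_minor (inner_mx h) t.
Proof.
pose f : {rmorphism D -> B} := mmap phi (fun i => h (vrow i) (vcol i)).
transitivity (f (bottom_minor (inner_mx X) t)); first by [].
rewrite bottom_minor_map inner_mx_map; congr (bottom_minor (inner_mx _) t).
exact: (matev_varmx phi h).
Qed.

Lemma semi_inv_eq L L' (P : D) : (forall b : 'I_n, (0 < b)%N -> L b = L' b) ->
  semi_inv L P -> semi_inv L' P.
Proof. by move=> LL PL B phi h b b' s u b0 ub; rewrite PL // LL. Qed.

Lemma semi_invB L (P Q : D) : semi_inv L P -> semi_inv L Q -> semi_inv L (P - Q).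
Proof.
by move=> PL QL B phi h b b' s u b0 ub; rewrite !matevB mulrBr PL // QL.
Qed.

Lemma semi_invZ L c (P : D) : semi_inv L P -> semi_inv L (c *: P).
Proof.
move=> PL B phi h b b' s u b0 ub; rewrite -mul_mpolyC !matevM PL //.
by rewrite mulrCA; congr (_ * (_ * _)); rewrite /matev !mmapC.
Qed.

Lemma semi_invM L L' (P Q : D) : semi_inv L P -> semi_inv L' Q ->
  semi_inv (fun b => L b + L' b)%N (P * Q).
Proof.
move=> PL QL B phi h b b' s u b0 ub; rewrite !matevM PL // QL // exprD.
by rewrite mulrACA.
Qed.

Lemma semi_inv1 : semi_inv (fun=> 0%N) (1 : D).
Proof.
move=> B phi h b b' s u b0 ub; rewrite expr0 mul1r.
by rewrite /matev !rmorph1.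
Qed.

Lemma semi_invX L (P : D) d : semi_inv L P ->
  semi_inv (fun b => d * L b)%N (P ^+ d).
Proof.
move=> PL; elim: d => [|d IH]; first exact: semi_inv1.
rewrite exprS; exact: (semi_invM PL IH).
Qed.

Lemma semi_inv_prod (I : Type) (r : seq I) (L : I -> 'I_n -> nat) (P : I -> D) :
  (forall i, semi_inv (L i) (P i)) ->
  semi_inv (fun b => \sum_(i <- r) L i b)%N (\prod_(i <- r) P i).
Proof.
move=> PL; elim: r => [|i r IH].
  rewrite big_nil; apply: semi_inv_eq semi_inv1 => b _; by rewrite big_nil.
rewrite big_cons; apply: semi_inv_eq (semi_invM (PL i) IH) => b _.
by rewrite big_cons.
Qed.

Lemma rowop_inner (B : comNzRingType) (b b' : 'I_n) (s : B) u (h : 'M[B]_n) :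
  (0 < b)%N -> u ==> (b < b')%N ->
  inner_mx (rowop b b' s u *m h) = rowop b b' s u *m inner_mx h.
Proof.
move=> b0 ub; have /negPf b0' : b != 0 by rewrite -lt0n.
apply: inner_mx_upper => [i i0||j j0]; rewrite mxE.
- case: eqP => [_|_]; last by rewrite (negPf i0).
  rewrite eq_sym b0'; case: u ub => //= bb'.
  by rewrite -(inj_eq val_inj) /= ltn_eqF // (leq_trans b0) // ltnW.
- by rewrite eq_sym b0' eqxx.
- by rewrite eq_sym b0' eq_sym (negPf j0).
Qed.

Lemma semi_inv_minor t : (size t <= n')%N ->
  semi_inv (fun b : 'I_n => nat_of_bool (n - size t <= b)%N)
    (bottom_minor (inner_mx X) t).
Proof.
move=> tn B phi h b b' s u b0 ub; rewrite !matev_minor rowop_inner //.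
rewrite bottom_minor_upper; last first.
- by move=> i j; exact: rowop_upper.
- exact: leqW.
congr (_ * _); have [nb|bn] := leqP (n - size t)%N b.
  rewrite (bigD1 b) //= mxE !eqxx big1 ?mulr1 ?expr1 // => i /andP[_ ib].
  by rewrite mxE (negPf ib) eqxx.
rewrite big1 // => i ni; rewrite mxE; case: eqP => [ib|_]; last by rewrite eqxx.
by move: ni; rewrite ib leqNgt bn.
Qed.

Lemma inner_minor t : inner (bottom_minor (inner_mx X) t).
Proof.
by move=> B phi h h' hh'; rewrite !matev_minor; exact: bottom_minor_inner.
Qed.

Lemma innerB (P Q : D) : inner P -> inner Q -> inner (P - Q).
Proof. by move=> PL QL B phi h h' hh; rewrite !matevB (PL _ _ _ _ hh) (QL _ _ _ _ hh). Qed.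

Lemma innerM (P Q : D) : inner P -> inner Q -> inner (P * Q).
Proof. by move=> PL QL B phi h h' hh; rewrite !matevM (PL _ _ _ _ hh) (QL _ _ _ _ hh). Qed.

Lemma innerZ c (P : D) : inner P -> inner (c *: P).
Proof.
move=> PL B phi h h' hh; rewrite -mul_mpolyC !matevM (PL _ _ _ _ hh).
by rewrite /matev !mmapC.
Qed.

Lemma inner1 : inner (1 : D).
Proof. by move=> B phi h h' hh; rewrite /matev !rmorph1. Qed.

Lemma innerX (P : D) d : inner P -> inner (P ^+ d).
Proof.
move=> PL; elim: d => [|d IH]; first exact: inner1.
by rewrite exprS; exact: innerM.
Qed.

Lemma inner_prod (I : Type) (r : seq I) (P : I -> D) :
  (forall i, inner (P i)) -> inner (\prod_(i <- r) P i).
Proof.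
move=> PL; elim: r => [|i r IH]; first by rewrite big_nil; exact: inner1.
by rewrite big_cons; exact: innerM.
Qed.

End SemiInvariantMinors.

Section Spanning.
Variables (A : idomainType) (n' : nat) (la : seq nat) (d : nat).
Local Notation n := n'.+1.
Local Notation N := (n * n)%N.
Local Notation D := {mpoly A[N]}.
Local Notation X := (varmx A n').
Hypotheses (la_sorted : sorted geq la) (la_size : (size la <= n')%N).

Definition tableau_weight (b : 'I_n) : nat := (d + nth 0%N la (n' - b))%N.

Definition tableau_poly (T : ssyt n' la) : D :=
  \det (inner_mx X) ^+ d * tableau_minor (inner_mx X) (val T).

Definition tableau_lead (T : ssyt n' la) : 'X_{1..N} :=
  (tableau_mnm (val T) + column_mnm n' (iota 1 n') *+ d)%MM.

Lemma tableau_poly_lead T : has_lead (tableau_poly T) (tableau_lead T).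
Proof.
rewrite /tableau_poly /tableau_lead mulrC; apply: has_leadM.
  apply: has_lead_prod => c.
  have /andP[Tp Ts] := valP T.
  have [st pt lt] := semistandard_column la_sorted c Tp Ts.
  apply: bottom_minor_lead => //.
  by rewrite size_column // (leq_trans (column_height_le la_sorted c)).
rewrite det_inner_mx; apply: has_leadX; apply: bottom_minor_lead.
- exact: iota_ltn_sorted.
- by apply/allP => x; rewrite mem_iota => /andP[].
- by apply/allP => x; rewrite mem_iota => /andP[].
- by rewrite size_iota.
Qed.

Lemma tableau_poly_inner T : inner (tableau_poly T).
Proof.
apply: innerM; last by apply: inner_prod => c; exact: inner_minor.
by apply: innerX; rewrite det_inner_mx; exact: inner_minor.
Qed.

Lemma tableau_poly_semi_inv T : semi_inv tableau_weight (tableau_poly T).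
Proof.
have h_le c : (size (column (val T) c) <= n')%N.
  by rewrite size_column // (leq_trans (column_height_le la_sorted c)).
have S1 := semi_inv_prod (index_enum _) (fun c => semi_inv_minor (A := A) (h_le c)).
have S2 : semi_inv (fun b : 'I_n => d * nat_of_bool (n - size (iota 1 n') <= b))%N
    (\det (inner_mx X) ^+ d).
  by rewrite det_inner_mx; apply: semi_invX; apply: semi_inv_minor; rewrite size_iota.
apply: semi_inv_eq (semi_invM S2 S1) => b b0.
rewrite size_iota subSnn b0 muln1; congr (_ + _)%N.
rewrite -(sum_column_height la_sorted); apply: eq_bigr => c _.
rewrite size_column //; congr nat_of_bool.
have := column_height_le la_sorted c; have := ltn_ord b.
by move: (column_height la c) => x; lia.
Qed.

Lemma tableau_lead_inj : injective tableau_lead.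
Proof.
move=> T T' /addIm TT; exact: (tableau_mnm_inj la_sorted la_size).
Qed.

Lemma lead_is_tableau (P : D) : semi_inv tableau_weight P -> inner P -> P != 0 ->
  exists T : ssyt n' la, mlead P = tableau_lead T.
Proof.
move=> Psi Pin P0; have eP := mlead_supp P0.
have [T TP eE] : exists2 T : tableau n' la, pos_entries T && semistandard T &
    mlead P = (tableau_mnm T + column_mnm n' (iota 1 n') *+ d)%MM.
  apply: pattern_tableau => //.
  - by move=> r j rj; exact: (inner_supp Pin eP rj).
  - by move=> b b0; exact: (semi_inv_supp Psi eP b0).
  - by move=> b b' j0 b0 bb'; exact: (lead_pattern Psi Pin P0 j0 b0 bb').
by exists (exist _ T TP).
Qed.

(** Subtracting a multiple of the matching tableau polynomial lowers the
leading monomial of a semi-invariant. *)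
Lemma semi_inv_span (P : D) : semi_inv tableau_weight P -> inner P ->
  exists c : ssyt n' la -> A, P = \sum_T c T *: tableau_poly T.
Proof.
have [m] : {m | mlead P = m} by exists (mlead P).
elim/(@ltmwf N): m P => m IH P mP Psi Pin.
have [->|P0] := eqVneq P 0.
  by exists (fun=> 0); rewrite big1 // => T _; rewrite scale0r.
have [T eT] := lead_is_tableau Psi Pin P0.
have [[s lT] mT] := tableau_poly_lead T.
(* the leading coefficient of the tableau polynomial is the sign of exponent
   s, which is its own inverse *)
pose a := P@_m * (-1) ^+ s; pose Q := P - a *: tableau_poly T.
have Qm : Q@_m = 0.
  rewrite mcoeffB mcoeffZ -{2}mP eT lT -mulrA -exprD addnn -mul2n exprM.
  by rewrite sqrrN expr1n expr1n mulr1 subrr.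
have Qsi : semi_inv tableau_weight Q.
  by apply: semi_invB => //; apply: semi_invZ; exact: tableau_poly_semi_inv.
have Qin : inner Q.
  by apply: innerB => //; apply: innerZ; exact: tableau_poly_inner.
suff [c Qc] : exists c : ssyt n' la -> A, Q = \sum_T c T *: tableau_poly T.
  exists (fun T' => c T' + a *+ (T' == T)).
  under eq_bigr => T' _ do rewrite scalerDl.
  rewrite big_split /= -Qc (bigD1 T) //= eqxx big1 => [|T' /negPf ->].
    by rewrite addr0 /Q subrK.
  by rewrite mulr0n scale0r.
have [Q0|Q0] := eqVneq Q 0.
  by exists (fun=> 0); rewrite Q0 big1 // => T' _; rewrite scale0r.
apply: (IH (mlead Q)) => //; rewrite lt_neqAle; apply/andP; split.
  by apply: contraNneq Q0 => mQ; rewrite -mleadc_eq0 mQ Qm.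
apply: le_trans (mleadB_le _ _) _; rewrite leUx mP lexx /=.
by rewrite (le_trans (mleadZ_le _ _)) // mT -eT mP.
Qed.

(** The tableau polynomials have distinct leading monomials with invertible
coefficients; the largest one with a nonzero coefficient cannot cancel. *)
Lemma tableau_poly_indep (c : ssyt n' la -> A) :
  \sum_T c T *: tableau_poly T = 0 -> forall T, c T = 0.
Proof.
move=> c0 T0; apply/eqP/negPn/negP => cT0.
case: (@arg_maxP _ _ _ T0 (fun T => c T != 0) tableau_lead cT0) => T cT Tmax.
have [[s lT] _] := tableau_poly_lead T.
have := congr1 (mcoeff (tableau_lead T)) c0; rewrite mcoeff0 raddf_sum /=.
rewrite (bigD1 T) //= big1 => [|T' T'T].
  by rewrite addr0 mcoeffZ lT => /eqP; rewrite mulf_eq0 (negPf cT) signr_eq0.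
have [cT'|/Tmax leT] := eqVneq (c T') 0; first by rewrite cT' scale0r mcoeff0.
rewrite mcoeffZ mcoeff_gt_mlead ?mulr0 //; have [_ ->] := tableau_poly_lead T'.
by rewrite lt_neqAle (inj_eq tableau_lead_inj) T'T; exact: leT.
Qed.

End Spanning.

(** * From values to formal semi-invariants *)

Lemma mulXC_eq0 (R : idomainType) (q : {poly R}) (a : R) :
  a != 0 -> q * ('X * a%:P) = 0 -> q = 0.
Proof.
move=> a0 /eqP; rewrite !mulf_eq0 polyX_eq0 polyC_eq0 (negPf a0) !orbF.
by move/eqP.
Qed.

(** The ring A of coefficients is separated by specializations eps to k, as a
polynomial ring over an infinite field is by its points. *)
Section Density.
Variables (k : fieldType) (A : idomainType) (n' : nat) (I : Type).
Local Notation n := n'.+1.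
Local Notation N := (n * n)%N.
Local Notation D := {mpoly A[N]}.
Local Notation X := (varmx A n').
Hypothesis infk : infinite_type k.
Variables (iota : {rmorphism k -> A}) (eps : I -> {rmorphism A -> k}).
Hypotheses (iota_inj : injective iota) (eps_iota : forall c x, eps c (iota x) = x).
Hypothesis eps_sep : forall a, (forall c, eps c a = 0) -> a = 0.

Lemma det_inner_varmx_neq0 : \det (inner_mx X) != 0.
Proof.
rewrite det_inner_mx; apply: has_lead_neq0 (bottom_minor_lead _ _ _ _ _).
- exact: iota_ltn_sorted.
- by apply/allP => x; rewrite mem_iota => /andP[].
- by apply/allP => x; rewrite mem_iota => /andP[].
- by rewrite size_iota.
Qed.

Lemma matev_det_inner (B : comNzRingType) (phi : {rmorphism A -> B}) (h : 'M[B]_n) :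
  matev phi h (\det (inner_mx X)) = \det (inner_mx h).
Proof. by rewrite !det_inner_mx matev_minor. Qed.

(** Semi-invariance is a formal identity, so it may be tested on the matrices
with invertible inner part over an infinite field. *)
Lemma semi_inv_density (L : 'I_n -> nat) (P : D) :
  (forall c (h : 'M[k]_n) (r r' : 'I_n) s u, (0 < r)%N -> u ==> (r < r')%N ->
     s != 0 -> \det (inner_mx h) != 0 ->
     matev (eps c) (rowop r r' s u *m h) P = s ^+ L r * matev (eps c) h P) ->
  semi_inv L P.
Proof.
move=> PL B phi h r r' s u r0 ur.
pose lhs : {poly D} := matev (polyC \o @mpolyC N A)
  (rowop r r' 'X u *m map_mx polyC X) P.
pose q : {poly D} := lhs - 'X^(L r) * P%:P.
have evq (B' : comNzRingType) (phi' : {rmorphism A -> B'}) (h' : 'M[B']_n) s' :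
    (map_poly (matev phi' h') q).[s'] =
      matev phi' (rowop r r' s' u *m h') P - s' ^+ L r * matev phi' h' P.
  pose ev : {rmorphism D -> B'} := mmap phi' (fun i => h' (vrow i) (vcol i)).
  pose psi : {rmorphism {poly D} -> B'} := (horner_eval s' \o map_poly ev).
  have psiX : psi 'X = s' by rewrite /psi /= map_polyX /horner_eval hornerX.
  have psiC a : psi a%:P = ev a by rewrite /psi /= map_polyC /horner_eval hornerC.
  transitivity (psi q); first by [].
  rewrite /q rmorphB rmorphM rmorphXn psiX psiC; congr (_ - _).
  rewrite /lhs /matev rmorph_mmap; apply: eq_mmap => [a|i] /=.
    by rewrite map_polyC /horner_eval hornerC; exact: mmapC.
  have <- : map_mx psi (rowop r r' 'X u *m map_mx polyC X) = rowop r r' s' u *m h'.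
    rewrite map_mxM; congr (_ *m _).
      apply/matrixP => a c; rewrite !mxE; case: ifP => _; last exact: rmorph_nat.
      by case: ifP => _; [exact: psiX | exact: rmorph_nat].
    rewrite -[RHS](matev_varmx phi' h'); apply/matrixP => a c.
    by rewrite [LHS]mxE [X in psi X]mxE psiC [RHS]mxE.
  by rewrite [RHS]mxE.
clearbody q; suff q0 : q = 0.
  have := evq B phi h s; rewrite q0 map_poly0 horner0 => /esym/eqP.
  by rewrite subr_eq0 => /eqP.
(* the values are known for invertible row operations and invertible blocks
   only; multiplying by s and by the determinant covers the others *)
apply: (mulXC_eq0 det_inner_varmx_neq0).
apply: (@poly_vanish k _ (fun x => (iota x)%:MP)) => //.
  move=> x y /(congr1 (mcoeff 0)); rewrite !mcoeffC eqxx !mulr1.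
  exact: iota_inj.
move=> x; apply: (@mpoly_vanish k _ A iota) => // v; apply: eps_sep => c.
pose h' : 'M[k]_n := \matrix_(a, j) v (vidx a j).
pose ev : {rmorphism D -> k} := mmap (eps c) (fun i => h' (vrow i) (vcol i)).
have evE p : eps c (p.@[iota \o v]) = ev p.
  rewrite /meval rmorph_mmap; apply: eq_mmap => // i /=.
  by rewrite eps_iota /h' mxE vidxK.
rewrite [LHS](evE _) hornerM !hornerE rmorphM rmorphM.
have evdX : ev (\det (inner_mx X)) = \det (inner_mx h').
  exact: (matev_det_inner (eps c) h').
have evx : ev (iota x)%:MP = x.
  by transitivity (eps c (iota x)); [exact: mmapC | exact: eps_iota].
rewrite evdX evx.
have -> : ev q.[(iota x)%:MP] = (map_poly (matev (eps c) h') q).[x].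
  by rewrite -[in RHS]evx; exact: (esym (horner_map ev q _)).
rewrite evq.
have [->|x0] := eqVneq x 0; first by rewrite !(mul0r, mulr0).
have [->|h0] := eqVneq (\det (inner_mx h')) 0; first by rewrite !(mul0r, mulr0).
by rewrite PL // subrr !mul0r.
Qed.

End Density.

Section TableauEvaluation.
Variables (A : idomainType) (n' : nat) (la : seq nat) (d : nat).
Local Notation n := n'.+1.

Lemma matev_tableau_sum (B : comNzRingType) (phi : {rmorphism A -> B})
    (h : 'M[B]_n) (c : ssyt n' la -> A) :
  matev phi h (\sum_T c T *: tableau_poly A d T) =
  \det (inner_mx h) ^+ d * \sum_T phi (c T) * tableau_minor (inner_mx h) (val T).
Proof.
rewrite mulr_sumr /matev rmorph_sum; apply: eq_bigr => T _ /=.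
rewrite mmapZ mulrCA; congr (_ * _).
rewrite rmorphM rmorphXn /=; congr (_ ^+ _ * _); first exact: matev_det_inner.
rewrite rmorph_prod; apply: eq_bigr => i _; exact: matev_minor.
Qed.

End TableauEvaluation.

(** A matrix with the first basis vector as its first column differs from its
bordered lower right block by a unitriangular factor, concentrated in the first
row. *)
Section InnerFactor.
Variables (k : fieldType) (n' : nat).
Local Notation n := n'.+1.
Variable K : 'M[k]_n.
Hypothesis K0 : col 0 K = col 0 1%:M.

Let Ki0 i : K i 0 = (i == 0)%:R.
Proof. by have := congr1 (fun M : 'cV_n => M i 0) K0; rewrite !mxE. Qed.

Lemma det_inner_frame : \det (inner_mx K) = \det K.
Proof.
rewrite (expand_det_col _ 0) [RHS](expand_det_col _ 0); apply: eq_bigr => i _.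
rewrite mxE orbT Ki0; have [->|_] := eqVneq i 0; last by rewrite !mul0r.
congr (_ * (_ * \det _)); apply/matrixP => a b; rewrite !mxE.
by rewrite ![lift 0 _ == 0]eq_sym !(negPf (neq_lift _ _)).
Qed.

Lemma inner_factor : K \in unitmx ->
  upper_unitriangular (K *m invmx (inner_mx K)).
Proof.
move=> uK; have uI : inner_mx K \in unitmx.
  by rewrite unitmxE det_inner_frame -unitmxE.
have row_eq i j : i != 0 -> (K *m invmx (inner_mx K)) i j = (i == j)%:R.
  move=> i0; transitivity ((inner_mx K *m invmx (inner_mx K)) i j).
    rewrite [LHS]mxE [RHS]mxE; apply: eq_bigr => l _; rewrite [inner_mx K i l]mxE.
    by have [->|_] := eqVneq l 0; rewrite ?orbT ?Ki0 // orbF (negPf i0).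
  by rewrite mulmxV // mxE.
have I0 : inner_mx K *m delta_mx 0 0 = delta_mx 0 0 :> 'cV_n.
  rewrite -colE; apply/matrixP => i j; rewrite !mxE orbT [j]ord1 eqxx andbT.
  by [].
have I0' : invmx (inner_mx K) *m delta_mx 0 0 = delta_mx 0 0 :> 'cV_n.
  by rewrite -{1}I0 mulKmx.
split=> [i|i j ji].
  have [->|i0] := eqVneq i 0; last by rewrite row_eq // eqxx.
  have : col 0 (K *m invmx (inner_mx K)) = col 0 1%:M.
    by rewrite colE -mulmxA I0' -colE.
  by move/matrixP/(_ 0 0); rewrite [LHS]mxE => ->; rewrite !mxE.
rewrite row_eq; first by rewrite -(inj_eq val_inj) /= gtn_eqF.
by rewrite -lt0n (leq_ltn_trans _ ji).
Qed.

End InnerFactor.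

Section Evaluation.
Variables (k : fieldType) (n' : nat).
Hypothesis infk : infinite_type k.
Local Notation n := n'.+1.
Local Notation kg := (polyfun k n').
Local Notation Apol := {mpoly k[n]}.

Definition evm (A : 'M[k]_n) : {rmorphism kg -> k} := meval (mxvec A 0).

Lemma evm_ext (f g : kg) : (forall A, evm A f = evm A g) -> f = g.
Proof.
move=> fg; apply/eqP; rewrite -subr_eq0; apply/eqP.
apply: (@mpoly_vanish k _ k idfun) => // v.
have -> : (f - g).@[idfun \o v] = evm (vec_mx (\row_i v i)) (f - g).
  by apply: meval_eq => i; rewrite vec_mxK mxE.
by rewrite rmorphB fg subrr.
Qed.

Lemma evm_xmx A : map_mx (evm A) (xmx k n') = A.
Proof.
apply/matrixP => i j; rewrite !mxE /xvar /evm /= mevalXU.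
exact: mxvecE.
Qed.

Definition chi (R : comNzRingType) (A : 'M[R]_n) (i : 'I_n) : R := (char_poly A)`_i.

(** Polynomials in n variables are the polynomials in the coefficients of the
characteristic polynomial: this morphism supplies the invariants occurring as
coordinates in the bases. *)
Definition rho : {rmorphism Apol -> kg} :=
  mmap (@mpolyC _ k) (chi (xmx k n')).

Lemma evm_chi A i : evm A (chi (xmx k n') i) = chi A i.
Proof.
rewrite /chi -(coef_map (evm A)); congr (_`_ _).
by rewrite /= map_char_poly evm_xmx.
Qed.

Lemma evm_rho A a : evm A (rho a) = a.@[chi A].
Proof.
rewrite /rho /= rmorph_mmap; apply: eq_mmap => [c|i] /=.
  by rewrite /evm /= mevalC.
exact: evm_chi.
Qed.

Lemma char_poly_conj (A B g : 'M[k]_n) : g \in unitmx -> A *m g = g *m B ->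
  char_poly A = char_poly B.
Proof.
move=> ug AB; have gP : \det (map_mx polyC g) != 0.
  by rewrite det_map_mx polyC_eq0 -unitfE -unitmxE.
apply: (mulIf gP); rewrite /char_poly [in RHS]mulrC -!det_mulmx; congr (\det _).
rewrite /char_poly_mx mulmxBl mulmxBr mul_scalar_mx mul_mx_scalar.
by rewrite -!map_mxM AB.
Qed.

Lemma evm_conj_act g f A : evm A (conj_act g f) = evm (invmx g *m A *m g) f.
Proof. exact: evalmx_conj_act. Qed.

Lemma rho_invariant a : Defs.invariant (rho a).
Proof.
move=> g ug; apply: evm_ext => A; rewrite evm_conj_act !evm_rho.
apply: meval_eq => i; rewrite /chi.
rewrite (@char_poly_conj (invmx g *m A *m g) A (invmx g)) ?unitmx_inv //.
by rewrite mulmxK.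
Qed.

Lemma evm_invariant (f : kg) (A B g : 'M[k]_n) : Defs.invariant f ->
  g \in unitmx -> A *m g = g *m B -> evm A f = evm B f.
Proof.
move=> fI ug AB; rewrite -{1}(fI g ug) evm_conj_act.
by rewrite -mulmxA AB mulKmx.
Qed.

End Evaluation.

(** * A parametrization of the matrices with a cyclic first basis vector *)

(** The frame of A is its Krylov basis followed by a change of basis Tau that
depends on the characteristic polynomial only and fixes the first vector. Both
kinds of minors in the theorem are minors of frames: Tau = 1 gives the
vectors A^t e_0, and another Tau the gradients of the traces of exterior powers.
Transporting the companion matrix by Tau gives a section of the map from
matrices to their characteristic polynomial on which the frame is the
identity. *)
Section Parametrization.
Variables (k : fieldType) (n' : nat).
Hypothesis infk : infinite_type k.
Local Notation n := n'.+1.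
Local Notation kg := (polyfun k n').
Local Notation Apol := {mpoly k[n]}.
Variables (Tau Tau' : 'M[Apol]_n).
Hypotheses (TauK : Tau *m Tau' = 1%:M) (Tau0 : col 0 Tau = col 0 1%:M).

Local Notation tau c := (map_mx (meval c) Tau).
Local Notation tau' c := (map_mx (meval c) Tau').

Definition frame (A : 'M[k]_n) : 'M[k]_n := krylov A *m tau (chi A).

Definition frame_pol : 'M[kg]_n := krylov (xmx k n') *m map_mx (rho k n') Tau.

Definition section_pol : 'M[Apol]_n := Tau' *m companion (fun i => 'X_i) *m Tau.

Definition section_mx (c : 'I_n -> k) : 'M[k]_n := map_mx (meval c) section_pol.

Lemma section_mxE c : section_mx c = tau' c *m companion c *m tau c.
Proof.
rewrite /section_mx /section_pol !map_mxM; congr (_ *m _ *m _).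
apply/matrixP => i j; rewrite !mxE; case: ifP => _; first by rewrite rmorphN /= mevalXU.
by rewrite rmorph_nat.
Qed.

Lemma tauK c : tau c *m tau' c = 1%:M.
Proof. by rewrite -map_mxM TauK map_mx1. Qed.

Lemma tauVK c : tau' c *m tau c = 1%:M.
Proof. by rewrite -map_mxM (mulmx1C TauK) map_mx1. Qed.

Lemma tau_col c : col 0 (tau c) = col 0 1%:M.
Proof. by rewrite -map_col Tau0 map_col map_mx1. Qed.

Lemma tauV_col c : col 0 (tau' c) = col 0 1%:M.
Proof.
by rewrite colE -[delta_mx 0 0]mul1mx -colE -{1}(tau_col c) colE mulmxA tauVK -colE.
Qed.

Lemma evm_frame A : map_mx (evm A) frame_pol = frame A.
Proof.
rewrite /frame_pol map_mxM; congr (_ *m _).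
  apply/matrixP => i j; rewrite !mxE -{2}(evm_xmx A) -[map_mx _ _ ^+ j]rmorphXn.
  by rewrite [RHS]mxE.
apply/matrixP => i j; rewrite !mxE; exact: evm_rho.
Qed.

Lemma frame_col A : col 0 (frame A) = col 0 1%:M.
Proof.
rewrite /frame colE -mulmxA -colE tau_col [col 0 1%:M]colE mul1mx -colE.
by apply/matrixP => i j; rewrite !mxE [j]ord1 eqxx andbT.
Qed.

Lemma frame_conj A B g al : g \in unitmx -> A *m g = g *m B ->
  col 0 g = al *: col 0 1%:M -> al *: frame A = g *m frame B.
Proof.
move=> ug AB g0; rewrite /frame scalemxAl (krylov_conj AB g0) -mulmxA.
by congr (_ *m (_ *m _)); apply/matrixP => i j; rewrite !mxE /chi (char_poly_conj ug AB).
Qed.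

Lemma section_conj c : section_mx c *m tau' c = tau' c *m companion c.
Proof. by rewrite section_mxE -!mulmxA tauK mulmx1. Qed.

Lemma unit_tau' c : tau' c \in unitmx.
Proof. by case/mulmx1_unit: (tauK c). Qed.

Lemma chi_section c : chi (section_mx c) =1 c.
Proof.
move=> i; rewrite /chi (char_poly_conj (unit_tau' c) (section_conj c)).
exact: char_poly_companion.
Qed.

Lemma frame_section c : frame (section_mx c) = 1%:M.
Proof.
have e : tau (chi (section_mx c)) = tau c.
  by apply/matrixP => i j; rewrite !mxE; apply: meval_eq; exact: chi_section.
have := krylov_conj (al := 1) (section_conj c).
rewrite scale1r tauV_col => /(_ erefl); rewrite scale1r krylov_companion mulmx1 => kE.
by rewrite /frame e kE tauVK.
Qed.

(** In the basis given by its frame, A has the matrix prescribed by the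
section. *)
Lemma mul_frame A : A *m frame A = frame A *m section_mx (chi A).
Proof.
rewrite section_mxE /frame mulmxA mul_krylov -!mulmxA; congr (_ *m _).
by rewrite !mulmxA tauK mul1mx.
Qed.

(** Every invertible matrix fixing the first basis vector is thus a frame, with
any prescribed characteristic polynomial. *)
Lemma frame_of_conj c g : g \in unitmx -> col 0 g = col 0 1%:M ->
  frame (g *m section_mx c *m invmx g) = g.
Proof.
move=> ug g0; have := @frame_conj (g *m section_mx c *m invmx g) (section_mx c) g 1 ug.
by rewrite mulmxKV // !scale1r frame_section mulmx1; apply.
Qed.

End Parametrization.

(** * The basis attached to a frame *)

Section Weights.
Variables (k : fieldType) (n' : nat) (la : seq nat).
Local Notation n := n'.+1.
Hypotheses (la_sorted : sorted geq la) (la_size : (size la <= n')%N).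

Definition row_weight : weight n' :=
  bracket (pad_weight n' [:: sumn la]) (pad_weight n' la).

Lemma sum_column_heights : (\sum_(c < head 0%N la) column_height la c)%N = sumn la.
Proof.
rewrite exchange_big /= sumnE (big_nth 0%N) big_mkord; apply: eq_bigr => i _.
by rewrite sum_ltn // la_head.
Qed.

(** The weight is written without negative exponents. *)
Lemma weight_charE (S : 'M[k]_n) : (forall i, S i i != 0) ->
  weight_char row_weight S * \prod_i S i i ^+ nth 0%N la (n' - i) =
  S 0 0 ^+ sumn la.
Proof.
move=> S0; have SE i : S i i ^ row_weight i * S i i ^+ nth 0%N la (n' - i) =
    S i i ^+ nth 0%N [:: sumn la] i.
  rewrite /row_weight /bracket /pad_weight /= subSS !exprnP -expfzDr //.
  by rewrite subrK.
rewrite /weight_char -big_split /= (bigD1 0) //= big1 => [|i i0].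
  by rewrite mulr1 SE.
rewrite SE; move: i0; rewrite -(inj_eq val_inj) /=.
by case: (nat_of_ord i) (S i i) => // m x _; rewrite /= nth_nil.
Qed.

Lemma bottom_minor_scale (R : comNzRingType) (a : R) (K : 'M[R]_n) t :
  bottom_minor (a *: K) t = a ^+ size t * bottom_minor K t.
Proof.
rewrite -detZ; congr (\det _); apply/matrixP => i j; by rewrite !mxE.
Qed.

Lemma tableau_minor_scale (R : comNzRingType) (a : R) (K : 'M[R]_n)
    (T : tableau n' la) :
  tableau_minor (a *: K) T = a ^+ sumn la * tableau_minor K T.
Proof.
rewrite -sum_column_heights /tableau_minor -prodrXr -big_split /=.
by apply: eq_bigr => c _; rewrite bottom_minor_scale size_column.
Qed.

(** The diagonal entry i is met by the columns of height at least n - i, whose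
number is the part of index n' - i of the partition. *)
Lemma tableau_minor_upper (R : comNzRingType) (g K : 'M[R]_n)
    (T : tableau n' la) : (forall i j : 'I_n, (j < i)%N -> g i j = 0) ->
  tableau_minor (g *m K) T =
    (\prod_i g i i ^+ nth 0%N la (n' - i)) * tableau_minor K T.
Proof.
move=> gU; have cn (c : 'I_(head 0%N la)) : (column_height la c <= n')%N.
  exact: leq_trans (column_height_le la_sorted c) la_size.
have -> : \prod_i g i i ^+ nth 0%N la (n' - i) =
    \prod_(c < head 0%N la) \prod_(i < n | (n - column_height la c <= i)%N) g i i.
  under [RHS]eq_bigr => c _ do rewrite big_mkcond.
  rewrite exchange_big; apply: eq_bigr => i _ /=.
  rewrite -(sum_column_height la_sorted) -prodrXr; apply: eq_bigr => c _.
  have -> : (n' - i < column_height la c)%N = (n - column_height la c <= i)%N.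
    by have := cn c; have := ltn_ord i; lia.
  by case: ifP; rewrite ?expr1 ?expr0.
rewrite /tableau_minor -big_split; apply: eq_bigr => c _ /=.
by rewrite bottom_minor_upper // ?size_column // leqW.
Qed.

Lemma tableau_minor_map (R S : comNzRingType) (f : {rmorphism R -> S})
    (K : 'M[R]_n) (T : tableau n' la) :
  f (tableau_minor K T) = tableau_minor (map_mx f K) T.
Proof.
by rewrite rmorph_prod; apply: eq_bigr => c _; exact: bottom_minor_map.
Qed.

Lemma tableau_minor_inner (R : comNzRingType) (K : 'M[R]_n) (T : tableau n' la) :
  pos_entries T -> semistandard T ->
  tableau_minor (inner_mx K) T = tableau_minor K T.
Proof.
move=> Tp Ts; apply: eq_bigr => c _.
have [st /allP pt /allP lt] := semistandard_column la_sorted c Tp Ts.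
have sz : (size (column T c) <= n')%N.
  by rewrite size_column // (leq_trans (column_height_le la_sorted c)).
congr (\det _); apply/matrixP => i j; rewrite !mxE -!(inj_eq val_inj) /=.
rewrite !inordK; last 2 first.
- by apply: lt; rewrite mem_nth.
- by have := ltn_ord i; lia.
have /negbTE -> : (n - size (column T c) + i != 0)%N.
  by rewrite -lt0n ltn_addr // subn_gt0 ltnS.
by have /negbTE -> : nth 0%N (column T c) j != 0%N by rewrite -lt0n; apply: pt; rewrite mem_nth.
Qed.

End Weights.

Section Membership.
Variables (k : fieldType) (n' : nat) (la : seq nat).
Hypothesis infk : infinite_type k.
Local Notation n := n'.+1.
Local Notation kg := (polyfun k n').
Local Notation Apol := {mpoly k[n]}.
Hypotheses (la_sorted : sorted geq la) (la_size : (size la <= n')%N).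
Variables (Tau Tau' : 'M[Apol]_n).
Hypotheses (TauK : Tau *m Tau' = 1%:M) (Tau0 : col 0 Tau = col 0 1%:M).

Local Notation F := (frame Tau).
Local Notation Fpol := (frame_pol Tau).

Definition frame_tableau (T : ssyt n' la) : kg := tableau_minor Fpol (val T).

Lemma evm_frame_tableau A T :
  evm A (frame_tableau T) = tableau_minor (F A) (val T).
Proof. by rewrite /frame_tableau tableau_minor_map (evm_frame Tau A). Qed.

(** Conjugation by an upper triangular matrix multiplies the frame on the left
by that matrix and divides it by the eigenvalue on the first basis vector. *)
Lemma frame_tableau_conj (A B g : 'M[k]_n) al T : g \in unitmx ->
  A *m g = g *m B -> col 0 g = al *: col 0 1%:M ->
  (forall i j : 'I_n, (j < i)%N -> g i j = 0) ->
  al ^+ sumn la * evm A (frame_tableau T) =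
    (\prod_i g i i ^+ nth 0%N la (n' - i)) * evm B (frame_tableau T).
Proof.
move=> ug AB g0 gU; rewrite !evm_frame_tableau -tableau_minor_scale //.
by rewrite (frame_conj Tau ug AB g0) tableau_minor_upper.
Qed.

Lemma upper_col (g : 'M[k]_n) : (forall i j : 'I_n, (j < i)%N -> g i j = 0) ->
  col 0 g = g 0 0 *: col 0 1%:M.
Proof.
move=> gU; apply/matrixP => i j; rewrite !mxE.
by have [->|i0] := eqVneq i 0; rewrite ?mulr1 // mulr0 gU // lt0n.
Qed.

Lemma upper_unit (g : 'M[k]_n) : (forall i j : 'I_n, (j < i)%N -> g i j = 0) ->
  (forall i, g i i != 0) -> g \in unitmx.
Proof.
move=> gU g0; rewrite -unitmx_tr unitmxE det_trig.
  by rewrite unitfE; apply/prodf_neq0 => i _; rewrite mxE.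
by apply/is_trig_mxP => i j ij; rewrite mxE gU.
Qed.

Lemma frame_tableau_weight (T : ssyt n' la) : U_weight_space k (row_weight la) (frame_tableau T).
Proof.
have conj g A : g \in unitmx -> A *m g = g *m (invmx g *m A *m g) :> 'M[k]_n.
  by move=> ug; rewrite !mulmxA mulmxV // mul1mx.
split=> [g [g1 gU]|S Sd uS].
  have ug : g \in unitmx by apply: upper_unit => // i; rewrite g1 oner_neq0.
  apply: (evm_ext infk) => A; rewrite evm_conj_act.
  have := frame_tableau_conj T ug (conj g A ug) (upper_col gU) gU.
  rewrite g1 expr1n mul1r => ->; rewrite big1 ?mul1r // => i _.
  by rewrite g1 expr1n.
have SU (i j : 'I_n) : (j < i)%N -> S i j = 0.
  by move=> ji; move/is_diag_mxP: Sd; apply; rewrite neq_ltn ji orbT.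
have S0 i : S i i != 0.
  move: uS; rewrite unitmxE unitfE det_trig; last first.
    by apply/is_trig_mxP => a b ab; move/is_diag_mxP: Sd; apply; rewrite neq_ltn ab.
  by move/prodf_neq0/(_ i isT).
apply: (evm_ext infk) => A; rewrite evm_conj_act.
have := frame_tableau_conj T uS (conj S A uS) (upper_col SU) SU.
rewrite -(weight_charE la S0) [in RHS]/evm /= mevalZ.
set p := \prod_i _ => E; have p0 : p != 0.
  by apply/prodf_neq0 => i _; rewrite expf_neq0.
by apply: (mulfI p0); rewrite -E mulrAC mulrC.
Qed.

End Membership.

Section Spanning.
Variables (k : fieldType) (n' : nat) (la : seq nat).
Hypothesis infk : infinite_type k.
Local Notation n := n'.+1.
Local Notation N := (n * n)%N.
Local Notation kg := (polyfun k n').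
Local Notation Apol := {mpoly k[n]}.
Local Notation D := {mpoly Apol[N]}.
Hypotheses (la_sorted : sorted geq la) (la_size : (size la <= n')%N).
Variables (Tau Tau' : 'M[Apol]_n).
Hypotheses (TauK : Tau *m Tau' = 1%:M) (Tau0 : col 0 Tau = col 0 1%:M).

Local Notation F := (frame Tau).
Local Notation Fpol := (frame_pol Tau).
Local Notation sec := (section_mx Tau Tau').
Local Notation b := (frame_tableau Tau).

Lemma frame_pol_neq0 : \det Fpol != 0.
Proof.
apply/eqP => /(congr1 (evm (sec (fun=> 0)))).
rewrite rmorph0 -det_map_mx (evm_frame Tau) (frame_section TauK Tau0) det1.
by move/eqP; rewrite oner_eq0.
Qed.

(** The matrices with an invertible frame are dense, as the determinant of the
frame is a nonzero polynomial. *)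
Lemma evm_ext_frame (f g : kg) :
  (forall A, F A \in unitmx -> evm A f = evm A g) -> f = g.
Proof.
move=> fg; apply: (mulIf frame_pol_neq0); apply: (evm_ext infk) => A.
rewrite !rmorphM /= -[in LHS]det_map_mx -[in RHS]det_map_mx (evm_frame Tau).
have [uF|] := boolP (F A \in unitmx); first by rewrite [meval _ f](fg A uF).
by rewrite unitmxE unitfE negbK => /eqP ->; rewrite !mulr0.
Qed.

Lemma invmx_mul (A B : 'M[k]_n) : A \in unitmx -> B \in unitmx ->
  invmx (A *m B) = invmx B *m invmx A.
Proof. by move=> uA uB; exact: (@invrM 'M[k]_n A B uA uB). Qed.

Lemma rmorph_mul3 (R S : comNzRingType) (g : {rmorphism R -> S}) m
    (M1 M2 M3 : 'M[R]_m) i j :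
  g ((M1 *m M2 *m M3) i j) = (map_mx g M1 *m map_mx g M2 *m map_mx g M3) i j.
Proof. by rewrite -!map_mxM [RHS]mxE. Qed.

Section Transport.
Variable f : kg.
Hypothesis fw : U_weight_space k (row_weight la) f.

Lemma evm_unitriangular g A B : upper_unitriangular g -> g \in unitmx ->
  A *m g = g *m B -> evm A f = evm B f.
Proof.
move=> gU ug AB; have := fw.1 g gU => fg.
by rewrite -{1}fg evm_conj_act -mulmxA AB mulKmx.
Qed.

Let d := msize f.

(** This is det(h)^d f(h C h^-1), for C on the section and h a bordered block,
with the inverse replaced by the adjugate: a polynomial in the entries of h
since d bounds the degree of f. *)
Definition hom_value (B : comNzRingType) (phi : Apol -> B) (h : 'M[B]_n) : B :=
  \sum_(m <- msupp f) phi (f@_m)%:MP * (\det (inner_mx h) ^+ (d - mdeg m) *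
    mmap1 (fun p => mxvec (inner_mx h *m map_mx phi (section_pol Tau Tau')
                            *m \adj (inner_mx h)) 0 p) m).

Definition hom_pol : D := hom_value (@mpolyC N Apol) (varmx Apol n').

Lemma matev_hom_pol (B : comNzRingType) (phi : {rmorphism Apol -> B}) h :
  matev phi h hom_pol = hom_value phi h.
Proof.
pose ev : {rmorphism D -> B} := mmap phi (fun i => h (vrow i) (vcol i)).
have evh : map_mx ev (inner_mx (varmx Apol n')) = inner_mx h.
  by rewrite inner_mx_map; congr inner_mx; exact: (matev_varmx phi h).
transitivity (ev hom_pol); first by [].
rewrite /hom_pol /hom_value rmorph_sum; apply: eq_bigr => m _.
rewrite rmorphM rmorphM rmorphXn -det_map_mx evh; congr (_ * (_ * _)).
  exact: mmapC.
rewrite /mmap1 rmorph_prod; apply: eq_bigr => p _; rewrite rmorphXn; congr (_ ^+ _).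
case/mxvec_indexP: p => i j; rewrite !mxvecE.
rewrite rmorph_mul3 map_mx_adj evh; congr ((_ *m _ *m _) i j).
by apply/matrixP => a c; rewrite [LHS]mxE [X in ev X]mxE [RHS]mxE; exact: mmapC.
Qed.

Lemma hom_value_conj (c : 'I_n -> k) (h : 'M[k]_n) : \det (inner_mx h) != 0 ->
  hom_value (meval c) h = \det (inner_mx h) ^+ d *
    evm (inner_mx h *m sec c *m invmx (inner_mx h)) f.
Proof.
move=> h0; have uh : inner_mx h \in unitmx by rewrite unitmxE unitfE.
rewrite /hom_value /evm /= mevalE mulr_sumr [LHS]big_seq [RHS]big_seq.
apply: eq_bigr => m mf; rewrite mevalC [RHS]mulrCA; congr (_ * _).
have dE : \det (inner_mx h) ^+ d =
    \det (inner_mx h) ^+ (d - mdeg m) * \det (inner_mx h) ^+ mdeg m.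
  by rewrite -exprD subnK // ltnW // msize_mdeg_lt.
rewrite dE -mulrA; congr (_ * _).
rewrite mdegE -prodrXr -big_split; apply: eq_bigr => p _ /=.
rewrite -exprMn; congr (_ ^+ _); case/mxvec_indexP: p => i j; rewrite !mxvecE.
by rewrite /invmx uh -scalemxAr [X in _ * X]mxE mulrA divff // mul1r.
Qed.

(** Acting on the rows of the frame amounts to conjugating the matrix. *)
Lemma hom_value_semi_inv (c : 'I_n -> k) (h : 'M[k]_n) (r r' : 'I_n) (s : k) u :
  (0 < r)%N -> u ==> (r < r')%N -> s != 0 -> \det (inner_mx h) != 0 ->
  hom_value (meval c) (rowop r r' s u *m h) =
    s ^+ tableau_weight la d r * hom_value (meval c) h.
Proof.
move=> r0 ur s0 h0; set g := rowop r r' s u.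
have gU (i j : 'I_n) : (j < i)%N -> g i j = 0 by exact: rowop_upper.
have gii i : g i i = if i == r then s else 1.
  by rewrite mxE eqxx; case: (i == r).
have ghE : inner_mx (g *m h) = g *m inner_mx h by exact: rowop_inner.
(* the row operation factors into a diagonal matrix S s and a unitriangular
   matrix V, for which the behaviour of f is prescribed *)
pose S (x : k) : 'M[k]_n := diag_mx (\row_i if i == r then x else 1).
have SS : S s *m S s^-1 = 1%:M.
  rewrite /S mulmx_diag -diag_const_mx; congr diag_mx; apply/matrixP => i j.
  by rewrite !mxE; case: ifP => _; rewrite ?mulfV // mulr1.
have uS : S s \in unitmx by case/mulmx1_unit: SS.
pose V := S s^-1 *m g.
have VE i j : V i j = (if i == r then s^-1 else 1) * g i j.
  by rewrite /V /S mul_diag_mx !mxE.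
have VU : upper_unitriangular V.
  split=> [i|i j ji]; last by rewrite VE gU // mulr0.
  by rewrite VE gii; case: ifP => _; rewrite ?mulVf ?mulr1.
have uV : V \in unitmx.
  by apply: upper_unit VU.2 _ => i; rewrite VU.1 oner_neq0.
have gE : g = S s *m V by rewrite /V mulmxA SS mul1mx.
have ug : g \in unitmx by rewrite gE unitmx_mul uS.
have dg : \det g = s.
  rewrite -det_tr det_trig; last by apply/is_trig_mxP => i j ij; rewrite mxE gU.
  rewrite (bigD1 r) //= mxE gii eqxx big1 ?mulr1 // => i /negPf ir.
  by rewrite mxE gii ir.
have dgh : \det (inner_mx (g *m h)) = s * \det (inner_mx h).
  by rewrite ghE det_mulmx dg.
have gh0 : \det (inner_mx (g *m h)) != 0 by rewrite dgh mulf_neq0.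
have uh : inner_mx h \in unitmx by rewrite unitmxE unitfE.
have Sii i : S s i i = if i == r then s else 1 by rewrite mxE eqxx mxE.
have wS : weight_char (row_weight la) (S s) * s ^+ nth 0%N la (n' - r) = 1.
  have := weight_charE la (S := S s) (fun i => _).
  rewrite (bigD1 r) //= Sii eqxx big1 ?mulr1 => [|i /negPf ir]; last first.
    by rewrite Sii ir expr1n.
  rewrite Sii -(inj_eq val_inj) /= ltn_eqF // expr1n; apply => i.
  by rewrite Sii; case: ifP; rewrite ?oner_neq0.
set A := inner_mx h *m sec c *m invmx (inner_mx h).
have fA : evm (g *m A *m invmx g) f = s ^+ nth 0%N la (n' - r) * evm A f.
  pose B := V *m A *m invmx V.
  have <- : evm B f = evm A f by apply: (evm_unitriangular VU uV); rewrite mulmxKV.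
  have := fw.2 (S s) (diag_mx_is_diag _) uS => /(congr1 (evm (g *m A *m invmx g))).
  rewrite evm_conj_act; have -> : invmx (S s) *m (g *m A *m invmx g) *m S s = B.
    rewrite gE invmx_mul // !mulmxA mulVmx // mul1mx -!mulmxA mulVmx // mulmx1.
    by rewrite /B /A /V !mulmxA.
  by rewrite [in RHS]/evm /= mevalZ => ->; rewrite mulrA [_ ^+ _ * _]mulrC wS mul1r.
rewrite !hom_value_conj // dgh exprMn /tableau_weight exprD.
have -> : inner_mx (g *m h) *m sec c *m invmx (inner_mx (g *m h)) = g *m A *m invmx g.
  by rewrite ghE invmx_mul // !mulmxA.
by rewrite fA mulrACA.
Qed.

Lemma hom_pol_inner : inner hom_pol.
Proof.
move=> B phi h h' hh; rewrite !matev_hom_pol /hom_value.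
by have -> : inner_mx h = inner_mx h' by
  apply/matrixP => i j; rewrite !mxE; case: ifP => // /norP[i0 j0]; exact: hh.
Qed.

Lemma hom_pol_semi_inv : semi_inv (tableau_weight la d) hom_pol.
Proof.
apply: (semi_inv_density infk (iota := @mpolyC n k) (eps := fun c => meval c)).
- by move=> y z /(congr1 (mcoeff 0)); rewrite !mcoeffC eqxx !mulr1.
- by move=> c x; rewrite /= mevalC.
- by move=> a a0; apply: (@mpoly_vanish k _ k idfun) => // c; exact: a0.
move=> c h r r' s u r0 ur s0 h0; rewrite !matev_hom_pol.
exact: hom_value_semi_inv.
Qed.

(** A weight vector is recovered from its values on the conjugates of the
section, where it is a semi-invariant polynomial in the frame. *)
Lemma weight_vector_span :
  exists2 c : ssyt n' la -> kg, (forall T, Defs.invariant (c T)) &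
    f = \sum_T c T * b T.
Proof.
have [c cE] := semi_inv_span la_sorted la_size hom_pol_semi_inv hom_pol_inner.
exists (fun T => rho k n' (c T)) => [T|]; first exact: rho_invariant.
apply: evm_ext_frame => A uF; pose K := F A.
have Kcol : col 0 K = col 0 1%:M by exact: frame_col.
have K0 : \det (inner_mx K) != 0.
  by rewrite (det_inner_frame Kcol) -unitfE -unitmxE.
have uK : inner_mx K \in unitmx by rewrite unitmxE unitfE.
have VU := inner_factor Kcol uF; set V := K *m _ in VU.
have uV : V \in unitmx by rewrite unitmx_mul uF unitmx_inv.
pose B := inner_mx K *m sec (chi A) *m invmx (inner_mx K).
have fAB : evm A f = evm B f.
  apply: (evm_unitriangular VU uV); rewrite /V mulmxA (mul_frame TauK) /B !mulmxA.
  by rewrite mulmxKV.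
have := congr1 (matev (meval (chi A)) K) cE.
rewrite matev_hom_pol hom_value_conj // -/B -fAB matev_tableau_sum.
move/(mulfI (expf_neq0 d K0)) => ->.
rewrite rmorph_sum; apply: eq_bigr => T _; rewrite rmorphM evm_rho.
rewrite (evm_frame_tableau Tau) tableau_minor_inner //.
  by case/andP: (valP T).
by case/andP: (valP T).
Qed.

End Transport.

(** On the conjugates of a point of the section, invariants are constant, and
the frame takes all values with invertible block. A relation among the frame
minors thus gives one among the tableau polynomials with constant
coefficients. *)
Lemma frame_tableau_indep (c : ssyt n' la -> kg) :
  (forall T, Defs.invariant (c T)) -> \sum_T c T * b T = 0 -> forall T, c T = 0.
Proof.
move=> cI c0.
have csec v : forall T, evm (sec v) (c T) = 0.
  (* one factor det h makes the relation hold also where the block is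
     singular *)
  apply: (tableau_poly_indep (d := 1) la_sorted la_size).
  apply: (@mpoly_vanish k _ k idfun) => // w.
  pose h : 'M[k]_n := \matrix_(a, j) w (vidx a j).
  transitivity (matev idfun h (\sum_T evm (sec v) (c T) *: tableau_poly k 1 T)).
    by apply: eq_mmap => // i; rewrite /h mxE vidxK.
  rewrite (matev_tableau_sum 1 idfun h) expr1.
  have [->|h0] := eqVneq (\det (inner_mx h)) 0; first by rewrite mul0r.
  have uh : inner_mx h \in unitmx by rewrite unitmxE unitfE.
  pose A := inner_mx h *m sec v *m invmx (inner_mx h).
  have hcol : col 0 (inner_mx h) = col 0 1%:M.
    by apply/matrixP => i j; rewrite !mxE orbT.
  have FA : F A = inner_mx h by exact: frame_of_conj.
  suff -> : \sum_T evm (sec v) (c T) * tableau_minor (inner_mx h) (val T) =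
    evm A (\sum_T c T * b T) by rewrite c0 rmorph0 mulr0.
  rewrite rmorph_sum; apply: eq_bigr => T _; rewrite rmorphM (evm_frame_tableau Tau).
  rewrite FA; congr (_ * _).
  by apply/esym/(evm_invariant (cI T) uh); rewrite /A mulmxKV.
move=> T; apply: evm_ext_frame => A uF; rewrite rmorph0 -[RHS](csec (chi A) T).
by apply: (evm_invariant (cI T) uF); exact: mul_frame.
Qed.

Lemma frame_tableau_basis :
  invariant_basis (U_weight_space k (row_weight la)) (fun T : ssyt n' la => b T).
Proof.
split=> [T|f fw|c cI c0].
- exact: frame_tableau_weight.
- exact: weight_vector_span.
- exact: frame_tableau_indep.
Qed.

End Spanning.

(** * The antitranspose and the four families *)

Section Antitranspose.
Variables (R : comNzRingType) (n' : nat).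
Local Notation n := n'.+1.
Implicit Types A B : 'M[R]_n.

(** The reflection in the antidiagonal reverses products, as the transpose does,
but preserves the upper unitriangular group. *)
Definition antitr A : 'M[R]_n := \matrix_(i, j) A (rev_ord j) (rev_ord i).

Lemma antitrK : involutive antitr.
Proof. by move=> A; apply/matrixP => i j; rewrite !mxE !rev_ordK. Qed.

Lemma antitrM A B : antitr (A *m B) = antitr B *m antitr A.
Proof.
apply/matrixP => i j; rewrite !mxE (reindex_inj rev_ord_inj).
by apply: eq_bigr => l _; rewrite !mxE mulrC.
Qed.

Lemma antitr1 : antitr 1%:M = 1%:M.
Proof. by apply/matrixP => i j; rewrite !mxE (inj_eq rev_ord_inj) eq_sym. Qed.

Lemma antitrX A m : antitr (A ^+ m) = antitr A ^+ m.
Proof.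
elim: m => [|m IH]; first by rewrite !expr0; exact: antitr1.
by rewrite exprS exprSr -IH; exact: antitrM.
Qed.

Lemma char_poly_antitr A : char_poly (antitr A) = char_poly A.
Proof.
rewrite /char_poly -(det_perm_conj (perm (@rev_ord_inj n)) (char_poly_mx A)).
rewrite -det_tr; congr (\det _); apply/matrixP => i j.
by rewrite !mxE !permE (inj_eq rev_ord_inj) eq_sym.
Qed.

End Antitranspose.

Section Symmetry.
Variables (k : fieldType) (n' : nat).
Hypothesis infk : infinite_type k.
Local Notation n := n'.+1.
Local Notation kg := (polyfun k n').
Local Notation X := (xmx k n').

(** Precomposition with the antitranspose. *)
Definition twist : {rmorphism kg -> kg} :=
  mmap (@mpolyC _ k) (fun p => mxvec (antitr X) 0 p).

Lemma twist_xmx : map_mx twist X = antitr X.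
Proof.
apply/matrixP => i j; rewrite [LHS]mxE [X in twist X]mxE /twist /= mmapX mmap1U.
exact: mxvecE.
Qed.

Lemma evmZ A a (f : kg) : evm A (a *: f) = a * evm A f.
Proof. exact: mevalZ. Qed.

Lemma evm_twist A (f : kg) : evm A (twist f) = evm (antitr A) f.
Proof.
rewrite /twist /= rmorph_mmap; apply: eq_mmap => [c|p] /=.
  by rewrite /evm /= mevalC.
case/mxvec_indexP: p => i j; rewrite !mxvecE.
transitivity ((map_mx (evm A) (antitr X)) i j); first by rewrite [RHS]mxE.
rewrite -[in RHS](evm_xmx A) [LHS]mxE [RHS]mxE [RHS]mxE.
by rewrite [antitr X i j]mxE.
Qed.

Lemma twistK (f : kg) : twist (twist f) = f.
Proof. by apply: (evm_ext infk) => A; rewrite !evm_twist antitrK. Qed.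

Lemma unit_antitr (g : 'M[k]_n) : g \in unitmx -> antitr g \in unitmx.
Proof.
move=> ug; have : antitr g *m antitr (invmx g) = 1%:M.
  by rewrite -antitrM mulVmx // antitr1.
by case/mulmx1_unit.
Qed.

Lemma antitr_conj (g A : 'M[k]_n) : g \in unitmx ->
  antitr (invmx g *m A *m g) *m antitr g = antitr g *m antitr A.
Proof. by move=> ug; rewrite -!antitrM !mulmxA mulmxV // mul1mx. Qed.

Lemma evm_conj_twist (g A : 'M[k]_n) (f : kg) : g \in unitmx ->
  evm (antitr A) f =
  evm (antitr (invmx g *m A *m g)) (conj_act (antitr g) f).
Proof.
move=> ug; rewrite evm_conj_act -mulmxA antitr_conj // mulKmx //.
exact: unit_antitr.
Qed.

Lemma twist_invariant (f : kg) : Defs.invariant f -> Defs.invariant (twist f).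
Proof.
move=> fI g ug; apply: (evm_ext infk) => A; rewrite evm_conj_act !evm_twist.
by rewrite (evm_conj_twist A f ug) fI // unit_antitr.
Qed.

Definition dual_weight (chi : weight n') : weight n' := fun i => - chi (rev_ord i).

Lemma twist_weight (chi : weight n') (f : kg) :
  U_weight_space k chi f -> U_weight_space k (dual_weight chi) (twist f).
Proof.
move=> [fU fH]; split=> [g [g1 gU]|S Sd uS]; apply: (evm_ext infk) => A.
  have ug : g \in unitmx by apply: upper_unit => // i; rewrite g1 oner_neq0.
  rewrite evm_conj_act !evm_twist (evm_conj_twist A f ug) fU //.
  split=> [i|i j ji]; rewrite mxE ?g1 // gU //=.
  by have := ltn_ord i; lia.
rewrite evm_conj_act evm_twist.
have Sd' : is_diag_mx (antitr S).
  apply/is_diag_mxP => i j ij; rewrite mxE; apply: (is_diag_mxP Sd).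
  by rewrite (inj_eq val_inj) (inj_eq rev_ord_inj) eq_sym.
have S0 i : S i i != 0.
  move: uS; rewrite unitmxE unitfE det_trig; last first.
    by apply/is_trig_mxP => a b ab; apply: (is_diag_mxP Sd); rewrite neq_ltn ab.
  by move/prodf_neq0/(_ i isT).
have wS : weight_char (dual_weight chi) S * weight_char chi (antitr S) = 1.
  rewrite /weight_char (reindex_inj rev_ord_inj) -big_split big1 //= => i _.
  by rewrite /dual_weight rev_ordK mxE -expfzDr // addNr expr0z.
have := evm_conj_twist A f uS; rewrite fH //; last exact: unit_antitr.
by rewrite evmZ => eA; rewrite evmZ evm_twist eA mulrA wS mul1r.
Qed.

Lemma weight_spaceZ (chi : weight n') a (f : kg) :
  U_weight_space k chi f -> U_weight_space k chi (a *: f).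
Proof.
move=> [fU fH]; split=> [g gU|S Sd uS]; rewrite /conj_act comp_mpolyZ.
  by rewrite [_ \mPo _]fU.
by rewrite [_ \mPo _]fH // scalerA mulrC -scalerA.
Qed.

Lemma invariantZ a (f : kg) : Defs.invariant f -> Defs.invariant (a *: f).
Proof. by move=> fI g ug; rewrite /conj_act comp_mpolyZ [_ \mPo _]fI. Qed.

Lemma twistZ a f : twist (a *: f) = a *: twist f.
Proof. by rewrite /twist /= mmapZ mul_mpolyC. Qed.

(** The antitranspose is an involution that permutes the invariants and
dualizes the weights, so it carries bases to bases. *)
Lemma twist_basis (I : finType) (chi : weight n') (u v : I -> kg) (s : nat) :
  invariant_basis (U_weight_space k chi) u ->
  (forall i, v i = (-1) ^+ s *: twist (u i)) ->
  invariant_basis (U_weight_space k (dual_weight chi)) v.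
Proof.
move=> [uM uspan uind] vE; split=> [i|f fM|c cI c0].
- by rewrite vE; apply: weight_spaceZ; exact: twist_weight.
- have ddchi : dual_weight (dual_weight chi) =1 chi.
    by move=> i; rewrite /dual_weight rev_ordK opprK.
  have [|c cI fE] := uspan (twist f).
    have [tU tH] := twist_weight fM; split=> // S Sd uS; rewrite tH //.
    suff -> : weight_char (dual_weight (dual_weight chi)) S = weight_char chi S by [].
    by apply: eq_bigr => i _; rewrite ddchi.
  exists (fun i => (-1) ^+ s *: twist (c i)) => [i|].
    by apply: invariantZ; exact: twist_invariant.
  rewrite -[LHS]twistK fE rmorph_sum; apply: eq_bigr => i _.
  rewrite rmorphM vE -scalerAl -scalerAr scalerA -exprD addnn -mul2n exprM.
  by rewrite sqrrN expr1n expr1n scale1r.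
have tc : \sum_i twist (c i) * u i = 0.
  transitivity ((-1) ^+ s *: twist (\sum_i c i * v i)); last first.
    by rewrite c0 rmorph0 scaler0.
  rewrite rmorph_sum scaler_sumr; apply: eq_bigr => i _; rewrite vE rmorphM twistZ twistK -scalerAr scalerA.
  by rewrite -exprD addnn -mul2n exprM sqrrN expr1n expr1n scale1r.
move=> i; rewrite -[LHS]twistK (uind _ _ tc) ?rmorph0 // => j.
exact: twist_invariant.
Qed.

(** The antitranspose sends last rows to first rows in reverse order, hence the
sign. *)
Lemma twist_minor (Mu Mv : 'I_n -> nat -> kg) (t : seq nat) :
  (size t <= n)%N -> all (fun j => j < n)%N t ->
  (forall i j, (j < n)%N -> twist (Mu i j) = Mv (rev_ord i) j) ->
  \det (first_rows (\matrix_(i < n, j < size t) Mv i (nth 0%N t j))) =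
  (-1) ^+ (perm (@rev_ord_inj (size t))) *:
    twist (\det (last_rows (\matrix_(i < n, j < size t) Mu i (nth 0%N t j)))).
Proof.
move=> tn /allP tlt Muv; set s := perm _; rewrite -det_map_mx.
have -> : map_mx twist (last_rows (\matrix_(i < n, j < size t) Mu i (nth 0%N t j))) =
    row_perm s (first_rows (\matrix_(i < n, j < size t) Mv i (nth 0%N t j))).
  apply/matrixP => a c; rewrite !mxE Muv ?tlt ?mem_nth //; congr (Mv _ _).
  apply: val_inj; rewrite permE /=; have := ltn_ord a => lta.
  rewrite !inordK; lia.
rewrite row_permE det_mulmx det_perm scaler_sign -mulr_sign mulrA -expr2.
by rewrite sqrr_sign mul1r.
Qed.

End Symmetry.

Section Families.
Variables (k : closedFieldType) (n' : nat) (la : seq nat).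
Local Notation n := n'.+1.
Local Notation kg := (polyfun k n').
Local Notation Apol := {mpoly k[n]}.
Local Notation X := (xmx k n').
Hypotheses (la_sorted : sorted geq la) (la_size : (size la <= n')%N).

Let infk : infinite_type k := @closed_field_infinite k.

(** The coefficients of the universal monic polynomial of degree n, whose lower
coefficients are the variables. *)
Definition generic_char_coef (l : nat) : Apol :=
  if insub l is Some i then 'X_(i : 'I_n) else (l == n)%:R.

Lemma rho_char_coef l : rho k n' (generic_char_coef l) = (char_poly X)`_l.
Proof.
rewrite /generic_char_coef; case: insubP => [i _ <-|].
  by rewrite /rho /= mmapX mmap1U.
rewrite -leqNgt leq_eqVlt rmorph_nat => /orP[/eqP <-|ltl].
  have /monicP := char_poly_monic X; rewrite lead_coefE size_char_poly /= => ->.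
  by rewrite eqxx.
by rewrite nth_default ?size_char_poly // gtn_eqF.
Qed.

(** The change of basis from the Krylov basis to the gradients of the traces of
exterior powers, as given by partial_s. It is upper triangular with signs on
the diagonal because the characteristic polynomial is monic. *)
Definition s_frame : 'M[Apol]_n :=
  \matrix_(q, t) ((-1) ^+ t * generic_char_coef (n - t + q)).

Lemma s_frame_upper (q t : 'I_n) : (t < q)%N -> s_frame q t = 0.
Proof.
move=> tq; have ltn_q : (n < n - t + q)%N by have := ltn_ord t; lia.
rewrite mxE /generic_char_coef insubF; last by rewrite ltnNge ltnW.
by rewrite gtn_eqF // mulr0.
Qed.

Lemma s_frame_diag (t : 'I_n) : s_frame t t = (-1) ^+ t.
Proof.
have e : (n - t + t = n)%N by rewrite subnK // ltnW.
by rewrite mxE e /generic_char_coef insubF ?ltnn // eqxx mulr1.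
Qed.

Lemma s_frame_unit : s_frame \in unitmx.
Proof.
rewrite -unitmx_tr unitmxE det_trig; last first.
  by apply/is_trig_mxP => i j ij; rewrite mxE s_frame_upper.
under eq_bigr => i _ do rewrite mxE s_frame_diag.
by rewrite prodrXr unitrX // unitrN1.
Qed.

Lemma s_frame_col : col 0 s_frame = col 0 1%:M.
Proof.
apply/matrixP => q t; rewrite [LHS]mxE [RHS]mxE [RHS]mxE.
have [->|q0] := eqVneq q 0; first by rewrite s_frame_diag.
by rewrite s_frame_upper // lt0n.
Qed.

Lemma frame_pol_s (i t : 'I_n) :
  frame_pol s_frame i t = partial ord0 i (s_ k n' t.+1).
Proof.
rewrite partial_s // mulr_sumr [LHS]mxE; apply: eq_bigr => q _.
rewrite [krylov X i q]mxE [map_mx _ _ q t]mxE [s_frame q t]mxE.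
by rewrite rmorphM rmorph_sign rho_char_coef mulrC -mulrA.
Qed.

Lemma frame_pol_1 (i t : 'I_n) :
  frame_pol (1%:M : 'M[Apol]_n) i t = (X ^+ t *m std_basis k 0) i 0.
Proof.
by rewrite /frame_pol map_mx1 mulmx1 krylov_col.
Qed.

Lemma column_bounds (T : ssyt n' la) (c : 'I_(head 0%N la)) :
  (size (column (val T) c) <= n')%N /\
  all (fun j => j < n)%N (column (val T) c).
Proof.
have /andP[Tp Ts] := valP T.
have [_ _ lt_t] := semistandard_column la_sorted c Tp Ts; split=> //.
by rewrite size_column // (leq_trans (column_height_le la_sorted c)).
Qed.

Lemma bottom_minor_col (K : 'M[kg]_n) (M : 'I_n -> nat -> kg) t :
  all (fun j => j < n)%N t -> (forall i j : 'I_n, K i j = M i j) ->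
  bottom_minor K t =
    \det (last_rows (\matrix_(i < n, j < size t) M i (nth 0%N t j))).
Proof.
move=> /allP tlt KM; congr (\det _); apply/matrixP => a c; rewrite !mxE KM.
by rewrite inordK // tlt // mem_nth.
Qed.

Lemma u_frame (T : ssyt n' la) : u_ k T = frame_tableau s_frame T :> kg.
Proof.
apply: eq_bigr => c _; have [_ tlt] := column_bounds T c.
rewrite (bottom_minor_col (M := fun i t => partial ord0 i (s_ k n' t.+1)) tlt) //.
exact: frame_pol_s.
Qed.

Lemma ut_frame (T : ssyt n' la) : ut_ k T = frame_tableau 1%:M T :> kg.
Proof.
apply: eq_bigr => c _; have [_ tlt] := column_bounds T c.
rewrite (bottom_minor_col (M := fun i t => (X ^+ t *m std_basis k 0) i 0) tlt) //.
exact: frame_pol_1.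
Qed.

Lemma eq_invariant_basis (I : finType) (M : kg -> Prop) (u v : I -> kg) :
  u =1 v -> invariant_basis M u -> invariant_basis M v.
Proof.
move=> uv [uM uspan uind]; split=> [i|f /uspan[c cI fE]|c cI c0].
- by rewrite -uv.
- by exists c => //; rewrite fE; apply: eq_bigr => i _; rewrite uv.
- by apply: uind => //; rewrite -[RHS]c0; apply: eq_bigr => i _; rewrite uv.
Qed.

Lemma u_basis : invariant_basis (U_weight_space k (row_weight la))
  (fun T : ssyt n' la => u_ k T).
Proof.
apply: (eq_invariant_basis (fun T => esym (u_frame T))).
exact: (frame_tableau_basis infk la_sorted la_size (mulmxV s_frame_unit) s_frame_col).
Qed.

Lemma ut_basis : invariant_basis (U_weight_space k (row_weight la))
  (fun T : ssyt n' la => ut_ k T).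
Proof.
apply: (eq_invariant_basis (fun T => esym (ut_frame T))).
exact: (frame_tableau_basis infk la_sorted la_size (mulmx1 _) erefl).
Qed.

(** The accumulated sign of the reversals of the rows, one for each column of
the shape; it is the same for all tableaux of that shape. *)
Let sign_exp := (\sum_(c < head 0%N la)
  odd_perm (perm (@rev_ord_inj (column_height la c))))%N.

Lemma twist_tableau (Mu Mv : 'I_n -> nat -> kg) (T : ssyt n' la) :
  (forall i j, (j < n)%N -> twist k n' (Mu i j) = Mv (rev_ord i) j) ->
  tableau_prod (fun t => \det (first_rows
    (\matrix_(i < n, j < size t) Mv i (nth 0%N t j)))) (val T) =
  (-1) ^+ sign_exp *: twist k n' (tableau_prod (fun t => \det (last_rows
    (\matrix_(i < n, j < size t) Mu i (nth 0%N t j)))) (val T)).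
Proof.
move=> Muv; rewrite /sign_exp -prodrXr rmorph_prod -scaler_prod.
apply: eq_bigr => c _; have [tn tlt] := column_bounds T c.
by rewrite (twist_minor (leqW tn) tlt Muv) size_column.
Qed.

Lemma twist_krylov (i : 'I_n) q :
  twist k n' ((X ^+ q) i 0) = (X ^+ q) ord_max (rev_ord i).
Proof.
transitivity ((map_mx (twist k n') (X ^+ q)) i 0); first by rewrite [RHS]mxE.
rewrite rmorphXn /= twist_xmx -antitrX [LHS]mxE; congr (_ _ _).
by apply: val_inj; rewrite /= subSS subn0.
Qed.

Lemma twist_char_coef l : twist k n' (char_poly X)`_l = (char_poly X)`_l.
Proof.
rewrite -(coef_map (twist k n')) /= map_char_poly twist_xmx.
by rewrite char_poly_antitr.
Qed.

Lemma twist_partial_s (i : 'I_n) t : (t < n)%N ->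
  twist k n' (partial ord0 i (s_ k n' t.+1)) =
  partial (rev_ord i) ord_max (s_ k n' t.+1).
Proof.
move=> tn; rewrite !partial_s // rmorphM rmorph_sign rmorph_sum; congr (_ * _).
by apply: eq_bigr => q _; rewrite rmorphM twist_char_coef twist_krylov.
Qed.

Lemma v_basis :
  invariant_basis (U_weight_space k (dual_weight (row_weight la)))
  (fun T : ssyt n' la => v_ k T).
Proof.
apply: (twist_basis infk u_basis (s := sign_exp)) => T.
exact: (twist_tableau (Mu := fun i t => partial ord0 i (s_ k n' t.+1))
  (Mv := fun i t => partial i ord_max (s_ k n' t.+1)) T twist_partial_s).
Qed.

Lemma vt_basis :
  invariant_basis (U_weight_space k (dual_weight (row_weight la)))
  (fun T : ssyt n' la => vt_ k T).
Proof.
apply: (twist_basis infk ut_basis (s := sign_exp)) => T.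
apply: (twist_tableau (Mu := fun i t => (X ^+ t *m std_basis k 0) i 0)
  (Mv := fun i t => (X^T ^+ t *m std_basis k ord_max) i 0) T) => i t _.
have -> : (X ^+ t *m std_basis k 0) i 0 = (X ^+ t) i 0.
  by rewrite -colE mxE.
rewrite twist_krylov -colE mxE.
have -> : X^T ^+ t = (X ^+ t)^T.
  elim: t => [|t IH]; first by rewrite !expr0; exact: esym (trmx1 _ _).
  by rewrite exprS exprSr IH; exact: esym (trmx_mul _ _).
by rewrite mxE.
Qed.

End Families.

Lemma eq_weight_space (k : fieldType) (n' : nat) (chi chi' : weight n')
    (f : polyfun k n') : chi =1 chi' ->
  U_weight_space k chi f -> U_weight_space k chi' f.
Proof.
move=> cc [fU fH]; split=> // S Sd uS; rewrite fH //.
suff -> : weight_char chi S = weight_char chi' S by [].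
by apply: eq_bigr => i _; rewrite cc.
Qed.

Lemma eq_weight_basis (k : fieldType) (n' : nat) (chi chi' : weight n')
    (I : finType) (u : I -> polyfun k n') : chi =1 chi' ->
  invariant_basis (U_weight_space k chi) u ->
  invariant_basis (U_weight_space k chi') u.
Proof.
move=> cc [uM uspan uind]; split=> // [i|f fM].
  exact: eq_weight_space (uM i).
by apply: uspan; apply: eq_weight_space fM => i; rewrite cc.
Qed.

Theorem theorem2 (k : closedFieldType) (n' : nat) (r : nat) (la : seq nat)
    (hn : (2 <= n'.+1)%N) (hla : is_partition_of r la)
    (hlen : (size la <= n'.+1 - 1)%N) :
  let lam := pad_weight n' la in
  let row := pad_weight n' [:: r] in
  (invariant_basis (U_weight_space k (bracket row lam))
     (fun T : ssyt n' la => u_ k T) /\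
   invariant_basis (U_weight_space k (bracket row lam))
     (fun T : ssyt n' la => ut_ k T)) /\
  (invariant_basis (U_weight_space k (bracket lam row))
     (fun T : ssyt n' la => v_ k T) /\
   invariant_basis (U_weight_space k (bracket lam row))
     (fun T : ssyt n' la => vt_ k T)).
Proof.
move=> lam row; have [la_sorted _ la_sum] := hla.
have la_size : (size la <= n')%N by rewrite subn1 in hlen.
have dualE : dual_weight (row_weight (n' := n') la) =1 bracket lam row.
  move=> i; rewrite /dual_weight /row_weight /bracket la_sum rev_ordK opprB.
  by [].
rewrite /lam /row -la_sum; split; split.
- exact: u_basis.
- exact: ut_basis.
- apply: eq_weight_basis (v_basis k la_sorted la_size); rewrite la_sum.
  exact: dualE.
- apply: eq_weight_basis (vt_basis k la_sorted la_size); rewrite la_sum.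
  exact: dualE.
Qed.
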